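(* Let $G=\mathrm{U}(1)$ act non-trivially (and isometrically) on the riemannian 3-manifold $(N,g_N)$, with Killing field $\nu$ and moment map $\mu$. Let $\alpha,\beta,\gamma\in\mathbb{R}$, and consider the BPS equations $$\star_M d^A\phi-\phi^{*A}(\Sigma+3\mu^\sharp)=0,\qquad \phi^{*A}(\alpha\Sigma+\beta\mu^\sharp+\gamma\nu)=0$$ for a section $\phi$ of $P\times_{\mathrm{U}(1)}N$ and a connection $A$, with curvature $F$, on a principal $\mathrm{U}(1)$-bundle $P$ over a riemannian 3-manifold $(M,g_M)$. Then these equations have solutions with $F\neq0$ only when $\alpha=\beta=\gamma=0$. When $\alpha=\beta=\gamma=0$, the solutions consist (locally) of the identity map $\phi:M=N\to N$, a choice of connection $A$ such that $$\iota_\nu A=\iota_{\mu^\sharp}A=\mathcal L_{\mu^\sharp}A=0,$$ and a metric $g_M$ given by $$g_M=g_\mu+\bigl(1+3\star_N(F\wedge\mu)\bigr)g_C,$$ in which $g_\mu=\mu^2/\mu(\mu^\sharp)$ and $g_C=\phi^{*A}g_N-g_\mu$.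
   Context: $M$ and $N$ are oriented, $V_N$ is the volume form of $g_N$, and $\star_M,\star_N$ are the Hodge stars of $g_M,g_N$. The Lie algebra $\mathfrak u(1)\cong\mathbb{R}$ is generated by $1$; $\nu$ is the vector field on $N$ given by $\nu(y)=\frac{d}{dt}\big|_{t=0}\exp(-t)\cdot y$. The moment map is a $\mathrm{U}(1)$-invariant 1-form $\mu$ on $N$ satisfying $d\mu=\iota_\nu V_N$ and $\iota_\nu\mu=0$; $\mu^\sharp$ is the vector field dual to $\mu$, i.e. $g_N(\mu^\sharp,\cdot)=\mu$, and $\mu^2=\mu\otimes\mu$. The $TN$-valued 2-form $\Sigma$ is defined by $g_N(u,\Sigma(v,w))=V_N(u,v,w)$ for all $u,v,w\in TN$. In a local trivialisation of $P$, $\phi$ is a map from $M$ to $N$, $A$ is a real 1-form and $F=dA$. In local coordinates $y^\lambda$ on $N$, the covariant differential is $d^A\phi=(d\phi^\lambda-A\,\nu^\lambda(\phi))\,\partial/\partial y^\lambda$, a section of $T^*M\otimes\phi^*TN$. The equivariant pullbacks are $$\phi^{*A}\Sigma=\tfrac12\Sigma^{\lambda}{}_{\rho\sigma}(\phi)\,d^A\phi^\rho\wedge d^A\phi^\sigma\otimes\tfrac{\partial}{\partial y^\lambda},\qquad \phi^{*A}\mu^\sharp=F\otimes\mu^\sharp(\phi),\qquad \phi^{*A}\nu=F\otimes\nu(\phi),$$ which are sections of $\Lambda^2M\otimes\phi^*TN$, and $(\phi^{*A}g_N)(v,w)=g_N(d^A\phi(v),d^A\phi(w))$.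
   Formalization: The English fails if F≠0 only where ν(φ)=0, and at exceptional points: here F≠0 is required at a point with ν(φ)≠0, and the normal form is claimed where ν(φ), μ(φ) are nonzero and d^Aφ is invertible, points shown to be dense in {F≠0, ν(φ)≠0}. *)

(* Defs.v *)
From HB Require Import structures.
From mathcomp Require Import all_boot all_order all_algebra.
From mathcomp Require Import all_classical all_reals all_analysis.

Set Implicit Arguments.
Unset Strict Implicit.
Unset Printing Implicit Defensive.

Import Order.TTheory GRing.Theory Num.Theory.
Import numFieldNormedType.Exports.

Local Open Scope classical_set_scope.
Local Open Scope ring_scope.

(* Conventions. Coordinates live in 'rV_3. Tangent vectors and covectors are
   both row vectors of components; a covector m is evaluated on v as
   (m *m v^T) 0 0. A linear map is a matrix acting on tangent row vectors from
   the right, as 'J does; a bilinear form B is evaluated as v *m B *m w^T.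
   Tensor fields on a manifold are families of component functions, indexed by
   the charts and depending on the coordinates of the chart. *)

Section Smooth.
Context {R : realType}.

(* Meant for open U. *)
Fixpoint Ck (V W : normedModType R) (n : nat) (U : set V) (f : V -> W) : Prop :=
  match n with
  | 0%N => forall x, U x -> {for x, continuous f}
  | k.+1 => (forall x, U x -> differentiable f x) /\
            forall v : V, Ck k U (fun x => 'D_v f x)
  end.

Definition smooth (V W : normedModType R) (U : set V) (f : V -> W) : Prop :=
  forall n, Ck n U f.

End Smooth.

Section PointwiseAlgebra.
Context {R : realType}.
Implicit Types (g B F E : 'M[R]_3) (u v w m n : 'rV[R]_3).

Definition pairing m v : R := (m *m v^T) 0 0.

Definition bil B v w : R := (v *m B *m w^T) 0 0.

Definition e_ (k : 'I_3) : 'rV[R]_3 := delta_mx 0 k.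

(* Volume form in a positively oriented frame. *)
Definition vol g u v w : R :=
  Num.sqrt (\det g) * \det (\matrix_(k < 3) [:: u; v; w]`_k).

Definition sharp g m : 'rV[R]_3 := m *m invmx g.

(* The vector S such that g(u, S) = vol(u, v, w) for all u. *)
Definition Sigma g v w : 'rV[R]_3 := sharp g (\row_k vol g (e_ k) v w).

(* The Hodge star of a 1-form, m |-> iota_(m^sharp) vol. *)
Definition hodge1 g m v w : R := vol g (sharp g m) v w.

Definition hodge3 g (t : 'rV[R]_3 -> 'rV[R]_3 -> 'rV[R]_3 -> R) : R :=
  t (e_ 0) (e_ 1) (e_ 2%:R) / vol g (e_ 0) (e_ 1) (e_ 2%:R).

Definition wedge21 F m u v w : R :=
  bil F u v * pairing m w + bil F v w * pairing m u + bil F w u * pairing m v.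

(* The Hodge star applied to the form part of a vector-valued 1-form E. *)
Definition hodge1_vec g E v w : 'rV[R]_3 := \row_k hodge1 g (col k E)^T v w.

(* At a point: E is d^A phi, F the curvature, m and n the values of mu and nu.
   The pullbacks below are those of Sigma and of a vector X. *)
Definition pull_Sigma gN E v w : 'rV[R]_3 := Sigma gN (v *m E) (w *m E).

Definition pull_vec F X v w : 'rV[R]_3 := bil F v w *: X.

Definition bps_eqs (al be ga : R) (gM gN : 'M[R]_3) m n E F : Prop :=
  forall v w,
    hodge1_vec gM E v w
      - (pull_Sigma gN E v w + 3 *: pull_vec F (sharp gN m) v w) = 0 /\
    al *: pull_Sigma gN E v w + be *: pull_vec F (sharp gN m) v w
      + ga *: pull_vec F n v w = 0.

(* g_mu + (1 + 3 * (F /\ mu)) g_C, for phi the identity: then d^A phi is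
   1 - A (x) nu. *)
Definition std_metric gN m n (a : 'rV[R]_3) F : 'M[R]_3 :=
  let gmu := (pairing m (sharp gN m))^-1 *: (m^T *m m) in
  let E := 1%:M - a^T *m n in
  let gC := E *m gN *m E^T - gmu in
  gmu + (1 + 3 * hodge3 gN (wedge21 F m)) *: gC.

Definition extd (om : 'rV[R]_3 -> 'rV[R]_3) (u : 'rV[R]_3) : 'M[R]_3 :=
  'J om u - ('J om u)^T.

(* (L_X om)_b = X^a d_a om_b + om_a d_b X^a. *)
Definition lie_form (X om : 'rV[R]_3 -> 'rV[R]_3) (u : 'rV[R]_3) : 'rV[R]_3 :=
  X u *m 'J om u + om u *m ('J X u)^T.

End PointwiseAlgebra.

(* Smooth oriented 3-manifolds, presented by an oriented atlas. *)
Record manifold3 (R : realType) := Manifold3 {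
  carrier :> topologicalType;
  chart : Type;
  dom : chart -> set carrier;
  coord : chart -> carrier -> 'rV[R]_3;
  point : chart -> 'rV[R]_3 -> carrier;
  manifold3_hausdorff : hausdorff_space carrier;
  manifold3_countable : @second_countable carrier;
  dom_open : forall c, open (dom c);
  dom_cover : forall x, exists c, dom c x;
  image_open : forall c, open (coord c @` dom c);
  coordK : forall c x, dom c x -> point c (coord c x) = x;
  coord_continuous : forall c x, dom c x -> {for x, continuous (coord c)};
  point_continuous : forall c u,
    (coord c @` dom c) u -> {for u, continuous (point c)};
  transition_smooth : forall c d,
    smooth (coord c @` (dom c `&` dom d)) (coord d \o point c);
  transition_oriented : forall c d x, dom c x -> dom d x ->
    0 < \det ('J (coord d \o point c) (coord c x))
}.

Section Manifolds.
Context {R : realType}.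

Definition local_rep (M N : manifold3 R) (f : M -> N) (c : chart M) (d : chart N)
  : 'rV[R]_3 -> 'rV[R]_3 := coord d \o f \o point c.

Definition jac (M N : manifold3 R) (f : M -> N) (c : chart M) (d : chart N)
  (x : M) : 'M[R]_3 := 'J (local_rep f c d) (coord c x).

Definition smooth_map (M N : manifold3 R) (U : set M) (f : M -> N) : Prop :=
  (forall x, U x -> {for x, continuous f}) /\
  forall c d, smooth (coord c @` (U `&` dom c `&` f @^-1` dom d))
                     (local_rep f c d).

Definition smooth_fun (M : manifold3 R) (U : set M) (h : M -> R) : Prop :=
  forall c, smooth (coord c @` (U `&` dom c)) (h \o point c).

Definition dfun (M : manifold3 R) (h : M -> R) (c : chart M) (x : M)
  : 'rV[R]_3 := \row_k 'D_(e_ k) (h \o point c) (coord c x).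

Definition components (M : manifold3 R) := chart M -> 'rV[R]_3 -> 'rV[R]_3.

Definition smooth_form (M : manifold3 R) (U : set M) (om : components M)
  : Prop :=
  (forall c, smooth (coord c @` (U `&` dom c)) (om c)) /\
  forall c d x, U x -> dom c x -> dom d x ->
    om c (coord c x) = om d (coord d x) *m (jac idfun c d x)^T.

Definition metric_components (M : manifold3 R) :=
  chart M -> 'rV[R]_3 -> 'M[R]_3.

Definition riemannian (M : manifold3 R) (g : metric_components M) : Prop :=
  [/\ forall c, smooth (coord c @` dom c) (g c),
      forall c x, dom c x -> (g c (coord c x))^T = g c (coord c x),
      forall c x v, dom c x -> v != 0 -> 0 < bil (g c (coord c x)) v v &
      forall c d x, dom c x -> dom d x ->
        g c (coord c x) =
          jac idfun c d x *m g d (coord d x) *m (jac idfun c d x)^T].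

End Manifolds.

(* U(1) is R / 2 pi Z through t |-> exp(t): act t is the action of exp(t). *)
Record u1_action (R : realType) (N : manifold3 R) := U1Action {
  act :> R -> N -> N;
  act0 : forall y, act 0 y = y;
  actD : forall s t y, act (s + t) y = act s (act t y);
  act_2pi : forall y, act (2 * pi) y = y;
  act_continuous : continuous (fun ty : R * N => act ty.1 ty.2);
  act_smooth : forall c d,
    smooth [set tu : R * 'rV[R]_3 |
              (coord c @` dom c) tu.2 /\ dom d (act tu.1 (point c tu.2))]
           (fun tu : R * 'rV[R]_3 => coord d (act tu.1 (point c tu.2)))
}.

Section Actions.
Context {R : realType} (N : manifold3 R).

Definition nontrivial_action (a : u1_action N) : Prop :=
  exists t y, a t y <> y.

Definition isometric (g : metric_components N) (a : u1_action N) : Prop :=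
  forall t c d y, dom c y -> dom d (a t y) ->
    g c (coord c y) =
      jac (a t) c d y *m g d (coord d (a t y)) *m (jac (a t) c d y)^T.

Definition nu (a : u1_action N) : components N :=
  fun c u => derive1 (fun t : R => coord c (a (- t) (point c u))) 0.

Definition moment_map (g : metric_components N) (a : u1_action N)
  (mu : components N) : Prop :=
  [/\ smooth_form setT mu,
      forall t c d y, dom c y -> dom d (a t y) ->
        mu c (coord c y) = mu d (coord d (a t y)) *m (jac (a t) c d y)^T,
      forall c y, dom c y -> let u := coord c y in forall v w,
        bil (extd (mu c) u) v w = vol (g c u) (nu a c u) v w &
      forall c y, dom c y -> let u := coord c y in
        pairing (mu c u) (nu a c u) = 0].

Definition mu_sharp (g : metric_components N) (mu : components N)
  : components N := fun c u => sharp (g c u) (mu c u).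

End Actions.

(* A principal U(1)-bundle: a fibrewise free and transitive right action (ract t
   being the action of exp(t)) on the total space, whose smooth structure is
   carried by the local sections sec i over the cover base i. *)
Record u1_bundle (R : realType) (M : manifold3 R) := U1Bundle {
  total : Type;
  proj : total -> M;
  ract : total -> R -> total;
  ract0 : forall p, ract p 0 = p;
  ractD : forall p s t, ract p (s + t) = ract (ract p s) t;
  proj_ract : forall p t, proj (ract p t) = proj p;
  ract_transitive : forall p q, proj p = proj q -> exists t, q = ract p t;
  ract_free : forall p t,
    ract p t = p <-> exists k : int, t = k%:~R * (2 * pi);
  triv : Type;
  base : triv -> set M;
  base_open : forall i, open (base i);
  base_cover : forall x, exists i, base i x;
  sec : triv -> M -> total;
  secK : forall i x, base i x -> proj (sec i x) = x;
  sec_smooth : forall i j x, base i x -> base j x ->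
    exists W h, [/\ open W, W x, smooth_fun W h &
      forall y, W y -> sec j y = ract (sec i y) (h y)]
}.

Section Gauge.
Context {R : realType} (M : manifold3 R) (P : u1_bundle M).

(* Smooth sections of P over U, i.e. local trivialisations over U. *)
Definition local_section (U : set M) (s : M -> total P) : Prop :=
  (forall x, U x -> proj (s x) = x) /\
  forall i x, U x -> base i x ->
    exists W h, [/\ open W, W x, smooth_fun W h &
      forall y, W y -> s y = ract (sec i y) (h y)].

(* conn s is the 1-form A in the local trivialisation s, i.e. the pullback by s
   of the connection form. *)
Record connection := Connection {
  conn : (M -> total P) -> components M;
  conn_smooth : forall U s, open U -> local_section U s ->
    smooth_form U (conn s);
  conn_gauge : forall U s s' h, open U ->
    local_section U s -> local_section U s' -> smooth_fun U h ->
    (forall y, U y -> s' y = ract (s y) (h y)) ->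
    forall c y, U y -> dom c y ->
      conn s' c (coord c y) = conn s c (coord c y) + dfun h c y
}.

(* Smooth sections of P x_U(1) N, as equivariant maps P -> N. *)
Record assoc_section (N : manifold3 R) (a : u1_action N) := AssocSection {
  field :> total P -> N;
  field_equivariant : forall p t, field (ract p t) = a (- t) (field p);
  field_smooth : forall U s, open U -> local_section U s ->
    smooth_map U (field \o s)
}.

Context (N : manifold3 R) (a : u1_action N).
Variables (gM : metric_components M) (gN : metric_components N).
Variables (mu : components N) (A : connection) (phi : assoc_section a).

(* A local trivialisation s around x, with charts at x and at phi(x). *)
Definition local_data (x : M) (U : set M) (s : M -> total P)
  (c : chart M) (d : chart N) : Prop :=
  [/\ open U, U x, local_section U s, dom c x & dom d (phi (s x))].

Definition curvature (s : M -> total P) (c : chart M) (x : M) : 'M[R]_3 :=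
  extd (conn A s c) (coord c x).

(* d^A phi at x. *)
Definition covd (s : M -> total P) (c : chart M) (d : chart N) (x : M)
  : 'M[R]_3 :=
  jac (phi \o s) c d x
    - (conn A s c (coord c x))^T *m nu a d (coord d (phi (s x))).

Definition bps_at (al be ga : R) (x : M) : Prop :=
  forall U s c d, local_data x U s c d ->
    let y := coord d (phi (s x)) in
    bps_eqs al be ga (gM c (coord c x)) (gN d y) (mu d y) (nu a d y)
      (covd s c d x) (curvature s c x).

(* F and nu(phi) do not vanish at x. *)
Definition curved_at (x : M) : Prop :=
  exists U s c d, [/\ local_data x U s c d, curvature s c x != 0 &
    nu a d (coord d (phi (s x))) != 0].

(* nu(phi) and mu(phi) do not vanish and d^A phi is invertible at x. *)
Definition regular_at (x : M) : Prop :=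
  exists U s c d, let y := coord d (phi (s x)) in
    [/\ local_data x U s c d, nu a d y != 0, mu d y != 0 &
        covd s c d x \in unitmx].

(* Near x and in a suitable local trivialisation s, phi is an orientation
   preserving diffeomorphism from U to an open subset V of N (with inverse psi)
   and, once it is used to identify U with V, so that phi becomes the identity
   map, A and g_M are the 1-form om and the metric std_metric on V. *)
Definition standard_at (x : M) : Prop :=
  exists (U : set M) (s : M -> total P) (V : set N) (psi : N -> M)
         (om : components N),
  [/\ [/\ open U, U x & local_section U s],
      [/\ open V, smooth_map V psi,
          forall z, U z -> V (phi (s z)) /\ psi (phi (s z)) = z,
          forall y, V y -> U (psi y) /\ phi (s (psi y)) = y &
          forall z c d, U z -> dom c z -> dom d (phi (s z)) ->
            0 < \det (jac (phi \o s) c d z)],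
      smooth_form V om /\
      (forall d y, V y -> dom d y -> let v := coord d y in
        [/\ mu d v != 0,
            pairing (om d v) (nu a d v) = 0,
            pairing (om d v) (mu_sharp gN mu d v) = 0 &
            lie_form (mu_sharp gN mu d) (om d) v = 0]) &
      forall z c d, U z -> dom c z -> dom d (phi (s z)) ->
        let u := coord c z in
        let v := coord d (phi (s z)) in
        let T := jac (phi \o s) c d z in
        conn A s c u = om d v *m T^T /\
        gM c u = T *m std_metric (gN d v) (mu d v) (nu a d v) (om d v)
                        (extd (om d) v) *m T^T].

End Gauge.

(* Main.v *)
(* Write E = d^A phi, let f be the axial vector of F, and s the square roots of
   the metric determinants. The first equation is then the matrix identity
     s_M g_M^-1 E g_N = s_N cof E + 3 f^T mu.
   If E is invertible, multiplying by E^T on the left and by g_N^-1 on the right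
   makes the left-hand side symmetric, whence F in the frame E is a multiple of
   iota_(mu^sharp) V_N and g_M is the stated conformal change of g_N orthogonally
   to mu^sharp; conversely these two conditions imply the equation. If E is
   singular on an open set, its image is orthogonal to nu, so that phi^*(nu^flat) =
   |nu|^2 A there, and differentiating this forces F = 0. If E is invertible while
   mu vanishes on an open set, d mu = iota_nu V_N gives nu = 0.
   Hence regular points accumulate at every point where F and nu do not vanish,
   and at a regular point with F <> 0 the second equation has a term of rank three
   and two terms of rank at most one, so that alpha = beta = gamma = 0.
   Near a regular point the plane field E^-1 <nu, mu^sharp> is integrable, because
   nu and mu^sharp commute, and A is closed along its leaves. A gauge
   transformation by a primitive along the leaves makes A vanish on this plane
   field; then d phi = E + A nu has the determinant of E, and the inverse function
   theorem turns phi into the identity map. *)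

From HB Require Import structures.
From mathcomp Require Import all_boot all_order all_algebra.
From mathcomp Require Import all_classical all_reals all_analysis.
From mathcomp Require Import ring lra.
Require Import Defs.

Set Implicit Arguments.
Unset Strict Implicit.
Unset Printing Implicit Defensive.

Import Order.TTheory GRing.Theory Num.Theory.
Import numFieldNormedType.Exports.

Local Open Scope classical_set_scope.
Local Open Scope ring_scope.

(** * Functions of class C^k *)

Section Differentials.
Context {R : realType}.
Implicit Types V W : normedModType R.

(** Where E is singular, the exterior derivative of phi^*(nu^flat) = |nu|^2 A leaves |nu|^2 F as the
    pullback of d nu^flat by E alone, since iota_nu d nu^flat = - d|nu|^2 cancels the other terms;
    so F is expressed by cof E. The rows of E are annihilated by nu^flat, hence cof E is the outer
    product of some a with nu^flat and F is proportional to a. The first equation then gives E rank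
    at most one, so that cof E and F vanish. That nu and mu^sharp commute is a fact about the
    target: L_nu mu = 0 by Cartan's formula, and nu is Killing. The leaves are graphs z = Z(x, y,
    q), with a label q. Solving along all rays of the (x, y)-plane at once turns existence into one
    fixed point problem; each partial derivative of Z solves the linearized equation along rays and
    has a closed formula in Z, which gives smoothness in all variables. The determinants agree
    because d phi = (1 + A (x) E^-1 nu) E, whose first factor has determinant 1 + A(E^-1 nu) = 1.
    That det E is positive comes from the first equation, contracted with nu, so phi preserves
    orientation. *)

Lemma differentiable_epsP V W (f : V -> W) (x : V) (L : {linear V -> W}) :
  continuous L ->
  (forall e : R, 0 < e -> \forall y \near (0 : V),
     `|f (y + x) - f x - L y| <= e * `|y|) ->
  differentiable f x /\ 'd f x = L :> (V -> W).
Proof.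
move=> cL fL.
have E : f \o shift x = cst (f x) + L +o_ 0 id.
  apply/eqaddoP => e e0; near=> y.
  rewrite -[X in `|X|]/(f (y + x) - (f x + L y)) opprD addrA.
  by near: y; exact: fL.
have dE := diff_unique cL E.
by split=> //; apply/diff_locallyP; rewrite dE.
Unshelve. all: by end_near. Qed.

Lemma differentiable_eps V W (f : V -> W) (x : V) : differentiable f x ->
  forall e : R, 0 < e -> \forall y \near (0 : V),
     `|f (y + x) - f x - 'd f x y| <= e * `|y|.
Proof.
move=> /diff_locallyP[_ /eqaddoP H] e e0; near=> y.
rewrite -addrA -opprD.
by near: y; exact: H.
Unshelve. all: by end_near. Qed.

Lemma near_eq_differentiable V W (f g : V -> W) (x : V) :
  {near x, f =1 g} -> differentiable f x -> differentiable g x.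
Proof.
move=> fg df.
have [] // := @differentiable_epsP V W g x ('d f x).
  exact: diff_continuous.
move=> e e0; near=> y.
rewrite -(nbhs_singleton fg) -(_ : f (y + x) = g (y + x)).
  by near: y; exact: differentiable_eps.
near: y; move: fg; rewrite (near_shift 0)/= subr0 => fg.
by apply: filterS fg => z /=.
Unshelve. all: by end_near. Qed.

End Differentials.

Section CkTheory.
Context {R : realType}.
Implicit Types V W : normedModType R.

Lemma open_near V (U : set V) (x : V) : open U -> U x -> \near x, U x.
Proof. by move=> oU Ux; exact: (open_nbhs_nbhs (conj oU Ux)). Qed.

Lemma differentiable_mxP V m n (f : V -> 'M[R]_(m, n)) (x : V) :
  differentiable f x <-> forall i j, differentiable (fun y => f y i j) x.
Proof.
split=> [df i j|df].
  apply: (differentiable_comp (g := fun A : 'M[R]_(m, n) => A i j)) => //.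
  exact: differentiable_coord.
have -> : f = \sum_(i < m) \sum_(j < n) (fun y => f y i j *: delta_mx i j).
  apply/funext => y; rewrite fct_sumE [LHS]matrix_sum_delta.
  by apply: eq_bigr => i _; rewrite fct_sumE.
by apply: differentiable_sum => i; apply: differentiable_sum => j; apply: differentiableZl.
Qed.

Lemma continuous_mxP V m n (f : V -> 'M[R]_(m, n)) (x : V) :
  {for x, continuous f} <-> forall i j, {for x, continuous (fun y => f y i j)}.
Proof.
split=> [cf i j|cf].
  apply: (@continuous_comp _ _ _ f (fun A : 'M[R]_(m, n) => A i j)) => //.
  exact: matrix_normedtype.coord_continuous.
have -> : f = \sum_(i < m) \sum_(j < n) (fun y => f y i j *: delta_mx i j).
  apply/funext => y; rewrite fct_sumE [LHS]matrix_sum_delta.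
  by apply: eq_bigr => i _; rewrite fct_sumE.
suff sumc k (F : 'I_k -> V -> 'M[R]_(m, n)) :
    (forall i, {for x, continuous (F i)}) -> {for x, continuous (\sum_i F i)}.
  apply: (sumc) => i; apply: (sumc) => j.
  by apply: (@continuousZr_tmp).
move=> cF; elim/big_ind : _ => [|F1 F2 c1 c2|i _]; last exact: cF.
- exact: cst_continuous.
- exact: continuousD.
Qed.

Lemma Ck_ext V W n (U : set V) (f g : V -> W) : open U ->
  (forall x, U x -> f x = g x) -> Ck n U f -> Ck n U g.
Proof.
move=> oU; elim: n f g => [|n IH] f g fg /=.
  move=> cf x Ux; rewrite /prop_for /continuous_at -(fg x Ux).
  apply: cvg_trans (cf x Ux); apply: near_eq_cvg.
  by apply: filterS (open_near oU Ux) => y /fg.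
have fgx x : U x -> {near x, f =1 g}.
  by move=> Ux; apply: filterS (open_near oU Ux) => y /fg.
move=> [df Df]; split=> [x Ux|v].
  exact: near_eq_differentiable (fgx x Ux) (df x Ux).
by apply: IH (Df v) => x Ux; apply: near_eq_derive; exact: fgx.
Qed.

Lemma Ck_subset V W n (U U' : set V) (f : V -> W) : U' `<=` U ->
  Ck n U f -> Ck n U' f.
Proof.
move=> sU; elim: n f => [|n IH] f /=; first by move=> cf x /sU; exact: cf.
by move=> [df Df]; split=> [x /sU|v]; [exact: df|exact: IH].
Qed.

Lemma CkW V W n (U : set V) (f : V -> W) : Ck n.+1 U f -> Ck n U f.
Proof.
elim: n f => [|n IH] f [df Df].
  by move=> x Ux; apply: differentiable_continuous; exact: df.
by split=> // v; exact: IH.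
Qed.

Lemma Ck0 V W n (U : set V) (f : V -> W) : Ck n U f -> Ck 0 U f.
Proof. by elim: n => // n IH /CkW. Qed.

Lemma Ck_continuous V W n (U : set V) (f : V -> W) x : Ck n U f -> U x ->
  {for x, continuous f}.
Proof. by move=> /Ck0; apply. Qed.

Lemma Ck_differentiable V W n (U : set V) (f : V -> W) x : Ck n.+1 U f -> U x ->
  differentiable f x.
Proof. by case=> + _; apply. Qed.

Lemma Ck_cst V W n (U : set V) (a : W) : Ck n U (fun _ => a).
Proof.
elim: n a => [|n IH] a /=; first by move=> x _; exact: cst_continuous.
split=> [x _|v]; first exact: differentiable_cst.
have -> : (fun x : V => 'D_v (fun=> a) x) = fun=> 0; last exact: IH.
by apply/funext => x; exact: derive_cst.
Qed.

Lemma Ck_linear V W n (U : set V) (f : {linear V -> W}) : continuous f ->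
  Ck n U f.
Proof.
move=> cf; case: n => [|n] /=; first by move=> x _; exact: cf.
split=> [x _|v]; first exact: linear_differentiable.
have -> : (fun x : V => 'D_v f x) = fun=> f v; last exact: Ck_cst.
apply/funext => x; rewrite deriveE; last exact: linear_differentiable.
by rewrite diff_lin.
Qed.

Lemma CkD V W n (U : set V) (f g : V -> W) : open U ->
  Ck n U f -> Ck n U g -> Ck n U (fun x => f x + g x).
Proof.
move=> oU; elim: n f g => [|n IH] f g.
  by move=> cf cg x Ux; apply: continuousD; [exact: cf|exact: cg].
move=> [df Df] [dg Dg]; split=> [x Ux|v].
  by apply: differentiableD; [exact: df|exact: dg].
apply: (@Ck_ext _ _ _ _ (fun x => 'D_v f x + 'D_v g x)) => [//|x Ux|].
  by rewrite [RHS]deriveD//; apply: diff_derivable; [exact: df|exact: dg].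
by apply: IH; [exact: Df|exact: Dg].
Qed.

Lemma CkN V W n (U : set V) (f : V -> W) : open U ->
  Ck n U f -> Ck n U (fun x => - f x).
Proof.
move=> oU; elim: n f => [|n IH] f.
  by move=> cf x Ux; apply: continuousN; exact: cf.
move=> [df Df]; split=> [x Ux|v].
  by apply: differentiableN; exact: df.
apply: (@Ck_ext _ _ _ _ (fun x => - 'D_v f x)) => [//|x Ux|].
  by rewrite [RHS]deriveN//; apply: diff_derivable; exact: df.
by apply: IH; exact: Df.
Qed.

Lemma CkB V W n (U : set V) (f g : V -> W) : open U ->
  Ck n U f -> Ck n U g -> Ck n U (fun x => f x - g x).
Proof. by move=> oU Cf Cg; apply: CkD => //; exact: CkN. Qed.

Lemma Ck_sum V W n (U : set V) (I : Type) (r : seq I) (F : I -> V -> W) :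
  open U -> (forall i, Ck n U (F i)) -> Ck n U (fun x => \sum_(i <- r) F i x).
Proof.
move=> oU CF; elim: r => [|i r IH].
  by under eq_fun do rewrite big_nil; exact: Ck_cst.
by under eq_fun do rewrite big_cons; exact: CkD.
Qed.

Lemma CkM V n (U : set V) (f g : V -> R) : open U ->
  Ck n U f -> Ck n U g -> Ck n U (fun x => f x * g x).
Proof.
move=> oU; elim: n f g => [|n IH] f g.
  by move=> cf cg x Ux; apply: continuousM; [exact: cf|exact: cg].
move=> Cf Cg; have [df Df] := Cf; have [dg Dg] := Cg; split=> [x Ux|v].
  by apply: differentiableM; [exact: df|exact: dg].
apply: (@Ck_ext _ _ _ _ (fun x => f x * 'D_v g x + g x * 'D_v f x)) => [//|x Ux|].
  by rewrite [RHS]deriveM//; apply: diff_derivable; [exact: df|exact: dg].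
by apply: CkD => //; apply: IH; solve [exact: Df|exact: Dg|exact: CkW].
Qed.

(** The derivative of 1/f is a product of 1/f, taken twice, and a derivative of f, so the statement
    for 1/f at order n yields order n + 1. *)
Lemma CkV V n (U : set V) (f : V -> R) : open U -> (forall x, U x -> f x != 0) ->
  Ck n U f -> Ck n U (fun x => (f x)^-1).
Proof.
move=> oU f0; elim: n => [|n IH].
  by move=> cf x Ux; apply: continuousV; [exact: f0|exact: cf].
move=> Cf; have [df Df] := Cf; split=> [x Ux|v].
  by apply: differentiableV; [exact: df|exact: f0].
have Ci := IH (CkW Cf).
apply: (@Ck_ext _ _ _ _ (fun x => - ((f x)^-1 * (f x)^-1) * 'D_v f x)) => [//|x Ux|].
  rewrite [RHS]deriveV//; [|exact: f0|by apply: diff_derivable; exact: df].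
  by rewrite -exprVn expr2.
by apply: CkM (Df v) => //; apply: CkN => //; exact: CkM.
Qed.

Lemma derive_expR_comp V (f : V -> R) x v : differentiable f x ->
  differentiable (expR \o f) x /\ 'D_v (expR \o f) x = expR (f x) * 'D_v f x.
Proof.
move=> df; have de : differentiable expR (f x).
  by apply/derivable1_diffP; exact: derivable_expR.
have dc : differentiable (expR \o f) x by exact: differentiable_comp.
split=> //; rewrite deriveE// diff_comp//= -(deriveE v df).
rewrite -[X in 'd _ _ X]mulr1 -[X in 'd _ _ X]/('D_v f x *: (1 : R)) linearZ/=.
by rewrite -deriveE// derive_val mulrC.
Qed.

Lemma Ck_expR V n (U : set V) (f : V -> R) : open U ->
  Ck n U f -> Ck n U (fun x => expR (f x)).
Proof.
move=> oU; elim: n => [|n IH].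
  move=> cf x Ux; apply: (@continuous_comp _ _ _ f expR); first exact: cf.
  exact: continuous_expR.
move=> Cf; have [df Df] := Cf; split=> [x Ux|v].
  by have [] := derive_expR_comp 0 (df x Ux).
apply: (@Ck_ext _ _ _ _ (fun x => expR (f x) * 'D_v f x)) => [//|x Ux|].
  by have [_ ->] := derive_expR_comp v (df x Ux).
by apply: CkM (Df v) => //; apply: IH; exact: CkW.
Qed.

Lemma Ck_mxP V m k n (U : set V) (f : V -> 'M[R]_(m, k)) : open U ->
  Ck n U f <-> forall i j, Ck n U (fun x => f x i j).
Proof.
move=> oU; elim: n f => [|n IH] f; split.
- by move=> cf i j x Ux; exact: ((continuous_mxP _ _).1 (cf x Ux)).
- by move=> cf x Ux; apply: (continuous_mxP _ _).2 => i j; exact: cf.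
- move=> [df Df] i j; split=> [x Ux|v].
    exact: ((differentiable_mxP _ _).1 (df x Ux)).
  apply: (@Ck_ext _ _ _ _ (fun x => 'D_v f x i j)) => [//|x Ux|].
    by rewrite derive_mx ?mxE//; apply: diff_derivable; exact: df.
  by move/IH : (Df v); apply.
- move=> Cf; have df x : U x -> differentiable f x.
    by move=> Ux; apply/differentiable_mxP => i j; exact: (Ck_differentiable (Cf i j)).
  split=> // v; apply/IH => i j.
  apply: (@Ck_ext _ _ _ _ (fun x => 'D_v (fun x => f x i j) x)) => [//|x Ux|].
    by rewrite derive_mx ?mxE//; apply: diff_derivable; exact: df.
  by have [_] := Cf i j; apply.
Qed.

Lemma Ck_mulmx V m k l n (U : set V) (f : V -> 'M[R]_(m, k)) (g : V -> 'M[R]_(k, l)) :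
  open U -> Ck n U f -> Ck n U g -> Ck n U (fun x => f x *m g x).
Proof.
move=> oU /(Ck_mxP _ _ oU) Cf /(Ck_mxP _ _ oU) Cg; apply/Ck_mxP => // i j.
under eq_fun do rewrite mxE.
by apply: Ck_sum => // k'; exact: CkM.
Qed.

Lemma Ck_trmx V m k n (U : set V) (f : V -> 'M[R]_(m, k)) :
  open U -> Ck n U f -> Ck n U (fun x => (f x)^T).
Proof.
move=> oU /(Ck_mxP _ _ oU) Cf; apply/Ck_mxP => // i j.
by under eq_fun do rewrite mxE.
Qed.


Lemma Ck_pair V V' W n (U : set V) (f : V -> V') (g : V -> W) : open U ->
  Ck n U f -> Ck n U g -> Ck n U (fun x => (f x, g x)).
Proof.
move=> oU; elim: n f g => [|n IH] f g.
  by move=> cf cg x Ux; apply: cvg_pair; [exact: cf|exact: cg].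
move=> [df Df] [dg Dg]; split=> [x Ux|v].
  by apply: differentiable_pair; [exact: df|exact: dg].
apply: (@Ck_ext _ _ _ _ (fun x => ('D_v f x, 'D_v g x))) => [//|x Ux|].
  rewrite [RHS]deriveE; last by apply: differentiable_pair; [exact: df|exact: dg].
  rewrite (diff_pair (df x Ux) (dg x Ux)).
  by rewrite (deriveE _ (df x Ux)) (deriveE _ (dg x Ux)).
by apply: IH; [exact: Df|exact: Dg].
Qed.

(* Over such spaces the iterated chain rule is a finite sum of products. *)
Definition coordinatized V : Prop := exists n (b : 'I_n -> V)
  (l : 'I_n -> {linear V -> R}),
  (forall i, continuous (l i)) /\ forall v, v = \sum_i l i v *: b i.

Lemma Ck_linear_comp V V' W n (U : set V) (l : {linear V' -> W}) (g : V -> V') :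
  open U -> continuous l -> Ck n U g -> Ck n U (fun x => l (g x)).
Proof.
move=> oU cl; elim: n g => [|n IH] g.
  move=> cg x Ux; apply: (@continuous_comp _ _ _ g l); first exact: cg.
  exact: cl.
move=> [dg Dg]; split=> [x Ux|w].
  apply: differentiable_comp; first exact: dg.
  exact: linear_differentiable.
apply: (@Ck_ext _ _ _ _ (fun x => l ('D_w g x))) => [//|x Ux|].
  have dl : differentiable l (g x) by exact: linear_differentiable.
  rewrite [RHS]deriveE; last exact: differentiable_comp (dg x Ux) dl.
  by rewrite (diff_comp (dg x Ux) dl)/= diff_lin// -(deriveE w (dg x Ux)).
by apply: IH; exact: Dg.
Qed.

Lemma Ck_comp V V' n (U : set V) (U' : set V') (f : V' -> R) (g : V -> V') :
  coordinatized V' -> open U -> (forall x, U x -> U' (g x)) ->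
  Ck n U' f -> Ck n U g -> Ck n U (fun x => f (g x)).
Proof.
move=> [m [b [l [cl bl]]]] oU UU'; elim: n f g UU' => [|n IH] f g UU'.
  move=> cf cg x Ux; apply: (@continuous_comp _ _ _ g f); first exact: cg.
  by apply: cf; exact: UU'.
move=> Cf Cg; have [df Df] := Cf; have [dg Dg] := Cg; split=> [x Ux|v].
  by apply: differentiable_comp; [exact: dg|apply: df; exact: UU'].
apply: (@Ck_ext _ _ _ _ (fun x => \sum_i l i ('D_v g x) * 'D_(b i) f (g x)))
    => [//|x Ux|].
  have dfx : differentiable f (g x) by apply: df; exact: UU'.
  rewrite [RHS]deriveE; last by apply: differentiable_comp => //; exact: dg.
  rewrite diff_comp//=; last exact: dg.
  rewrite -(deriveE v (dg x Ux)).
  rewrite [in RHS](bl ('D_v g x)) linear_sum/=.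
  by apply: eq_bigr => i _; rewrite linearZ/= -deriveE.
apply: Ck_sum => // i; apply: CkM => //; last first.
  exact: (IH _ _ UU' (Df (b i)) (CkW Cg)).
exact: (Ck_linear_comp oU (cl i) (Dg v)).
Qed.

Lemma coordinatized_R : coordinatized R.
Proof.
exists 1%N, (fun _ => 1), (fun _ => idfun); split=> [i x|v]; first exact: cvg_id.
by rewrite big_ord1 /= [RHS]mulr1.
Qed.

Definition rV_coord n (i : 'I_n) (v : 'rV[R]_n) : R := v 0 i.

Fact rV_coord_linear n (i : 'I_n) : linear (@rV_coord n i).
Proof. by move=> k u v; rewrite /rV_coord !mxE. Qed.

HB.instance Definition _ n (i : 'I_n) :=
  GRing.isLinear.Build _ _ _ _ (@rV_coord n i) (rV_coord_linear i).

Lemma rV_coord_continuous n (i : 'I_n) : continuous (@rV_coord n i).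
Proof. by move=> v; exact: matrix_normedtype.coord_continuous. Qed.

Lemma coordinatized_rV n : coordinatized 'rV[R]_n.
Proof.
exists n, (fun i => delta_mx 0 i), (fun i => @rV_coord n i); split=> [i|v].
  exact: rV_coord_continuous.
by rewrite [LHS]row_sum_delta.
Qed.

Lemma coordinatized_pair V W :
  coordinatized V -> coordinatized W -> coordinatized (V * W)%type.
Proof.
move=> [m [b [l [cl bl]]]] [m' [b' [l' [cl' bl']]]].
pose B (k : 'I_m + 'I_m') : V * W :=
  match k with inl i => (b i, 0) | inr j => (0, b' j) end.
pose L (k : 'I_m + 'I_m') : {linear (V * W)%type -> R} :=
  match k with inl i => l i \o fst | inr j => l' j \o snd end.
exists (m + m')%N, (fun k => B (fintype.split k)), (fun k => L (fintype.split k)).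
split=> [k|[v w]].
  case: (fintype.split k) => i /= x.
    by apply: (@continuous_comp _ _ _ fst (l i)); [exact: cvg_fst|exact: cl].
  by apply: (@continuous_comp _ _ _ snd (l' i)); [exact: cvg_snd|exact: cl'].
rewrite big_split_ord/=.
under eq_bigr do rewrite (unsplitK (inl _)).
under [X in _ + X]eq_bigr do rewrite (unsplitK (inr _)).
rewrite /L /B /= {1}(bl v) {1}(bl' w).
have E k (F : 'I_k -> V * W) : \sum_i F i = (\sum_i (F i).1, \sum_i (F i).2).
  by elim/big_rec3 : _ => // i y1 y2 y3 _ ->; case: (F i).
rewrite !E/=.
under [X in (_, X) + _]eq_bigr do rewrite scaler0.
under [X in _ + (X, _)]eq_bigr do rewrite scaler0.
rewrite !big1_eq.
by rewrite -[RHS]/(_ + _, _ + _) addr0 add0r.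
Qed.

End CkTheory.

(** * Mean value estimates and symmetry of second derivatives *)

Section MeanValue.
Context {R : realType}.
Implicit Types V W : normedModType R.

Lemma near_and3 (T : Type) (F : set_system T) {FF : Filter F} (P Q S : set T) :
  F P -> F Q -> F S -> F (fun y => [/\ P y, Q y & S y]).
Proof. by move=> p q s; exact: filterS3 p q s. Qed.

Lemma near_dist_lt V W (f : V -> W) x (e : R) : {for x, continuous f} -> 0 < e ->
  \forall y \near x, `|f x - f y| < e.
Proof. by move=> /cvgrPdist_lt cf e0; exact: cf. Qed.

Lemma near_dist_continuous V W (f : V -> W) x :
  (forall e : R, 0 < e -> \forall y \near x, `|f x - f y| <= e) ->
  {for x, continuous f}.
Proof. by move=> H; apply/cvgrPdist_le => e e0; exact: H. Qed.

Lemma near_and V (x : V) (P Q : set V) : (\near x, P x) -> (\near x, Q x) ->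
  \forall y \near x, P y /\ Q y.
Proof. by move=> Px Qx; exact: filterI. Qed.

Lemma near_sub V (x : V) (P Q : set V) : P `<=` Q -> (\near x, P x) ->
  \near x, Q x.
Proof. by move=> PQ; apply: filterS => y; exact: PQ. Qed.

Lemma near0_norm_lt V (r : R) : 0 < r -> \forall y \near (0 : V), `|y| < r.
Proof.
move=> r0; apply/nbhs_ballP; exists r => // y.
by rewrite -ball_normE/= sub0r normrN.
Qed.

Lemma mx_coord_le_norm m n (M : 'M[R]_(m, n)) i j : `|M i j| <= `|M|.
Proof.
rewrite [leRHS]/Num.Def.normr/= mx_normrE.
exact: (le_bigmax _ (fun k : 'I_m * 'I_n => `|M k.1 k.2|) (i, j)).
Qed.

Lemma mx_norm_le m n (M : 'M[R]_(m, n)) (C : R) : 0 <= C ->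
  (forall i j, `|M i j| <= C) -> `|M| <= C.
Proof.
move=> C0 MC; rewrite [leLHS]/Num.Def.normr/= mx_normrE.
by apply: bigmax_le => // k _; exact: MC.
Qed.

Lemma is_derive_line V W (f : V -> W) (x v : V) (t : R) :
  derivable f (t *: v + x) v ->
  is_derive t 1 (fun t => f (t *: v + x)) ('D_v f (t *: v + x)).
Proof.
move=> df.
have E : (fun h : R => h^-1 *: (f ((h *: (1 : R) + t) *: v + x) - f (t *: v + x)))
    = (fun h => h^-1 *: (f (h *: v + (t *: v + x)) - f (t *: v + x))).
  by apply/funext => h; rewrite [h *: 1]mulr1 scalerDl addrA.
by apply: DeriveDef; rewrite /derivable /derive/= E.
Qed.

Lemma MVT_line V (f : V -> R) (x v : V) (s : R) : 0 <= s ->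
  (forall t, 0 <= t <= s -> derivable f (t *: v + x) v) ->
  exists2 t, 0 <= t <= s & f (s *: v + x) - f x = s * 'D_v f (t *: v + x).
Proof.
move=> s0 df.
have [| |t ts E] := @MVT_segment R (fun t => f (t *: v + x))
    (fun t => 'D_v f (t *: v + x)) 0 s s0.
- move=> t; rewrite in_itv/= => /andP[t0 ts].
  by apply: is_derive_line; apply: df; rewrite !ltW.
- apply: derivable_within_continuous => t; rewrite in_itv/= => ts.
  by have [] := is_derive_line (df t ts).
exists t; first by move: ts; rewrite in_itv.
by rewrite scale0r add0r subr0 in E; rewrite E mulrC.
Qed.

(** The mean value theorem is applied twice: along v to the increment [g] of f in the direction w,
    then along w to ['D_v f]. Exchanging v and w gives the same second difference with the other
    mixed derivative. *)
Lemma second_difference V (U : set V) (f : V -> R) (x v w : V) (s : R) :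
  0 <= s -> Ck 2 U f ->
  (forall a b, 0 <= a <= s -> 0 <= b <= s -> U (a *: v + b *: w + x)) ->
  exists a b, [/\ 0 <= a <= s, 0 <= b <= s &
    f (s *: v + s *: w + x) - f (s *: v + x) - f (s *: w + x) + f x =
    s * s * 'D_w ('D_v f) (a *: v + b *: w + x)].
Proof.
move=> s0 [df Df] HU; have [dDf _] := Df v.
have ss : 0 <= s <= s by rewrite s0 lexx.
have ss0 : 0 <= (0 : R) <= s by rewrite lexx.
pose g y := f (s *: w + y) - f y.
have dg a : 0 <= a <= s -> is_derive (a *: v + x) v g
    ('D_v f (s *: w + (a *: v + x)) - 'D_v f (a *: v + x)).
  move=> as0.
  have d1 : differentiable f (s *: w + (a *: v + x)).
    by apply: df; rewrite addrA [_ *: w + _]addrC; exact: HU.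
  have d0 : differentiable f (a *: v + x).
    by apply: df; have := HU _ _ as0 ss0; rewrite scale0r addr0.
  have D1 : is_derive (a *: v + x) v (fun y => f (s *: w + y))
      ('D_v f (s *: w + (a *: v + x))).
    have E : (fun h => h^-1 *: (f (s *: w + (h *: v + (a *: v + x))) -
        f (s *: w + (a *: v + x)))) = (fun h : R => h^-1 *:
        (f (h *: v + (s *: w + (a *: v + x))) - f (s *: w + (a *: v + x)))).
      by apply/funext => h; rewrite addrCA.
    have := @diff_derivable _ _ _ _ _ v d1; rewrite /derivable -E => ?.
    by apply: DeriveDef => //; rewrite /derive/= E.
  by apply: is_deriveB; apply: derivableP; exact: diff_derivable.
have [|a as0 Ea] := @MVT_line V g x v s s0.
  by move=> t /dg [].
have {}dg := dg a as0; rewrite (@derive_val _ _ _ _ _ _ _ dg) in Ea.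
have [|b bs Eb] := @MVT_line V ('D_v f) (a *: v + x) w s s0.
  move=> t ts; apply: diff_derivable; apply: dDf.
  by rewrite addrA [_ *: w + _]addrC; exact: HU.
exists a, b; split; [exact: as0|exact: bs|].
rewrite Eb addrA [_ *: w + _ *: v]addrC mulrA in Ea; rewrite -Ea /g.
have -> : s *: v + s *: w + x = s *: w + (s *: v + x).
  by rewrite addrA [s *: w + _]addrC.
by ring.
Qed.

Lemma near_parallelogram V (P : set V) (x v w : V) : nbhs x P ->
  exists2 s : R, 0 < s & forall a b, 0 <= a <= s -> 0 <= b <= s ->
    P (a *: v + b *: w + x).
Proof.
move=> /nbhs_ballP[r /= r0 rP].
have d0 : 0 < `|v| + `|w| + 1 by rewrite ltr_wpDl// addr_ge0.
(* The added 1 keeps the denominator positive when v = w = 0, and half the radius makes the final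
   inequality strict. *)
exists (r / 2 / (`|v| + `|w| + 1)); first by rewrite !divr_gt0.
move=> a b /andP[a0 a1] /andP[b0 b1]; apply: rP.
rewrite -ball_normE/= distrC addrK.
rewrite (@le_lt_trans _ _ (r / 2))//; last by rewrite ltr_pdivrMr// ltr_pMr// ltr1n.
rewrite (le_trans (ler_normD _ _))// !normrZ !ger0_norm//.
set s := r / 2 / _ in a1 b1.
have s0 : 0 <= s by rewrite (le_trans a0).
have -> : r / 2 = s * (`|v| + `|w| + 1) by rewrite /s divfK// gt_eqF.
have ? : a * `|v| <= s * `|v| by rewrite ler_wpM2r.
have ? : b * `|w| <= s * `|w| by rewrite ler_wpM2r.
by lra.
Qed.

(* Both mixed derivatives are approximated by the same second difference. *)
Lemma schwarz_derive V (U : set V) (f : V -> R) (x v w : V) : open U -> U x ->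
  Ck 2 U f -> 'D_w ('D_v f) x = 'D_v ('D_w f) x.
Proof.
move=> oU Ux Cf; have [df Df] := Cf.
have c1 : {for x, continuous ('D_w ('D_v f))} by have [_ /(_ w)] := Df v; apply.
have c2 : {for x, continuous ('D_v ('D_w f))} by have [_ /(_ v)] := Df w; apply.
apply/eqP; rewrite -subr_eq0 -normr_le0; apply/ler_addgt0Pr => e e0.
have e20 : 0 < e / 2 by rewrite divr_gt0.
rewrite add0r.
have N : \forall y \near x, [/\ U y,
    `|'D_w ('D_v f) x - 'D_w ('D_v f) y| < e / 2 &
    `|'D_v ('D_w f) x - 'D_v ('D_w f) y| < e / 2].
  have := near_and3 (open_near oU Ux) (near_dist_lt c1 e20) (near_dist_lt c2 e20).
  exact.
have [s s0 HP] := near_parallelogram v w N.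
have [|a [b [as0 bs0 E1]]] := @second_difference V U f x v w s (ltW s0) Cf.
  by move=> a b as0 bs0; have [] := HP a b as0 bs0.
have [|b' [a' [bs0' as0' E2]]] := @second_difference V U f x w v s (ltW s0) Cf.
  by move=> b' a' bs0' as0'; rewrite [b' *: w + _]addrC; have [] := HP a' b' as0' bs0'.
have [_ H1 _] := HP a b as0 bs0.
have [_ _ H2] := HP a' b' as0' bs0'.
rewrite [b' *: w + _]addrC [s *: w + s *: v]addrC in E2.
have E : 'D_w ('D_v f) (a *: v + b *: w + x) = 'D_v ('D_w f) (a' *: v + b' *: w + x).
  have ss0 : s * s != 0 by rewrite mulf_neq0// gt_eqF.
  apply: (mulfI ss0); apply: etrans (esym E1) (etrans _ E2).
  by congr (_ + _); exact: addrAC.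
rewrite -E distrC in H2.
set A := 'D_w ('D_v f) x in H1 *; set B := 'D_v ('D_w f) x in H2 *.
set C := 'D_w _ _ in H1 H2.
move: H1 H2 => /ltW H1 /ltW H2.
rewrite [e]splitr -(subrKA C); exact: le_trans (ler_normD _ _) (lerD H1 H2).
Unshelve. all: by end_near. Qed.

End MeanValue.

Section Partials.
Context {R : realType}.

(** The increment from x to y + x is telescoped into n moves, each along one coordinate axis. By the
    mean value theorem each move gives a partial derivative at a point near x, off by at most e / (n
    + 1), and the n errors add up to at most e times the norm of y. *)
Lemma partials_differentiable n (U : set 'rV[R]_n) (f : 'rV[R]_n -> R) x :
  open U -> U x ->
  (forall y i, U y -> derivable f y (delta_mx 0 i)) ->
  (forall i, {for x, continuous ('D_(delta_mx 0 i) f)}) ->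
  differentiable f x.
Proof.
move=> oU Ux df cf.
pose L (y : 'rV[R]_n) := \sum_i rV_coord i y * 'D_(delta_mx 0 i) f x.
have lL : linear L.
  move=> k u v; rewrite /L scaler_sumr -big_split/=; apply: eq_bigr => i _.
  by rewrite linearPZ/= mulrDl -mulrA.
pose pL := GRing.isLinear.Build _ _ _ _ _ lL.
pose LL : {linear 'rV[R]_n -> R} := HB.pack L pL.
have cL : continuous LL.
  move=> y; apply: (@Ck_continuous R _ _ 0 setT) => //.
  apply: Ck_sum; first exact: openT.
  move=> i; apply: CkM; first exact: openT.
    by apply: Ck_linear; exact: rV_coord_continuous.
  exact: Ck_cst.
have [] // := @differentiable_epsP R _ _ f x LL cL.
move=> e e0.
have en0 : 0 < e / n.+1%:R by rewrite divr_gt0.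
have : \forall y \near x, U y /\
    forall i, `|'D_(delta_mx 0 i) f x - 'D_(delta_mx 0 i) f y| < e / n.+1%:R.
  have n1 : \forall y \near x, forall i,
      `|'D_(delta_mx 0 i) f x - 'D_(delta_mx 0 i) f y| < e / n.+1%:R.
    have H i := near_dist_lt (cf i) en0.
    exact: (filter_forall _ H).
  by have := filterI (open_near oU Ux) n1; exact.
move=> /nbhs_ballP[r /= r0 rP].
apply: filterS (@near0_norm_lt R 'rV[R]_n r r0) => y yr.
(* [z k] has the first k coordinates of y + x and the remaining ones of x. *)
pose z (k : nat) : 'rV[R]_n := x + \row_j (if (j < k)%N then y 0 j else 0).
have zS (k : 'I_n) : z k.+1 = y 0 k *: delta_mx 0 k + z k.
  rewrite /z addrCA; congr (_ + _); apply/rowP => j; rewrite !mxE eqxx/= ltnS leq_eqVlt.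
  have [->|jk] := eqVneq j k; first by rewrite eqxx/= mulr1 ltnn addr0.
  by rewrite (_ : (j == k :> nat) = false) ?mulr0 ?add0r//; apply/negbTE.
have z0 : z 0%N = x.
  by rewrite /z; apply/rowP => j; rewrite !mxE addr0.
have zn : z n = y + x.
  by rewrite /z addrC; congr (_ + _); apply/rowP => j; rewrite !mxE ltn_ord.
have inb (k : 'I_n) t : `|t| <= `|y 0 k| -> ball x r (t *: delta_mx 0 k + z k).
  move=> tk; rewrite -ball_normE/= distrC /z addrCA [x + _]addrC addrK.
  apply: le_lt_trans yr; apply: mx_norm_le => // i j; rewrite !mxE ord1 eqxx/=.
  have [->|jk] := eqVneq j k; first by rewrite mulr1 ltnn addr0 (le_trans tk)// mx_coord_le_norm.
  by rewrite mulr0 add0r; case: ifP => _; rewrite ?normr0// mx_coord_le_norm.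
have step (k : 'I_n) :
    `|f (z k.+1) - f (z k) - y 0 k * 'D_(delta_mx 0 k) f x| <= `|y| * (e / n.+1%:R).
  rewrite zS.
  have key : exists2 t, `|t| <= `|y 0 k| &
      f (y 0 k *: delta_mx 0 k + z k) - f (z k) =
      y 0 k * 'D_(delta_mx 0 k) f (t *: delta_mx 0 k + z k).
    have [y0|y0] := leP 0 (y 0 k).
      have [t /andP[t0 t1]|t /andP[t0 t1] ->] :=
          @MVT_line R _ f (z k) (delta_mx 0 k) (y 0 k) y0.
        by apply: df; have [] := rP _ (inb k t _) => //; rewrite !ger0_norm.
      by exists t => //; rewrite !ger0_norm.
    (* [MVT_line] moves forward only, so a negative displacement is travelled backwards from its end
       point. *)
    have y0' : 0 <= - y 0 k by rewrite oppr_ge0 ltW.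
    have [t /andP[t0 t1]|t /andP[t0 t1] E] :=
        @MVT_line R _ f (y 0 k *: delta_mx 0 k + z k) (delta_mx 0 k) (- y 0 k) y0'.
      rewrite addrA -scalerDl; apply: df.
      have [] := rP _ (inb k (t + y 0 k) _) => //.
      by rewrite (ltr0_norm y0) ler0_norm; lra.
    exists (t + y 0 k); first by rewrite (ltr0_norm y0) ler0_norm; lra.
    rewrite addrA scaleNr addNr add0r in E.
    by apply: oppr_inj; rewrite opprB E scalerDl addrA mulNr.
  have [t tk ->] := key.
  rewrite -mulrBr normrM ler_pM// ?mx_coord_le_norm//.
  by have [_ /(_ k) /ltW] := rP _ (inb k t tk); rewrite distrC.
have E : f (y + x) - f x - LL y =
    \sum_(k < n) (f (z k.+1) - f (z k) - y 0 k * 'D_(delta_mx 0 k) f x).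
  rewrite sumrB -(big_mkord xpredT (fun k => f (z k.+1) - f (z k))).
  by rewrite telescope_sumr// zn z0.
rewrite E (le_trans (ler_norm_sum _ _ _))//.
apply: (@le_trans _ _ (\sum_(k < n) `|y| * (e / n.+1%:R))).
  by apply: ler_sum => k _; exact: step.
rewrite sumr_const card_ord -mulrnAr mulrC ler_wpM2r//.
rewrite -[_ *+ n]mulr_natr -mulrA ger_pMr// mulrC ler_pdivrMr// mul1r.
by rewrite ler_nat.
Qed.

(** This is how regularity is later read off from formulas for the partial derivatives: for ray
    integrals, and for the graph function of the leaves. *)
Lemma Ck_partials n k (U : set 'rV[R]_n) (f : 'rV[R]_n -> R) : open U ->
  (forall x i, U x -> derivable f x (delta_mx 0 i)) ->
  (forall i, Ck k U ('D_(delta_mx 0 i) f)) -> Ck k.+1 U f.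
Proof.
move=> oU df Cf.
have dff x : U x -> differentiable f x.
  move=> Ux; apply: (partials_differentiable oU Ux) => [y i Uy|i]; first exact: df.
  by apply: (Ck_continuous (Cf i)).
split=> // v.
apply: (@Ck_ext _ _ _ _ _ (fun x => \sum_i v 0 i * 'D_(delta_mx 0 i) f x)) => [//|x Ux|].
  rewrite (deriveE v (dff x Ux)) {2}[v]row_sum_delta linear_sum/=.
  by apply: eq_bigr => i _; rewrite linearZ/= -deriveE//; exact: dff.
by apply: Ck_sum => // i; apply: CkM => //; exact: Ck_cst.
Qed.

End Partials.

(** * Matrix-valued maps *)

Section Jacobian.
Context {R : realType}.

Lemma Ck_prod (V : normedModType R) n (U : set V) (I : Type) (r : seq I)
    (F : I -> V -> R) :
  open U -> (forall i, Ck n U (F i)) -> Ck n U (fun x => \prod_(i <- r) F i x).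
Proof.
move=> oU CF; elim: r => [|i r IH].
  by under eq_fun do rewrite big_nil; exact: Ck_cst.
by under eq_fun do rewrite big_cons; exact: CkM.
Qed.

Lemma Ck_det (V : normedModType R) n k (U : set V) (A : V -> 'M[R]_k) :
  open U -> Ck n U A -> Ck n U (fun x => \det (A x)).
Proof.
move=> oU /(Ck_mxP _ _ oU) CA; rewrite /determinant.
apply: Ck_sum => // s; apply: CkM => //; first exact: Ck_cst.
by apply: Ck_prod => // i; exact: CA.
Qed.

Lemma Ck_invmx (V : normedModType R) n k (U : set V) (A : V -> 'M[R]_k) :
  open U -> (forall x, U x -> A x \in unitmx) -> Ck n U A ->
  Ck n U (fun x => invmx (A x)).
Proof.
move=> oU uA CA.
apply: (@Ck_ext _ _ _ _ _ (fun x => (\det (A x))^-1 *: \adj (A x))) => // [x Ux|].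
  by rewrite /invmx uA.
apply/Ck_mxP => // i j; under eq_fun do rewrite !mxE.
apply: CkM => //.
  apply: CkV => // [x Ux|]; last exact: Ck_det.
  by have := uA _ Ux; rewrite unitmxE unitfE.
rewrite /cofactor; apply: CkM => //; first exact: Ck_cst.
apply: Ck_det => //; apply/Ck_mxP => // i' j'; under eq_fun do rewrite !mxE.
by move/(Ck_mxP _ _ oU) : CA; apply.
Qed.

Lemma jacobianE m n (f : 'rV[R]_m -> 'rV[R]_n) x i j : differentiable f x ->
  'J f x i j = 'D_(delta_mx 0 i) f x 0 j.
Proof. by move=> df; rewrite (deriveEjacobian _ df) -rowE [RHS]mxE. Qed.

Lemma Ck_jacobian m n k (U : set 'rV[R]_m) (f : 'rV[R]_m -> 'rV[R]_n) :
  open U -> Ck k.+1 U f -> Ck k U (fun x => 'J f x).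
Proof.
move=> oU [df Df]; apply/Ck_mxP => // i j.
apply: (@Ck_ext _ _ _ _ _ (fun x => 'D_(delta_mx 0 i) f x 0 j)) => // [x Ux|].
  by rewrite jacobianE//; exact: df.
by have /(Ck_mxP _ _ oU) := Df (delta_mx 0 i); apply.
Qed.

Lemma mulmx_bound m n (B : 'M[R]_(m, n)) :
  exists2 K : R, 0 < K & forall v : 'rV[R]_m, `|v *m B| <= K * `|v|.
Proof.
exists (m%:R * `|B| + 1); first by rewrite ltr_wpDl// mulr_ge0.
move=> v; apply: mx_norm_le => [|i j]; first by rewrite mulr_ge0// addr_ge0// mulr_ge0.
rewrite mxE (le_trans (ler_norm_sum _ _ _))//.
apply: (@le_trans _ _ (\sum_(k < m) `|v| * `|B|)).
  by apply: ler_sum => k _; rewrite normrM ler_pM// mx_coord_le_norm.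
rewrite sumr_const card_ord -[_ *+ m]mulr_natr mulrDl mul1r.
have -> : `|v| * `|B| * m%:R = m%:R * `|B| * `|v| by ring.
by rewrite lerDl.
Qed.

Lemma is_derive_mulmx (V : normedModType R) m k l (f : V -> 'M[R]_(m, k))
    (g : V -> 'M[R]_(k, l)) x v : derivable f x v -> derivable g x v ->
  is_derive x v (fun y => f y *m g y) ('D_v f x *m g x + f x *m 'D_v g x).
Proof.
move=> df dg.
have E i j : is_derive x v (fun y => (f y *m g y) i j)
    (('D_v f x *m g x + f x *m 'D_v g x) i j).
  have -> : (fun y => (f y *m g y) i j) = \sum_(a < k) (fun y => f y i a * g y a j).
    by apply/funext => y; rewrite mxE fct_sumE.
  have D a : is_derive x v (fun y => f y i a * g y a j)
      ('D_v f x i a * g x a j + f x i a * 'D_v g x a j).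
    have dfa : derivable (fun y => f y i a) x v by exact: (derivable_mxP _ _ _).1.
    have dga : derivable (fun y => g y a j) x v by exact: (derivable_mxP _ _ _).1.
    apply: DeriveDef; first exact: (derivableM dfa dga).
    rewrite (deriveM dfa dga) (derive_mx df) (derive_mx dg) !mxE addrC.
    by congr (_ + _); exact: mulrC.
  have [+ _] := all_and2 (fun a => conj (@ex_derive _ _ _ _ _ _ _ (D a)) (@derive_val _ _ _ _ _ _ _ (D a))).
  move=> dD; apply: DeriveDef; first exact: derivable_sum.
  rewrite derive_sum// !mxE -big_split/=; apply: eq_bigr => a _.
  by rewrite (@derive_val _ _ _ _ _ _ _ (D a)).
have dfg : derivable (fun y => f y *m g y) x v.
  by apply/derivable_mxP => i j; have [] := E i j.
apply: DeriveDef => //; rewrite derive_mx//; apply/matrixP => i j.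
by rewrite mxE (@derive_val _ _ _ _ _ _ _ (E i j)).
Qed.

Lemma derive_mulmx (V : normedModType R) m k l (f : V -> 'M[R]_(m, k))
    (g : V -> 'M[R]_(k, l)) x v : derivable f x v -> derivable g x v ->
  'D_v (fun y => f y *m g y) x = 'D_v f x *m g x + f x *m 'D_v g x.
Proof. by move=> df dg; have [] := is_derive_mulmx df dg. Qed.

Lemma differentiable_eps_mx m n (f : 'rV[R]_m -> 'rV[R]_n) x (A : 'M[R]_(m, n)) :
  (forall e : R, 0 < e -> \forall y \near (0 : 'rV[R]_m),
     `|f (y + x) - f x - y *m A| <= e * `|y|) ->
  differentiable f x /\ forall v, 'D_v f x = v *m A.
Proof.
move=> fA; pose L (v : 'rV[R]_m) : 'rV[R]_n := v *m A.
have cL : continuous L.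
  move=> z; apply: (@Ck_continuous R _ _ 0 setT); last by [].
  apply: Ck_mulmx; first exact: openT.
    by apply: (@Ck_linear _ _ _ _ _ idfun) => ?; exact: cvg_id.
  exact: Ck_cst.
have lL : linear L by move=> k u v; rewrite /L mulmxDl scalemxAl.
pose pL := GRing.isLinear.Build _ _ _ _ _ lL.
pose LL : {linear 'rV[R]_m -> 'rV[R]_n} := HB.pack L pL.
have [df dE] := @differentiable_epsP R _ _ f x LL cL fA.
by split=> // v; rewrite (deriveE _ df) dE.
Qed.

Lemma Ck_comp_mx (V : normedModType R) (V' : normedModType R) m k n (U : set V)
    (U' : set V')
    (f : V' -> 'M[R]_(m, k)) (g : V -> V') :
  coordinatized V' -> open U -> open U' -> (forall x, U x -> U' (g x)) ->
  Ck n U' f -> Ck n U g -> Ck n U (fun x => f (g x)).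
Proof.
move=> cV oU oU' UU' /(Ck_mxP _ _ oU') Cf Cg; apply/Ck_mxP => // i j.
exact: (@Ck_comp _ _ _ _ U U' (fun y => f y i j)).
Qed.

End Jacobian.

Section Contraction.
Context {R : realType} {X : completeNormedModType R}.

Lemma contraction_fixpoint (x0 : X) (r : R) (T : X -> X) : 0 < r ->
  (forall x, `|x - x0| <= r -> `|T x - x0| <= r) ->
  (forall x y, `|x - x0| <= r -> `|y - x0| <= r -> `|T x - T y| <= 2^-1 * `|x - y|) ->
  exists2 x, `|x - x0| <= r & T x = x.
Proof.
move=> r0 TB Tc.
pose B : set X := closed_ball_ Num.norm x0 r.
have TF : set_fun B B T.
  by move=> x; rewrite /B /closed_ball_/= ![`|x0 - _|]distrC; exact: TB.
pose pT := isFun.Build _ _ _ _ _ TF.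
pose TT : {fun B >-> B} := HB.pack T pT.
have c2 : (0 : R) <= 2^-1 by rewrite invr_ge0.
have [|||x Bx xE] := @banach_fixed_point R X B TT.
- exists (NngNum c2); split; first by rewrite /= invf_lt1// ltr1n.
  move=> [x y] /= [Bx By]; apply: Tc; by rewrite distrC.
- exact: closed_closed_ball_.
- by exists x0; rewrite /B /closed_ball_/= subrr normr0 ltW.
by exists x => //; rewrite distrC.
Qed.

End Contraction.

(** Provides the complete normed module structure that [contraction_fixpoint] asks of its space. *)
HB.instance Definition _ (R : realType) (n : nat) :=
  Complete.copy 'rV[R]_n 'rV[R]_n.

(** * The inverse function theorem *)

Section InverseFunction.
Context {R : realType} {n : nat}.
Implicit Types (U V : set 'rV[R]_n) (f : 'rV[R]_n -> 'rV[R]_n).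

Lemma smooth_subset (V W : normedModType R) (U U' : set V) (f : V -> W) :
  U' `<=` U -> smooth U f -> smooth U' f.
Proof. by move=> sU Cf k; exact: Ck_subset sU (Cf k). Qed.

Lemma near_neq0 (V : normedModType R) (D : V -> R) x :
  {for x, continuous D} -> D x != 0 -> \forall y \near x, D y != 0.
Proof.
move=> cD d0; have d1 : 0 < `|D x| by rewrite normr_gt0.
apply: filterS (near_dist_lt cD d1) => y h.
by apply/eqP => Dy; move: h; rewrite Dy subr0 ltxx.
Qed.

Lemma near_eq0_le (V : normedModType R) (D : V -> R) x (e : R) :
  {for x, continuous D} -> D x = 0 -> 0 < e -> \forall y \near x, `|D y| <= e.
Proof.
move=> cD d0 e0; apply: filterS (near_dist_lt cD e0) => y.
by rewrite d0 sub0r normrN => /ltW.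
Qed.

Lemma ball_segment (x0 x y : 'rV[R]_n) (r t : R) : `|x - x0| <= r ->
  `|y - x0| <= r -> 0 <= t <= 1 -> `|t *: (y - x) + x - x0| <= r.
Proof.
move=> xr yr /andP[t0 t1].
have -> : t *: (y - x) + x - x0 = t *: (y - x0) + (1 - t) *: (x - x0).
  by apply/rowP => i; rewrite !mxE; ring.
have t1' : 0 <= 1 - t by rewrite subr_ge0.
rewrite (le_trans (ler_normD _ _))// !normrZ !ger0_norm//.
have : t * `|y - x0| <= t * r by rewrite ler_wpM2l.
have : (1 - t) * `|x - x0| <= (1 - t) * r by rewrite ler_wpM2l.
by lra.
Qed.

(** In the sup norm each coordinate can be treated separately: the mean value theorem gives a sum of
    n terms, each at most |x - y| / (2 (n + 1)), hence at most half of |x - y|. Dividing by n + 1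
    rather than n also covers n = 0. *)
Lemma small_derivative_contracts U (k : 'rV[R]_n -> 'rV[R]_n) x0 (r : R) :
  (forall x, `|x - x0| <= r -> U x) -> Ck 1 U k ->
  (forall x i j, `|x - x0| <= r ->
     `|'D_(delta_mx 0 i) k x 0 j| <= (2 * n.+1%:R)^-1) ->
  forall x y, `|x - x0| <= r -> `|y - x0| <= r -> `|k x - k y| <= 2^-1 * `|x - y|.
Proof.
move=> rU [dk _] Dk x y xr yr.
apply: mx_norm_le => [|i j]; first by rewrite mulr_ge0.
rewrite [i]ord1 {i}.
have dkj z : U z -> differentiable (fun z => k z 0 j) z.
  by move=> Uz; exact: ((differentiable_mxP _ _).1 (dk z Uz)).
have [||t t01 E] := @MVT_line R _ (fun z => k z 0 j) y (x - y) 1.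
- exact: ler01.
- move=> t t01; apply: diff_derivable; apply: dkj; apply: rU.
  exact: ball_segment.
rewrite scale1r subrK mul1r in E; rewrite !mxE E.
have zr := ball_segment yr xr t01.
set z := t *: (x - y) + y in E zr *.
have -> : 'D_(x - y) (fun z => k z 0 j) z = \sum_i (x - y) 0 i * 'D_(delta_mx 0 i) k z 0 j.
  have dkz := dk z (rU z zr).
  have := derive_mx (@diff_derivable _ _ _ _ _ (x - y) dkz).
  move=> /matrixP/(_ 0 j); rewrite mxE => <-.
  rewrite (deriveE _ dkz) {1}[x - y]row_sum_delta linear_sum/= summxE.
  by apply: eq_bigr => i _; rewrite linearZ/= mxE -(deriveE _ dkz).
rewrite (le_trans (ler_norm_sum _ _ _))//.
apply: (@le_trans _ _ (\sum_(i < n) `|x - y| * (2 * n.+1%:R)^-1)).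
  by apply: ler_sum => i _; rewrite normrM ler_pM ?mx_coord_le_norm//; exact: Dk.
rewrite sumr_const card_ord -[_ *+ n]mulr_natr -mulrA mulrC ler_wpM2r//.
by rewrite invfM -mulrA ler_piMr// mulrC ler_pdivrMr// mul1r ler_nat.
Qed.

Lemma open_preimage_ball f (x0 : 'rV[R]_n) (r : R) V : open V ->
  (forall x, ball x0 r x -> {for x, continuous f}) ->
  open [set x | ball x0 r x /\ V (f x)].
Proof.
move=> oV cf; rewrite openE => x [bx Vx].
have n1 : \near x, ball x0 r x by apply: open_near bx; exact: ball_open.
have n2 : \forall y \near x, V (f y).
  exact: (cf x bx) (open_near oV Vx).
exact: filterI n1 n2.
Qed.

(** Since x - f(x) B contracts by 1/2, the triangle inequality gives |x - y| <= |x - y| / 2 + K |f x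
    - f y|. *)
Lemma inverse_Lipschitz f (x y : 'rV[R]_n) (B : 'M[R]_n) (K : R) :
  (forall v : 'rV[R]_n, `|v *m B| <= K * `|v|) ->
  `|(x - f x *m B) - (y - f y *m B)| <= 2^-1 * `|x - y| ->
  `|x - y| <= 2 * K * `|f x - f y|.
Proof.
move=> KB; rewrite opprB addrACA -opprB => H.
have {}H : `|x - y - (f x - f y) *m B| <= 2^-1 * `|x - y|.
  apply: le_trans H; rewrite le_eqVlt; apply/orP; left; apply/eqP; congr `|_|.
  by rewrite mulmxBl; apply/rowP => i; rewrite !mxE; ring.
have := KB (f x - f y); have := ler_normD (x - y - (f x - f y) *m B) ((f x - f y) *m B).
by rewrite subrK; lra.
Qed.

(** The remainder of g at y is minus the remainder of f at g(y), multiplied by the inverse of J. The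
    Lipschitz bound on g converts an error that is small relative to the increment of g into one
    that is small relative to h; hence the tolerance e / (K C). *)
Lemma inverse_differentiable f (g : 'rV[R]_n -> 'rV[R]_n) V (C : R) y : open V -> V y -> 0 < C ->
  (forall z, V z -> f (g z) = z) ->
  (forall z, V z -> `|g z - g y| <= C * `|z - y|) ->
  differentiable f (g y) -> 'J f (g y) \in unitmx ->
  differentiable g y /\ forall v, 'D_v g y = v *m invmx ('J f (g y)).
Proof.
move=> oV Vy C0 fg gC df uJ; set J := 'J f (g y).
have [K K0 KJ] := mulmx_bound (invmx J).
apply: differentiable_eps_mx.
move=> e e0.
have e'0 : 0 < e / (K * C) by rewrite divr_gt0// mulr_gt0.
have := differentiable_eps df e'0.
move=> /nbhs_ballP[r /= r0 rP].
have nV : \forall h \near (0 : 'rV[R]_n), V (h + y).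
  by move: (open_near oV Vy); rewrite (near_shift 0)/= subr0.
have nr : \forall h \near (0 : 'rV[R]_n), `|h| < r / C.
  by apply: near0_norm_lt; rewrite divr_gt0.
apply: filterS (filterI nV nr) => h [Vh hr].
have gh : `|g (h + y) - g y| <= C * `|h| by have := gC _ Vh; rewrite addrK.
have br : ball 0 r (g (h + y) - g y).
  rewrite -ball_normE/= sub0r normrN (le_lt_trans gh)//.
  by rewrite mulrC -ltr_pdivlMr.
have := rP _ br; rewrite /= subrK !fg// addrK => H.
have E : g (h + y) - g y - h *m invmx J =
    - ((h - 'd f (g y) (g (h + y) - g y)) *m invmx J).
  rewrite -(deriveE _ df) (deriveEjacobian _ df) -/J mulmxBl mulmxK// opprB.
  by [].
rewrite E normrN (le_trans (KJ _))//.
have H2 : `|h - 'd f (g y) (g (h + y) - g y)| <= e / (K * C) * (C * `|h|).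
  by apply: le_trans H _; rewrite ler_wpM2l// ltW.
apply: (@le_trans _ _ (K * (e / (K * C) * (C * `|h|)))).
  by rewrite ler_wpM2l// ltW.
by rewrite le_eqVlt; apply/orP; left; apply/eqP; field; rewrite !gt_eqF.
Qed.

(** Bootstrapping: the derivative of g is a smooth expression in g itself, so each order of
    regularity of g gives the next. *)
Lemma Ck_inverse f g U V k : open U -> open V -> smooth U f ->
  (forall y, V y -> U (g y)) ->
  (forall y, V y -> differentiable g y /\
     forall v, 'D_v g y = v *m invmx ('J f (g y))) ->
  (forall y, V y -> 'J f (g y) \in unitmx) ->
  Ck k V g.
Proof.
move=> oU oV sf VU dg uJ; elim: k => [|k IH].
  by move=> y /dg[/differentiable_continuous].
split=> [y /dg[]//|v].
apply: (@Ck_ext _ _ _ _ _ (fun y => v *m invmx ('J f (g y)))) => // [y /dg[_ ->]//|].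
apply: Ck_mulmx => //; first exact: Ck_cst.
apply: Ck_invmx => //.
apply: (@Ck_comp_mx _ _ _ _ _ _ V U (fun x => 'J f x)) => //.
- exact: coordinatized_rV.
- by apply: Ck_jacobian => //; exact: sf.
Qed.

(** Newton's method with the derivative frozen at x0. The map k x = x - f(x) B, with B the inverse
    of the Jacobian at x0, has zero derivative there, hence contracts near x0; and f x = y holds
    exactly when x is a fixed point of k x + y B. *)
Theorem inverse_function U f x0 : open U -> U x0 -> smooth U f ->
  'J f x0 \in unitmx ->
  exists U' V g, [/\ open U', U' x0, U' `<=` U, open V & smooth V g] /\
    [/\ forall x, U' x -> V (f x) /\ g (f x) = x,
        forall y, V y -> U' (g y) /\ f (g y) = y &
        forall x, U' x -> 'J f x \in unitmx].
Proof.
move=> oU Ux0 sf uJ; set J := 'J f x0 in uJ.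
pose B := invmx J.
pose k (x : 'rV[R]_n) : 'rV[R]_n := x - f x *m B.
have Ck1 : smooth U k.
  move=> m; apply: CkB => //.
    by apply: (@Ck_linear _ _ _ _ _ idfun) => ?; exact: cvg_id.
  by apply: Ck_mulmx; [exact: oU|exact: sf|exact: Ck_cst].
have df x : U x -> differentiable f x by exact: (Ck_differentiable (sf 1%N)).
have dk x : U x -> differentiable k x by exact: (Ck_differentiable (Ck1 1%N)).
have Dk0 i j : 'D_(delta_mx 0 i) k x0 0 j = 0.
  have dfx := @diff_derivable _ _ _ _ _ (delta_mx 0 i) (df _ Ux0).
  have dB : derivable (fun=> B : 'M[R]_n) x0 (delta_mx 0 i) by exact: derivable_cst.
  have dfB := is_derive_mulmx dfx dB.
  have -> : 'D_(delta_mx 0 i) k x0 = 0; last by rewrite mxE.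
  rewrite deriveB; [|exact: derivable_id|by have [] := dfB].
  rewrite derive_id (@derive_val _ _ _ _ _ _ _ dfB) (deriveEjacobian _ (df _ Ux0)) -/J.
  by rewrite derive_cst mulmx0 addr0 mulmxK// subrr.
have [K K0 KB] := mulmx_bound B.
have c0 : 0 < (2 * n.+1%:R : R)^-1 by rewrite invr_gt0 mulr_gt0.
have n1 : \forall x \near x0, forall i, forall j,
    `|'D_(delta_mx 0 i) k x 0 j| <= (2 * n.+1%:R)^-1.
  have H i j : {for x0, continuous (fun x => 'D_(delta_mx 0 i) k x 0 j)}.
    have [_ /(_ (delta_mx 0 i) x0 Ux0)] := Ck1 1%N.
    by move=> /(continuous_mxP _ _).1; apply.
  have H1 i : \forall x \near x0, forall j,
      `|'D_(delta_mx 0 i) k x 0 j| <= (2 * n.+1%:R)^-1.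
    have H2 j := near_eq0_le (H i j) (Dk0 i j) c0.
    exact: (filter_forall _ H2).
  exact: (filter_forall _ H1).
have n2 : \forall x \near x0, 'J f x \in unitmx.
  have cd : {for x0, continuous (fun x => \det ('J f x))}.
    have C0 : Ck 0 U (fun x => \det ('J f x)).
      by apply: Ck_det; [exact: oU|exact: Ck_jacobian (sf 1%N)].
    exact: C0.
  have d0 : \det ('J f x0) != 0 by rewrite -unitfE -unitmxE.
  by apply: filterS (near_neq0 cd d0) => x; rewrite unitmxE unitfE.
have /nbhs_ballP[r0 /= r00 rP] := near_and3 (FF := nbhs_filter x0) (open_near oU Ux0) n1 n2.
pose r := r0 / 2.
have r1 : 0 < r by rewrite divr_gt0.
have inb x : `|x - x0| <= r -> ball x0 r0 x.
  move=> xr; rewrite -ball_normE/= distrC (le_lt_trans xr)//.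
  by rewrite /r ltr_pdivrMr// ltr_pMr// ltr1n.
have contr x y : `|x - x0| <= r -> `|y - x0| <= r -> `|k x - k y| <= 2^-1 * `|x - y|.
  apply: (@small_derivative_contracts U k x0 r _ (Ck1 1%N)) => [z /inb/rP[]//|z i j].
  by move=> /inb/rP[_ H _]; exact: H.
have Lip x y : `|x - x0| <= r -> `|y - x0| <= r -> `|x - y| <= 2 * K * `|f x - f y|.
  by move=> xr yr; apply: (@inverse_Lipschitz f x y B K KB); exact: contr.
(* With this radius K s = r / 4, so [T] sends the closed ball of radius r into the one of radius
   3r/4. The fixed point therefore lies in the open ball. *)
pose s := r / (4 * K).
have s0 : 0 < s by rewrite divr_gt0// mulr_gt0.
pose V := ball (f x0) s.
have oV : open V by exact: ball_open.
have solve y : V y -> exists2 x, ball x0 r x & f x = y.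
  rewrite /V -ball_normE/= => ys.
  pose T x := k x + y *m B.
  have TB x : `|x - x0| <= r -> `|T x - x0| <= 3 / 4 * r.
    move=> xr.
    have -> : T x - x0 = (k x - k x0) + (y - f x0) *m B.
      by rewrite /T /k mulmxBl; apply/rowP => i; rewrite !mxE; ring.
    have x0r : `|x0 - x0| <= r by rewrite subrr normr0 ltW.
    have h1 := contr x x0 xr x0r.
    have h2 := KB (y - f x0).
    have h3 : K * `|y - f x0| <= K * s by rewrite ler_wpM2l// ltW// distrC.
    have h4 : K * s = r / 4 by rewrite /s; field; rewrite gt_eqF.
    have h5 := ler_normD (k x - k x0) ((y - f x0) *m B).
    by lra.
  have [x xr Tx] : exists2 x, `|x - x0| <= r & T x = x.
    apply: contraction_fixpoint => // [x xr|x x' xr xr'].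
      by apply: le_trans (TB x xr) _; lra.
    by rewrite /T opprD addrACA subrr addr0; exact: contr.
  exists x.
    rewrite distrC; have := TB x xr; rewrite Tx => h.
    by apply: le_lt_trans h _; lra.
  have : (y - f x) *m B = 0.
    have : T x - x = 0 by rewrite Tx subrr.
    by rewrite /T /k mulmxBl => <-; apply/rowP => i; rewrite !mxE; ring.
  move/(congr1 (fun v => v *m J)); rewrite mulmxKV// mul0mx => /eqP.
  by rewrite subr_eq0 => /eqP ->.
(* Outside V the value x0 is a default. *)
pose g y := if pselect (V y) is left Vy then s2val (cid2 (solve y Vy)) else x0.
have gP y : V y -> ball x0 r (g y) /\ f (g y) = y.
  move=> Vy; rewrite /g; case: pselect => // Vy'.
  by case: cid2.
have ballr x : ball x0 r x -> `|x - x0| <= r.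
  by rewrite -ball_normE/= distrC => /ltW.
have gL y z : V y -> V z -> `|g z - g y| <= 2 * K * `|z - y|.
  move=> /gP[b1 e1] /gP[b2 e2].
  by have := Lip (g z) (g y) (ballr _ b2) (ballr _ b1); rewrite e1 e2.
(* Restricting the ball to the preimage of V makes f a bijection from U' onto V. *)
pose U' := [set x | ball x0 r x /\ V (f x)].
have U'U : U' `<=` U by move=> x [/ballr/inb/rP[]].
have K20 : 0 < 2 * K by rewrite mulr_gt0.
exists U', V, g; split; split.
- apply: open_preimage_ball => // x /ballr/inb/rP[Ux _ _].
  by apply: differentiable_continuous; exact: df.
- by split; exact: ballxx.
- exact: U'U.
- exact: oV.
- move=> m; apply: (@Ck_inverse f g U V m oU oV sf).
  + by move=> y /gP[/ballr/inb/rP[]].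
  + move=> y Vy; have [by' _] := gP y Vy.
    have [Ug _ ug] := rP _ (inb _ (ballr _ by')).
    apply: (@inverse_differentiable f g V _ y oV Vy K20) => //.
    * by move=> z /gP[].
    * by move=> z Vz; exact: gL.
    * exact: df.
  + by move=> y /gP[/ballr/inb/rP[]].
- move=> x [bx Vx]; split=> //.
  have [bg e] := gP _ Vx.
  have := Lip (g (f x)) x (ballr _ bg) (ballr _ bx); rewrite e subrr normr0 mulr0.
  by rewrite normr_le0 subr_eq0 => /eqP.
- by move=> y Vy; have [bg e] := gP _ Vy; split=> //; split=> //; rewrite e.
- by move=> x [/ballr/inb/rP[]].
Qed.

End InverseFunction.

(** * Integrals along rays *)

Section UnitIntegral.
Context {R : realType}.

Definition int01 (f : R -> R) : R := \int[lebesgue_measure]_(s in `[0, 1]) f s.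

(** Continuity is two-sided even at the end points 0 and 1, so that primitives can have ordinary
    derivatives there. *)
Definition cont01 (f : R -> R) : Prop :=
  forall s, 0 <= s <= 1 -> {for s, continuous f}.

Lemma cont01_within f : cont01 f -> {within `[0, 1], continuous f}.
Proof.
move=> cf; apply: continuous_in_subspaceT => s.
by rewrite inE/= in_itv/= => s01; exact: cf.
Qed.

Lemma cont01_integrable f : cont01 f ->
  (@lebesgue_measure R).-integrable `[0, 1] (EFin \o f).
Proof.
move=> /cont01_within cf.
by apply: continuous_compact_integrable => //; exact: segment_compact.
Qed.

Lemma int01D f g : cont01 f -> cont01 g ->
  int01 (fun s => f s + g s) = int01 f + int01 g.
Proof. by move=> cf cg; rewrite /int01 RintegralD//; exact: cont01_integrable. Qed.

Lemma int01B f g : cont01 f -> cont01 g ->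
  int01 (fun s => f s - g s) = int01 f - int01 g.
Proof. by move=> cf cg; rewrite /int01 RintegralB//; exact: cont01_integrable. Qed.

Lemma int01Z (k : R) f : cont01 f -> int01 (fun s => k * f s) = k * int01 f.
Proof. by move=> cf; rewrite /int01 RintegralZl//; exact: cont01_integrable. Qed.

Lemma eq_int01 f g : (forall s, 0 <= s <= 1 -> f s = g s) -> int01 f = int01 g.
Proof.
move=> fg; apply: eq_Rintegral => s; rewrite inE/= in_itv/=; exact: fg.
Qed.

Lemma int01_cst (k : R) : int01 (fun=> k) = k.
Proof.
rewrite /int01 Rintegral_cst//= lebesgue_measure_itv/= lte_fin ltr01.
by rewrite sube0/= mulr1.
Qed.

Lemma int01_bound f (C : R) : cont01 f ->
  (forall s, 0 <= s <= 1 -> `|f s| <= C) -> `|int01 f| <= C.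
Proof.
move=> cf fC.
have If := cont01_integrable cf.
have cn : cont01 (fun s => `|f s|).
  by move=> s /cf cs; apply: (@continuous_comp _ _ _ f Num.norm) => //; exact: norm_continuous.
apply: (le_trans (le_normr_Rintegral _ _)) => //.
rewrite -[leRHS]int01_cst; apply: le_Rintegral => //.
- exact: cont01_integrable.
- by apply: cont01_integrable => s _; exact: cst_continuous.
Qed.

Lemma int01_FTC f (F : R -> R) : cont01 f ->
  (forall s : R, 0 <= s <= 1 -> is_derive s 1 F (f s)) -> int01 f = F 1 - F 0.
Proof.
move=> cf dF; have cF s : 0 <= s <= 1 -> {for s, continuous F}.
  move=> /dF[dFs _]; apply: differentiable_continuous.
  exact/derivable1_diffP.
rewrite /int01 /Rintegral (@continuous_FTC2 _ f F 0 1) => //.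
- exact: cont01_within.
- split.
  + move=> s; rewrite in_itv/= => /andP[s0 s1].
    by have [] := dF s; rewrite ?ltW.
  + by apply: cvg_at_right_filter; apply: cF; rewrite lexx ler01.
  + by apply: cvg_at_left_filter; apply: cF; rewrite lexx ler01.
- move=> s; rewrite in_itv/= => /andP[s0 s1].
  have s01 : 0 <= s <= 1 by rewrite !ltW.
  by have [_ <-] := dF s s01; rewrite derive1E.
Qed.

Definition clamp01 (s : R) : R := Num.max 0 (Num.min s 1).

Lemma clamp01_in s : 0 <= clamp01 s <= 1.
Proof. by rewrite /clamp01 le_max lexx/= ge_max ler01 ge_min lexx orbT. Qed.

Lemma clamp01_id s : 0 <= s <= 1 -> clamp01 s = s.
Proof. by move=> /andP[s0 s1]; rewrite /clamp01 min_l// max_r. Qed.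

Lemma clamp01_continuous : continuous clamp01.
Proof.
move=> s.
have ci : {for s, continuous (@idfun R)} by exact: cvg_id.
have c1 := continuous_min ci (@cst_continuous R R 1 s).
exact: (continuous_max (@cst_continuous R R 0 s) c1).
Qed.

(** The integrand is frozen outside the unit interval by [clamp01] and integrated from -1, inside
    [-1, 2]. Thus 0 and 1 become interior points and the derivatives there are two-sided. *)
Lemma primitive01 f : cont01 f ->
  exists K : R -> R, forall s : R, 0 <= s <= 1 -> is_derive s 1 K (f s).
Proof.
move=> cf; pose g := f \o clamp01.
have cg : continuous g.
  move=> s; apply: (@continuous_comp _ _ _ clamp01 f); first exact: clamp01_continuous.
  by apply: cf; exact: clamp01_in.
exists (fun y => \int[lebesgue_measure]_(t in `[-1, y]) g t) => s s01.
have ig : (@lebesgue_measure R).-integrable `[-1, 2] (EFin \o g).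
  apply: continuous_compact_integrable; first exact: segment_compact.
  exact: continuous_subspaceT.
have s2 : s < 2 by move/andP: s01 => [_]; lra.
have s1 : -1 < s by move/andP: s01 => [+ _]; lra.
have [dK EK] := continuous_FTC1_closed s2 ig s1 (cg s).
by apply: DeriveDef => //; rewrite -derive1E EK /g/= clamp01_id.
Qed.

(** The substitution t -> s t, without division by s, so that s = 0 is included. *)
Lemma int01_scale f (K : R -> R) (s : R) : cont01 f -> 0 <= s <= 1 ->
  (forall t : R, 0 <= t <= 1 -> is_derive t 1 K (f t)) ->
  s * int01 (fun t => f (s * t)) = K s - K 0.
Proof.
move=> cf s01 dK; have /andP[s0 s1] := s01.
have st t : 0 <= t <= 1 -> 0 <= s * t <= 1.
  by move=> /andP[t0 t1]; rewrite mulr_ge0//= mulr_ile1.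
have cs : cont01 (fun t => f (s * t)).
  move=> t t01; apply: (@continuous_comp _ _ _ ( *%R s) f); first exact: mulrl_continuous.
  by apply: cf; exact: st.
rewrite -int01Z//.
have cs' : cont01 (fun t => s * f (s * t)).
  by move=> t t01; apply: continuousM; [exact: cst_continuous|exact: cs].
suff dKs (t : R) : 0 <= t <= 1 -> is_derive t 1 (fun t => K (s * t)) (s * f (s * t)).
  by rewrite (int01_FTC cs' dKs) mulr1 mulr0.
move=> t01; have dKst := dK _ (st t t01).
have dm : is_derive t 1 ( *%R s) s.
  by apply: (is_derive_eq (is_deriveM (is_derive_cst s t 1) (is_derive_id t 1))); rewrite scaler0 addr0; exact: mulr1.
by have := is_derive1_comp dKst dm; rewrite mulrC.
Qed.

(** The tube lemma: compactness of the unit interval makes a local condition near each (s, p0)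
    uniform in s. *)
Lemma near_tube (V : normedModType R) (p0 : V) (P : V -> R -> Prop) :
  (forall s : R, 0 <= s <= 1 -> \forall s' \near s & p \near p0, P p s') ->
  \forall p \near p0, forall s, 0 <= s <= 1 -> P p s.
Proof.
move=> H.
have c01 : compact `[(0 : R), 1] by exact: segment_compact.
have := (compact_near_coveringP _).1 c01 V (nbhs p0) P _ _.
move=> /(_ (nbhs_filter p0)) h.
have {}h := h _.
have : \forall p \near p0, `[0, 1] `<=` P p.
  by apply: h => s; rewrite /= in_itv/= => s01; exact: H.
by apply: filterS => p hp s s01; apply: hp; rewrite /= in_itv.
Qed.

Lemma tube_dist (V : normedModType R) (p0 : V) (G : R * V -> R) (e : R) : 0 < e ->
  (forall s, 0 <= s <= 1 -> {for (s, p0), continuous G}) ->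
  \forall p \near p0, forall s, 0 <= s <= 1 -> `|G (s, p0) - G (s, p)| <= e.
Proof.
move=> e0 cG.
apply: (@near_tube V p0 (fun p s => `|G (s, p0) - G (s, p)| <= e)) => s s01.
have e2 : 0 < e / 2 by rewrite divr_gt0.
have [[A B] /= [sA pB] AB] := near_dist_lt (cG s s01) e2.
exists (A, B) => // -[s' p] /= [As' Bp].
have /ltW h1 := AB (s', p) (conj As' Bp).
have /ltW h2 := AB (s', p0) (conj As' (nbhs_singleton pB)).
rewrite [e]splitr -(subrKA (G (s, p0))) (le_trans (ler_normD _ _))//.
by rewrite lerD// distrC.
Qed.

End UnitIntegral.

Section Rays.
Context {R : realType}.
Implicit Types (p : 'rV[R]_3) (s : R) (c : 'rV[R]_3 -> R) (B : set 'rV[R]_3).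

(* The third coordinate is a parameter: rays scale the first two only. *)
Definition rayw (i : 'I_3) : nat := (i != 2%:R).

Definition ray s p : 'rV[R]_3 := \row_i (s ^+ rayw i * p 0 i).

Definition raystable B : Prop := forall p s, B p -> 0 <= s <= 1 -> B (ray s p).

(** The weight [s ^+ m] makes the family stable under differentiation: a derivative in x or y
    produces one more factor s from the chain rule, a derivative in the label none. *)
Definition rayint (m : nat) c p : R := int01 (fun s => s ^+ m * c (ray s p)).

Lemma ray1 p : ray 1 p = p.
Proof. by apply/rowP => i; rewrite mxE expr1n mul1r. Qed.

Lemma ray_mul s t p : ray s (ray t p) = ray (s * t) p.
Proof. by apply/rowP => i; rewrite !mxE exprMn mulrA. Qed.

Lemma rayD s p q : ray s (p + q) = ray s p + ray s q.
Proof. by apply/rowP => i; rewrite !mxE mulrDr. Qed.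

Lemma rayZ s (k : R) p : ray s (k *: p) = k *: ray s p.
Proof. by apply/rowP => i; rewrite !mxE mulrCA. Qed.

Lemma ray_delta s i : ray s (delta_mx 0 i) = s ^+ rayw i *: delta_mx 0 i.
Proof.
apply/rowP => j; rewrite !mxE eqxx/=.
by have [->|ji] := eqVneq j i; rewrite ?mulr1 ?mulr0.
Qed.

Lemma raystable_ball (r : R) : raystable (ball (0 : 'rV[R]_3) r).
Proof.
move=> p s; rewrite -ball_normE/= !sub0r !normrN => pr /andP[s0 s1].
apply: le_lt_trans pr; apply: mx_norm_le => // i j; rewrite !mxE normrM.
rewrite -[leRHS]mul1r ler_pM// ?mx_coord_le_norm//.
by rewrite ger0_norm ?exprn_ge0// exprn_ile1.
Qed.

Lemma ray_smooth n : Ck n setT (fun sp : R * 'rV[R]_3 => ray sp.1 sp.2).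
Proof.
have o : open [set: R * 'rV[R]_3] by exact: openT.
have c1 : Ck n setT (fun sp : R * 'rV[R]_3 => sp.1).
  by apply: (@Ck_linear _ _ _ _ _ fst) => ?; exact: cvg_fst.
have c2 : Ck n setT (fun sp : R * 'rV[R]_3 => sp.2).
  by apply: (@Ck_linear _ _ _ _ _ snd) => ?; exact: cvg_snd.
apply/Ck_mxP => // i j; under eq_fun do rewrite mxE.
apply: CkM => //; last by move/(Ck_mxP _ _ o) : c2; apply.
by rewrite /rayw; case: (_ != _) => //=; under eq_fun do rewrite expr0; exact: Ck_cst.
Qed.

Lemma ray_continuous : continuous (fun sp : R * 'rV[R]_3 => ray sp.1 sp.2).
Proof. by move=> sp; exact: (Ck_continuous (ray_smooth 0)). Qed.

Lemma ray_continuousl p : continuous (fun s => ray s p).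
Proof.
move=> s; apply: (@continuous_comp _ _ _ (fun s => (s, p)) (fun sp : R * 'rV[R]_3 => ray sp.1 sp.2)).
  apply: (@Ck_continuous R _ _ 0 setT) => //.
  apply: Ck_pair; [exact: openT| |exact: Ck_cst].
  by apply: (@Ck_linear _ _ _ _ _ idfun) => ?; exact: cvg_id.
exact: ray_continuous.
Qed.

Lemma rayint_cont01 m c B p : raystable B -> B p ->
  (forall q, B q -> {for q, continuous c}) ->
  cont01 (fun s => s ^+ m * c (ray s p)).
Proof.
move=> sB Bp cc s s01; apply: continuousM; first exact: exprn_continuous.
apply: (@continuous_comp _ _ _ (fun s => ray s p) c); first exact: ray_continuousl.
by apply: cc; exact: sB.
Qed.

Lemma ray_tube c B p (e : R) : 0 < e -> raystable B -> B p ->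
  (forall q, B q -> {for q, continuous c}) ->
  \forall q \near p, forall s, 0 <= s <= 1 -> `|c (ray s p) - c (ray s q)| <= e.
Proof.
move=> e0 sB Bp cc.
apply: (@tube_dist R _ p (fun sp => c (ray sp.1 sp.2)) e e0) => s s01.
apply: (@continuous_comp _ _ _ (fun sp : R * 'rV[R]_3 => ray sp.1 sp.2) c).
  exact: ray_continuous.
by apply: cc; exact: sB.
Qed.

Lemma rayint_continuous m c B p : open B -> raystable B -> B p ->
  (forall q, B q -> {for q, continuous c}) -> {for p, continuous (rayint m c)}.
Proof.
move=> oB sB Bp cc; apply: near_dist_continuous => e e0.
have N := near_and (open_near oB Bp) (ray_tube e0 sB Bp cc).
apply: near_sub N => q [Bq H].
rewrite /rayint -int01B; [|exact: rayint_cont01 cc|exact: rayint_cont01 cc].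
apply: int01_bound => [s s01|s s01].
  by apply: continuousB; apply: rayint_cont01 cc _ s01.
rewrite -mulrBr normrM -[leRHS]mul1r ler_pM//; last exact: H.
by case/andP: s01 => s0 s1; rewrite ger0_norm ?exprn_ge0// exprn_ile1.
Qed.

(** Differentiation under the integral sign. For each s the difference quotient equals the
    derivative of c at an intermediate point of a nearby ray, and [ray_tube] bounds the resulting
    error uniformly in s. *)
Lemma rayint_derivative m c B p i : open B -> raystable B -> B p -> Ck 1 B c ->
  derivable (rayint m c) p (delta_mx 0 i) /\
  'D_(delta_mx 0 i) (rayint m c) p = rayint (m + rayw i) ('D_(delta_mx 0 i) c) p.
Proof.
move=> oB sB Bp Cc; set v := delta_mx 0 i; have [dc Dc] := Cc.
have cc q : B q -> {for q, continuous c} by exact: (Ck_continuous Cc).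
have cD q : B q -> {for q, continuous ('D_v c)} by exact: Dc.
suff H : h^-1 *: (rayint m c (h *: v + p) - rayint m c p) @[h --> 0^'] -->
    rayint (m + rayw i) ('D_v c) p.
  by split; [apply/cvg_ex; eexists; exact: H|exact: cvg_lim H].
apply/cvgrPdist_le => e e0.
have /nbhs_ballP[r /= r0 rP] :=
  near_and (open_near oB Bp) (ray_tube e0 sB Bp cD).
have v1 : `|v| <= 1.
  apply: mx_norm_le => // a b; rewrite mxE; case: (_ && _); rewrite ?normr0 ?normr1//.
have inb (h : R) : `|h| < r -> ball p r (h *: v + p).
  move=> hr; rewrite -ball_normE/= distrC addrK normrZ (le_lt_trans _ hr)//.
  by rewrite ler_piMr.
have n1 : \forall h \near (0 : R)^', `|h| < r by exact: dnbhs0_lt.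
have n2 : \forall h \near (0 : R)^', h != 0 by exact: nbhs_dnbhs_neq.
apply: filterS (filterI n1 n2) => h [hr h0].
have [Bh _] := rP _ (inb h hr).
have k1 := @rayint_cont01 m c B _ sB Bh cc.
have k2 := @rayint_cont01 m c B _ sB Bp cc.
have k3 := @rayint_cont01 (m + rayw i) _ B _ sB Bp cD.
have k12 : cont01 (fun s => s ^+ m * c (ray s (h *: v + p)) - s ^+ m * c (ray s p)).
  by move=> s s01; apply: continuousB; [exact: k1|exact: k2].
have k4 : cont01 (fun s => h^-1 *
    (s ^+ m * c (ray s (h *: v + p)) - s ^+ m * c (ray s p))).
  by move=> s s01; apply: continuousM; [exact: cst_continuous|exact: k12].
rewrite /rayint -int01B// -[_ *: _]/(_ * _) -int01Z// -int01B//.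
apply: int01_bound => [s s01|s s01]; first by apply: continuousB; [exact: k3|exact: k4].
have /andP[s0 s1] := s01.
(* Moving p by h along e_i moves the point with parameter s on its ray by [u]. *)
pose u := (h * s ^+ rayw i) *: v.
have E t : t *: u + ray s p = ray s ((t * h) *: v + p).
  by rewrite rayD rayZ ray_delta !scalerA; congr (_ *: _ + _); ring.
have inB t : 0 <= t <= 1 -> ball p r ((t * h) *: v + p).
  move=> /andP[t0 t1]; apply: inb; rewrite normrM (le_lt_trans _ hr)//.
  by rewrite (ger0_norm t0) ler_piMl.
have [||t t01 Et] := @MVT_line R _ c (ray s p) u 1.
- exact: ler01.
- move=> t t01; apply: diff_derivable; apply: dc; rewrite E.
  by apply: sB s01; have [] := rP _ (inB t t01).
rewrite E mul1r in Et; rewrite E mul1r in Et.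
have [Bt Ht] := rP _ (inB t t01).
have Du : 'D_u c (ray s ((t * h) *: v + p)) =
    h * s ^+ rayw i * 'D_v c (ray s ((t * h) *: v + p)).
  have dct := dc _ (sB _ _ Bt s01).
  by rewrite !(deriveE _ dct) linearZ.
rewrite -mulrBr Et Du.
have -> : s ^+ (m + rayw i) * 'D_v c (ray s p) -
    h^-1 * (s ^+ m * (h * s ^+ rayw i * 'D_v c (ray s ((t * h) *: v + p)))) =
    s ^+ (m + rayw i) * ('D_v c (ray s p) - 'D_v c (ray s ((t * h) *: v + p))).
  set X := 'D_v c _; set Y := 'D_v c _.
  by rewrite exprD; field.
rewrite normrM -[leRHS]mul1r ler_pM//; last exact: Ht.
by rewrite ger0_norm ?exprn_ge0// exprn_ile1.
Qed.

Lemma Ck_rayint k m c B : open B -> raystable B -> Ck k B c -> Ck k B (rayint m c).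
Proof.
move=> oB sB; elim: k m c => [|k IH] m c Cc.
  by move=> p Bp; exact: (rayint_continuous oB sB Bp Cc).
have C1 : Ck 1 B c.
  by elim: k {IH} Cc => // k IH /CkW.
apply: Ck_partials => // [p i Bp|i].
  by have [] := rayint_derivative m i oB sB Bp C1.
apply: (@Ck_ext _ _ _ _ _ (rayint (m + rayw i) ('D_(delta_mx 0 i) c))) => // [p Bp|].
  by have [_ ->] := rayint_derivative m i oB sB Bp C1.
by apply: IH; have [_] := Cc; apply.
Qed.

End Rays.

(** * Integrable plane fields *)

Section Real.
Context {R : realType}.

(** With d n = 2M / 2^n one has d n - d (n + 1) = M / 2^n, so the intervals of radius d n around u n
    are nested, and the supremum of their left ends lies in all of them. *)
Lemma geometric_limit (u : nat -> R) (M : R) : 0 <= M ->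
  (forall n, `|u n.+1 - u n| <= M / 2 ^+ n) ->
  exists l, forall n, `|u n - l| <= 2 * M / 2 ^+ n.
Proof.
move=> M0 Hu.
pose d n := 2 * M / 2 ^+ n.
have dS n : M / 2 ^+ n = d n - d n.+1.
  by rewrite /d exprS; field; rewrite expf_neq0.
have d0 n : 0 <= d n by rewrite /d divr_ge0// ?mulr_ge0// exprn_ge0.
have aS n : u n - d n <= u n.+1 - d n.+1.
  by have := Hu n; rewrite dS ler_norml => /andP[]; lra.
have bS n : u n.+1 + d n.+1 <= u n + d n.
  by have := Hu n; rewrite dS ler_norml => /andP[]; lra.
have aM m n : (m <= n)%N -> u m - d m <= u n - d n.
  by move=> /subnK <-; elim: (n - m)%N => // k IH; rewrite addSn (le_trans IH).
have bM m n : (m <= n)%N -> u n + d n <= u m + d m.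
  by move=> /subnK <-; elim: (n - m)%N => // k IH; rewrite addSn (le_trans _ IH).
have ab m n : u m - d m <= u n + d n.
  have h1 := aM m (maxn m n) (leq_maxl _ _).
  have h2 := bM n (maxn m n) (leq_maxr _ _).
  by have := d0 (maxn m n); lra.
pose A := [set u n - d n | n in setT].
have hA : has_sup A.
  split; first by exists (u 0%N - d 0%N); exists 0%N.
  by exists (u 0%N + d 0%N) => _ [n _ <-]; exact: ab.
exists (sup A) => n; rewrite -/(d n).
have h1 : u n - d n <= sup A by apply: ub_le_sup => //; [case: hA|exists n].
have h2 : sup A <= u n + d n.
  by apply: ge_sup; [case: hA|move=> _ [m _ <-]; exact: ab].
by rewrite ler_norml; apply/andP; split; lra.
Qed.

Lemma geometric_le (M e : R) : 0 < e -> exists n : nat, M / 2 ^+ n <= e.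
Proof.
move=> e0; exists (Num.truncn (M / e)).+1; set n := (Num.truncn _).+1.
have : M / e < n%:R by exact: truncnS_gt.
rewrite ler_pdivrMr ?exprn_gt0// ltr_pdivrMr// => /ltW h1.
have h2 : (n%:R : R) <= 2 ^+ n by rewrite -natrX ler_nat ltnW// ltn_expl.
by apply: (le_trans h1); rewrite mulrC ler_wpM2l// ltW.
Qed.

Lemma geometric_small (x M : R) : (forall n : nat, `|x| <= M / 2 ^+ n) -> x = 0.
Proof.
move=> H; apply/eqP; rewrite -normr_le0; apply/ler_addgt0Pr => e e0; rewrite add0r.
by have [n Mn] := geometric_le M e0; exact: le_trans (H n) Mn.
Qed.

Lemma sum3_bound (a0 a1 a2 x0 x1 x2 M e : R) :
  `|a0| <= M -> `|a1| <= M -> `|a2| <= M ->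
  `|x0| <= e -> `|x1| <= e -> `|x2| <= e ->
  `|a0 * x0 + a1 * x1 + a2 * x2| <= 3 * M * e.
Proof.
move=> h0 h1 h2 k0 k1 k2.
have -> : 3 * M * e = M * e + M * e + M * e by ring.
apply: le_trans (ler_normD _ _) _; apply: lerD; last by rewrite normrM ler_pM.
by apply: le_trans (ler_normD _ _) _; apply: lerD; rewrite normrM ler_pM.
Qed.

Lemma half_gronwall (D D' : R -> R) (eta : R) :
  (forall s : R, 0 <= s <= 1 -> is_derive s 1 D (D' s)) -> D 0 = 0 ->
  (forall s : R, 0 <= s <= 1 -> `|D' s| <= eta + 2^-1 * `|D s|) ->
  `|D 1| <= 2 * eta.
Proof.
move=> dD D0 HD.
have cN : {within `[0, 1], continuous (fun s => `|D s|)}.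
  apply: continuous_in_subspaceT => s; rewrite inE/= in_itv/= => /dD[ds _].
  apply: (@continuous_comp _ _ _ D Num.norm); last exact: norm_continuous.
  by apply: differentiable_continuous; exact/derivable1_diffP.
have [c c01 Hc] := EVT_max ler01 cN.
have c01' : 0 <= c <= 1 by move: c01; rewrite in_itv.
have /andP[c0 c1] := c01'.
have [||t t0c E] := @MVT_segment R D D' 0 c c0.
- move=> s; rewrite in_itv/= => /andP[s0 sc]; apply: dD.
  by rewrite ltW//= (le_trans (ltW sc)).
- apply: derivable_within_continuous => s; rewrite in_itv/= => /andP[s0 sc].
  by have [|] := dD s; rewrite ?s0//= (le_trans sc).
have t01 : 0 <= t <= 1.
  by move: t0c; rewrite in_itv/= => /andP[-> tc]; rewrite (le_trans tc).
have h1 : `|D c| <= `|D' t|.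
  by move: E; rewrite D0 !subr0 => ->; rewrite normrM (ger0_norm c0) ler_piMr.
have h2 := HD t t01.
have h3 : `|D t| <= `|D c| by apply: Hc; rewrite in_itv.
have h4 : `|D 1| <= `|D c| by apply: Hc; rewrite in_itv/= ler01 lexx.
by lra.
Qed.

End Real.

Section Coordinates3.
Context {R : realType}.

Lemma sum3 (V : nmodType) (F : 'I_3 -> V) : \sum_i F i = F 0 + F 1 + F 2%:R.
Proof.
rewrite !big_ord_recl big_ord0 addr0 addrA.
by congr (F _ + F _ + F _); apply/val_inj.
Qed.

Lemma forall3 (P : 'I_3 -> Prop) : P 0 -> P 1 -> P 2%:R -> forall i, P i.
Proof.
move=> P0 P1 P2 [[|[|[|//]]] Hi].
- by rewrite (_ : Ordinal Hi = 0)//; apply/val_inj.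
- by rewrite (_ : Ordinal Hi = 1)//; apply/val_inj.
- by rewrite (_ : Ordinal Hi = 2%:R)//; apply/val_inj.
Qed.

Lemma derive3 (f : 'rV[R]_3 -> R) x a : differentiable f x ->
  'D_a f x = a 0 0 * 'D_(e_ 0) f x + a 0 1 * 'D_(e_ 1) f x
    + a 0 2%:R * 'D_(e_ 2%:R) f x.
Proof.
move=> df; rewrite (deriveE a df) {1}[a]row_sum_delta linear_sum/= sum3.
by rewrite !linearZ/= !(deriveE _ df).
Qed.

Lemma derive_dirZ (V : normedModType R) (f : V -> R) x (k : R) v :
  differentiable f x -> 'D_(k *: v) f x = k * 'D_v f x.
Proof. by move=> df; rewrite !(deriveE _ df) linearZ. Qed.

(* (x, y, z) for p = (x, y, q), where q is the label of a leaf. *)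
Definition emb (p : 'rV[R]_3) (z : R) : 'rV[R]_3 :=
  \row_i (if i == 2%:R then z else p 0 i).

Lemma Ck_emb (V : normedModType R) n (U : set V) (p : V -> 'rV[R]_3) (z : V -> R) :
  open U -> Ck n U p -> Ck n U z -> Ck n U (fun x => emb (p x) (z x)).
Proof.
move=> oU /(Ck_mxP _ _ oU) Cp Cz; apply/Ck_mxP => // i j.
have [->|j2] := eqVneq j 2%:R; first by under eq_fun do rewrite mxE eqxx.
by under eq_fun do rewrite mxE (negbTE j2).
Qed.

Lemma Ck_id (V : normedModType R) n (U : set V) : Ck n U (fun x : V => x).
Proof. by apply: (@Ck_linear _ _ _ _ _ idfun) => ?; exact: cvg_id. Qed.

Lemma Ck_coord m k n (U : set 'M[R]_(m, k)) i j : open U -> Ck n U (fun x => x i j).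
Proof. by move=> oU; have /(Ck_mxP _ _ oU) := @Ck_id _ n U; apply. Qed.

Lemma emb_norm p z (r : R) : `|p| < r -> `|z| < r -> `|emb p z| < r.
Proof.
move=> pr zr; apply: (@le_lt_trans _ _ (Num.max `|p| `|z|)); last by rewrite gt_max pr zr.
apply: mx_norm_le => [|i j]; first by rewrite le_max normr_ge0.
rewrite mxE le_max; case: ifP => _; first by rewrite lexx orbT.
by rewrite mx_coord_le_norm.
Qed.

End Coordinates3.

(** * Picard iteration for leaves written as graphs *)

Section Frobenius.
Context {R : realType} (P Q : 'rV[R]_3 -> R) (rho C L r : R).
Let W := ball (0 : 'rV[R]_3) rho.
Let B := ball (0 : 'rV[R]_3) r.
Context (r0 : 0 < r) (r_rho : r <= rho) (C0 : 0 <= C) (L0 : 0 <= L).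
Context (rC : r + 2 * r * C < rho) (rL : 2 * r * L <= 2^-1).
Context (sP : smooth W P) (sQ : smooth W Q).
Context (PC : forall a, W a -> `|P a| <= C) (QC : forall a, W a -> `|Q a| <= C).
Context (PL : forall a, W a -> `|'D_(e_ 2%:R) P a| <= L).
Context (QL : forall a, W a -> `|'D_(e_ 2%:R) Q a| <= L).

Let along (Z : 'rV[R]_3 -> R) (c : 'rV[R]_3 -> R) p := c (emb p (Z p)).

(** Let z = Z(x, y, q) be tangent to the planes dz = P dx + Q dy, with value q at x = y = 0. Along
    the ray to (x, y) it satisfies zeta' = x P + y Q with zeta(0) = q; integrating from 0 to 1 gives
    the fixed point equation of [picard]. *)
Definition picard (Z : 'rV[R]_3 -> R) (p : 'rV[R]_3) : R :=
  p 0 2%:R + (p 0 0 * rayint 0 (along Z P) p + p 0 1 * rayint 0 (along Z Q) p).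

(** The radius 2rC bounds the displacement produced by one application of [picard]. By the
    hypothesis [rC] the graph then stays inside W, and by [rL] the iteration contracts by 1/2. *)
Definition admissible (Z : 'rV[R]_3 -> R) : Prop :=
  (forall p, B p -> {for p, continuous Z}) /\
  (forall p, B p -> `|Z p - p 0 2%:R| <= 2 * r * C).

Let inB p : B p = (`|p| < r).
Proof. by rewrite /B -ball_normE/= sub0r normrN. Qed.

Let inW p : W p = (`|p| < rho).
Proof. by rewrite /W -ball_normE/= sub0r normrN. Qed.

Let oB : open B. Proof. exact: ball_open. Qed.
Let oW : open W. Proof. exact: ball_open. Qed.
Let sB : raystable B. Proof. exact: raystable_ball. Qed.

Let coordB p i : B p -> `|p 0 i| <= r.
Proof. by rewrite inB => /ltW pr; apply: le_trans pr; exact: mx_coord_le_norm. Qed.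

Lemma admissible_emb Z p : admissible Z -> B p -> W (emb p (Z p)).
Proof.
move=> [_ HZ] Bp; rewrite inW; apply: emb_norm.
  by move: Bp; rewrite inB => /lt_le_trans; apply.
rewrite -[Z p](subrK (p 0 2%:R)); apply: le_lt_trans (ler_normD _ _) _.
by apply: le_lt_trans rC; rewrite [leRHS]addrC lerD//; [exact: HZ|exact: coordB].
Qed.

Lemma along_continuous Z c p : admissible Z -> (forall a, W a -> {for a, continuous c}) ->
  B p -> {for p, continuous (along Z c)}.
Proof.
move=> aZ cc Bp.
apply: (@continuous_comp _ _ _ (fun p => emb p (Z p)) c); last exact: cc (admissible_emb aZ Bp).
have CZ : Ck 0 B Z by case: aZ.
by apply: (Ck_continuous (n := 0) (U := B)) => //; apply: Ck_emb => //; exact: Ck_id.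
Qed.

Let cP a : W a -> {for a, continuous P}. Proof. exact: (Ck_continuous (sP 0)). Qed.
Let cQ a : W a -> {for a, continuous Q}. Proof. exact: (Ck_continuous (sQ 0)). Qed.

Lemma rayint_bound c (K : R) p : (forall q, B q -> {for q, continuous c}) ->
  (forall q, B q -> `|c q| <= K) -> B p -> `|rayint 0 c p| <= K.
Proof.
move=> cc cK Bp; apply: int01_bound; first exact: (@rayint_cont01 _ 0 c B p sB Bp cc).
by move=> s s01; rewrite expr0 mul1r; apply: cK; exact: sB.
Qed.

Lemma picard_admissible Z : admissible Z -> admissible (picard Z).
Proof.
move=> aZ.
have aP q : B q -> {for q, continuous (along Z P)} by exact: along_continuous.
have aQ q : B q -> {for q, continuous (along Z Q)} by exact: along_continuous.
split=> p Bp.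
  have CP : Ck 0 B (along Z P) by [].
  have CQ : Ck 0 B (along Z Q) by [].
  apply: (Ck_continuous (n := 0) (U := B)); last exact: Bp.
  apply: CkD; [exact: oB|exact: Ck_coord|].
  apply: CkD; first exact: oB.
    by apply: CkM; [exact: oB|exact: Ck_coord|exact: Ck_rayint].
  by apply: CkM; [exact: oB|exact: Ck_coord|exact: Ck_rayint].
rewrite /picard addrC addKr (le_trans (ler_normD _ _))// !normrM.
have b1 : `|rayint 0 (along Z P) p| <= C.
  by apply: rayint_bound => // q Bq; apply: PC; exact: admissible_emb.
have b2 : `|rayint 0 (along Z Q) p| <= C.
  by apply: rayint_bound => // q Bq; apply: QC; exact: admissible_emb.
have h1 : `|p 0 0| * `|rayint 0 (along Z P) p| <= r * C by rewrite ler_pM// coordB.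
have h2 : `|p 0 1| * `|rayint 0 (along Z Q) p| <= r * C by rewrite ler_pM// coordB.
by lra.
Qed.

Let convexW a b t : W a -> W b -> 0 <= t <= 1 -> W (t *: (a - b) + b).
Proof.
rewrite !inW => aW bW t01; pose m := Num.max `|a| `|b|.
have am : `|a - 0| <= m by rewrite subr0 le_max lexx.
have bm : `|b - 0| <= m by rewrite subr0 le_max lexx orbT.
have := ball_segment bm am t01; rewrite subr0 => h.
by apply: le_lt_trans h _; rewrite gt_max aW.
Qed.

Lemma increment (c : 'rV[R]_3 -> R) a b : smooth W c -> W a -> W b ->
  exists t, [/\ 0 <= t <= 1, W (t *: (a - b) + b) &
    c a - c b = 'D_(a - b) c (t *: (a - b) + b)].
Proof.
move=> sc aW bW; have [dc _] := sc 1%N.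
have [||t t01 E] := @MVT_line R _ c b (a - b) 1.
- exact: ler01.
- by move=> t t01; apply: diff_derivable; apply: dc; exact: convexW.
rewrite scale1r subrK mul1r in E.
by exists t; split; [exact: t01|exact: convexW|exact: E].
Qed.

Lemma lipschitz_along (c : 'rV[R]_3 -> R) a z z' : smooth W c ->
  (forall a, W a -> `|'D_(e_ 2%:R) c a| <= L) ->
  W (emb a z) -> W (emb a z') -> `|c (emb a z) - c (emb a z')| <= L * `|z - z'|.
Proof.
move=> sc cL Wz Wz'.
have [t [t01 Wt ->]] := increment sc Wz Wz'.
set x := t *: _ + _ in Wt *.
have dc : differentiable c x by exact: (Ck_differentiable (sc 1%N)).
have -> : emb a z - emb a z' = (z - z') *: e_ 2%:R.
  by apply/rowP => i; rewrite !mxE eqxx/=; case: eqP => _ /=; ring.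
rewrite (deriveE _ dc) linearZ/= -(deriveE _ dc) normrM mulrC.
by rewrite ler_wpM2r//; exact: cL.
Qed.

Lemma picard_contracts Z Z' (d : R) : admissible Z -> admissible Z' ->
  (forall p, B p -> `|Z p - Z' p| <= d) ->
  forall p, B p -> `|picard Z p - picard Z' p| <= 2^-1 * d.
Proof.
move=> aZ aZ' H p Bp.
have d0 : 0 <= d by apply: le_trans (H p Bp).
have key (c : 'rV[R]_3 -> R) (i : 'I_3) : smooth W c ->
    (forall a, W a -> `|'D_(e_ 2%:R) c a| <= L) ->
    `|p 0 i * rayint 0 (along Z c) p - p 0 i * rayint 0 (along Z' c) p| <= r * (L * d).
  move=> sc cL; rewrite -mulrBr normrM ler_pM//; first exact: coordB.
  have cc a : W a -> {for a, continuous c} by exact: (Ck_continuous (sc 0)).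
  have k1 : cont01 (fun s => s ^+ 0 * along Z c (ray s p)).
    by apply: (@rayint_cont01 _ 0 _ B p sB Bp) => q Bq; exact: along_continuous.
  have k2 : cont01 (fun s => s ^+ 0 * along Z' c (ray s p)).
    by apply: (@rayint_cont01 _ 0 _ B p sB Bp) => q Bq; exact: along_continuous.
  rewrite /rayint -int01B//; apply: int01_bound => s s01.
    by apply: continuousB; [exact: k1|exact: k2].
  rewrite !expr0 !mul1r; have Bs := sB Bp s01.
  apply: (le_trans (lipschitz_along sc cL _ _)); try exact: admissible_emb.
  by rewrite ler_wpM2l//; exact: H.
have h1 := key P 0 sP PL; have h2 := key Q 1 sQ QL.
have E : 2 * r * L * d <= 2^-1 * d by rewrite ler_wpM2r.
rewrite /picard opprD addrACA subrr add0r opprD addrACA.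
apply: (le_trans (ler_normD _ _)); apply: (le_trans (lerD h1 h2)).
by apply: le_trans E; rewrite le_eqVlt; apply/orP; left; apply/eqP; ring.
Qed.

(** The iterates start at the label and converge pointwise at a geometric rate that is the same at
    all points of B. This uniform rate makes the limit continuous, admissible and fixed. *)
Lemma picard_fixpoint : exists2 Z, admissible Z & forall p, B p -> picard Z p = Z p.
Proof.
pose Zn n := iter n picard (fun p => p 0 2%:R).
have aZn n : admissible (Zn n).
  elim: n => [|n IH]; last exact: picard_admissible.
  split=> p Bp; last by rewrite subrr normr0 !mulr_ge0// ltW.
  by apply: (Ck_continuous (n := 0) (U := B)); [exact: Ck_coord|exact: Bp].
pose M := 2 * r * C.
have M0 : 0 <= M by rewrite !mulr_ge0// ltW.
have step n p : B p -> `|Zn n.+1 p - Zn n p| <= M / 2 ^+ n.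
  elim: n p => [|n IH] p Bp.
    by rewrite expr0 divr1; have [_] := aZn 1%N; apply.
  have := picard_contracts (aZn n.+1) (aZn n) IH Bp.
  by rewrite mulrCA -invfM -exprS.
have lim p : exists l, B p -> forall n, `|Zn n p - l| <= 2 * M / 2 ^+ n.
  have [Bp|nB] := pselect (B p); last by exists 0.
  by have [l Hl] := geometric_limit M0 (fun n => step n p Bp); exists l.
pose Z p := sval (cid (lim p)).
have HZ p n : B p -> `|Zn n p - Z p| <= 2 * M / 2 ^+ n.
  by move=> Bp; apply: (svalP (cid (lim p))).
have aZ : admissible Z.
  split=> p Bp.
    apply: near_dist_continuous => e e0.
    have e3 : 0 < e / 3 by rewrite divr_gt0.
    have [n Hn] := geometric_le (2 * M) e3.
    have [cn _] := aZn n.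
    apply: near_sub (near_and (open_near oB Bp) (near_dist_lt (cn p Bp) e3)).
    move=> q [Bq /ltW h].
    have h1 := le_trans (HZ p n Bp) Hn; have h2 := le_trans (HZ q n Bq) Hn.
    have -> : Z p - Z q = - (Zn n p - Z p) + (Zn n p - Zn n q) + (Zn n q - Z q) by ring.
    apply: (le_trans (ler_normD _ _)); rewrite (_ : e = e / 3 + e / 3 + e / 3); last by field.
    rewrite lerD//; apply: (le_trans (ler_normD _ _)); rewrite lerD//.
    by rewrite normrN.
  apply/ler_addgt0Pr => e e0; have [n Hn] := geometric_le (2 * M) e0.
  have h1 := le_trans (HZ p n Bp) Hn; have [_ /(_ p Bp) h2] := aZn n.
  rewrite -(subrKA (Zn n p)) addrC; apply: (le_trans (ler_normD _ _)).
  by rewrite lerD// distrC.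
exists Z => // p Bp; apply/eqP; rewrite -subr_eq0; apply/eqP.
apply: (@geometric_small _ _ (2 * M)) => n.
have h1 := picard_contracts aZ (aZn n) (fun q Bq => (eq_ind _ (fun x => x <= _) (HZ q n Bq) _ (distrC _ _))) Bp.
have h2 := HZ p n.+1 Bp.
rewrite -(subrKA (Zn n.+1 p)); apply: (le_trans (ler_normD _ _)); apply: (le_trans (lerD h1 h2)).
by rewrite exprS le_eqVlt; apply/orP; left; apply/eqP; field; rewrite expf_neq0.
Qed.


Section Solution.
Context (Z : 'rV[R]_3 -> R) (aZ : admissible Z).
Context (fZ : forall p, B p -> picard Z p = Z p).

Let b (p : 'rV[R]_3) (s : R) : 'rV[R]_3 := emb (ray s p) (Z (ray s p)).

Let speed (p : 'rV[R]_3) (s : R) : R := p 0 0 * P (b p s) + p 0 1 * Q (b p s).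

Let Wb p s : B p -> 0 <= s <= 1 -> W (b p s).
Proof. by move=> Bp s01; apply: admissible_emb => //; exact: sB. Qed.

Let cZ p : B p -> {for p, continuous Z}. Proof. by case: aZ => cz _; exact: cz. Qed.

Let comp_cont01 c p : B p -> (forall a, W a -> {for a, continuous c}) ->
  cont01 (fun s => c (b p s)).
Proof.
move=> Bp cc s s01.
apply: (@continuous_comp _ _ _ (fun s => ray s p) (along Z c)).
  exact: ray_continuousl.
by apply: along_continuous => //; exact: sB.
Qed.

Let speed_cont01 p : B p -> cont01 (speed p).
Proof.
move=> Bp s s01; apply: continuousD; apply: continuousM.
- exact: cst_continuous.
- exact: (comp_cont01 Bp cP).
- exact: cst_continuous.
- exact: (comp_cont01 Bp cQ).
Qed.

Lemma Z_ray0 p : B p -> Z (ray 0 p) = p 0 2%:R.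
Proof.
move=> Bp; rewrite -fZ; last by apply: sB => //; rewrite lexx ler01.
by rewrite /picard !mxE /rayw/= expr0 !expr1 !mul0r mul1r !addr0.
Qed.

(** The fixed point equation at [ray s p] is rescaled by [int01_scale] into the integrated
    differential equation. [zeta] is built from a primitive and compared with Z on the unit interval
    only; this way it has two-sided derivatives at 0 and 1. *)
Lemma ray_ode p : B p -> exists zeta : R -> R,
  (forall s, 0 <= s <= 1 -> zeta s = Z (ray s p)) /\
  forall s : R, 0 <= s <= 1 -> is_derive s 1 zeta (speed p s).
Proof.
move=> Bp; have [K dK] := primitive01 (speed_cont01 Bp).
exists (fun s => p 0 2%:R + (K s - K 0)); split=> [s s01|s s01].
  rewrite -(int01_scale (speed_cont01 Bp) s01 dK) -(fZ (sB Bp s01)) /picard.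
  have -> : (ray s p) 0 2%:R = p 0 2%:R by rewrite mxE expr0 mul1r.
  have -> : (ray s p) 0 0 = s * p 0 0 by rewrite mxE expr1.
  have -> : (ray s p) 0 1 = s * p 0 1 by rewrite mxE expr1.
  have E c : rayint 0 (along Z c) (ray s p) = int01 (fun t => c (b p (s * t))).
    by apply: eq_int01 => t _; rewrite expr0 mul1r ray_mul mulrC.
  have cc c : (forall a, W a -> {for a, continuous c}) -> cont01 (fun t => c (b p (s * t))).
    move=> cc t t01; apply: (@continuous_comp _ _ _ ( *%R s) (fun t => c (b p t))).
      exact: mulrl_continuous.
    apply: comp_cont01 => //; case/andP: s01 => s0 s1; case/andP: t01 => t0 t1.
    by rewrite mulr_ge0//= mulr_ile1.
  have cx c (k : R) : cont01 c -> cont01 (fun t => k * c t).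
    by move=> ck t t01; apply: continuousM; [exact: cst_continuous|exact: ck].
  rewrite !E /speed int01D; [|exact: cx (cc _ cP)|exact: cx (cc _ cQ)].
  by rewrite !int01Z; [ring|exact: cc cQ|exact: cc cP].
have dKs := dK s s01.
apply: (is_derive_eq (is_deriveD (is_derive_cst (p 0 2%:R) s 1)
  (is_deriveB dKs (is_derive_cst (K 0) s 1)))).
by rewrite add0r subr0.
Qed.

Let along_tube (c : 'rV[R]_3 -> R) p (e : R) : 0 < e -> B p ->
  (forall a, W a -> {for a, continuous c}) ->
  \forall d \near (0 : 'rV[R]_3), forall s, 0 <= s <= 1 ->
    `|c (b p s + d) - c (b p s)| <= e.
Proof.
move=> e0 Bp cc.
pose G (sd : R * 'rV[R]_3) := c (b p sd.1 + sd.2).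
have cG s : 0 <= s <= 1 -> {for (s, 0), continuous G}.
  move=> s01.
  apply: (@continuous_comp _ _ _ (fun sd : R * 'rV[R]_3 => b p sd.1 + sd.2) c); last first.
    by apply: cc; rewrite /= addr0; exact: Wb.
  apply: continuousD; last exact: cvg_snd.
  apply: (@continuous_comp _ _ _ fst (b p)); first exact: cvg_fst.
  apply: (@continuous_comp _ _ _ (fun s => ray s p) (fun q => emb q (Z q))).
    exact: ray_continuousl.
  apply: (Ck_continuous (n := 0) (U := B)); last exact: sB.
  by apply: Ck_emb; [exact: oB|exact: Ck_id|exact: cZ].
apply: near_sub (tube_dist e0 cG) => d /= H s s01.
by have := H s s01; rewrite /G/= addr0 distrC.
Qed.

Let b_close p (e : R) : 0 < e -> B p ->
  \forall q \near p, forall s, 0 <= s <= 1 -> `|b q s - b p s| <= e.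
Proof.
move=> e0 Bp.
have n2 : \forall q \near p, `|p - q| < e by exact: (@near_dist_lt _ _ _ idfun p e (@cvg_id _ _) e0).
apply: near_sub (near_and n2 (ray_tube e0 sB Bp cZ)) => q [/ltW pq H] s s01.
apply: mx_norm_le => [|i j]; first exact: ltW.
rewrite /b !mxE; case: ifP => _; first by rewrite distrC; exact: H.
rewrite -mulrBr normrM -[leRHS]mul1r ler_pM//.
  by case/andP: s01 => s0 s1; rewrite ger0_norm ?exprn_ge0// exprn_ile1.
apply: le_trans pq; rewrite distrC.
by have := mx_coord_le_norm (p - q) 0 j; rewrite !mxE.
Qed.

(* The right-hand side of the linearized equation in the direction v. *)
Let variation (p v : 'rV[R]_3) (w : R -> R) (s : R) : R :=
  v 0 0 * P (b p s) + v 0 1 * Q (b p s)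
  + (p 0 0 * 'D_(emb (ray s v) (w s)) P (b p s)
     + p 0 1 * 'D_(emb (ray s v) (w s)) Q (b p s)).

(** A solution w of the linearized equation along the ray, starting at the label component of v,
    computes the derivative of Z at the end of the ray. The difference between the difference
    quotient and w vanishes at s = 0, and [half_gronwall] bounds it at s = 1. *)
Lemma Z_derivative p v w : B p ->
  (forall s : R, 0 <= s <= 1 -> is_derive s 1 w (variation p v w s)) ->
  w 0 = v 0 2%:R ->
  derivable Z p v /\ 'D_v Z p = w 1.
Proof.
move=> Bp dw w0.
have cw : {within `[0, 1], continuous (fun s => `|w s|)}.
  apply: continuous_in_subspaceT => s; rewrite inE/= in_itv/= => /dw[ds _].
  apply: (@continuous_comp _ _ _ w Num.norm); last exact: norm_continuous.
  by apply: differentiable_continuous; exact/derivable1_diffP.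
have [c0 _ Hw] := EVT_max ler01 cw.
pose M := `|v| + `|w c0|.
have M0 : 0 <= M by rewrite addr_ge0.
pose a s := emb (ray s v) (w s).
have aM s i : 0 <= s <= 1 -> `|a s 0 i| <= M.
  move=> s01; rewrite mxE; case: ifP => _.
    by rewrite ler_wpDl//; apply: Hw; rewrite in_itv.
  rewrite ler_wpDr// mxE normrM -[leRHS]mul1r ler_pM ?mx_coord_le_norm//.
  by case/andP: s01 => s0 s1; rewrite ger0_norm ?exprn_ge0// exprn_ile1.
suff H : h^-1 *: (Z (h *: v + p) - Z p) @[h --> 0^'] --> w 1.
  by split; [apply/cvg_ex; eexists; exact: H|exact: cvg_lim H].
apply/cvgrPdist_le => e e0.
(* [K] collects the errors committed at tolerance [eps]: one for each of P and Q multiplied by the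
   components of v, and 3M for each gradient, multiplied by a coordinate of size at most r. Since
   eps K = e / 2, the final bound 2 eps K equals e. *)
pose K := `|v 0 0| + `|v 0 1| + 2 * r * (3 * M) + 1.
have K0 : 0 < K.
  by rewrite /K ltr_wpDl// addr_ge0// ?addr_ge0// mulr_ge0// mulr_ge0// ltW.
pose eps := e / (2 * K).
have eps0 : 0 < eps by rewrite divr_gt0// mulr_gt0.
have cD (c : 'rV[R]_3 -> R) i : smooth W c -> forall x, W x -> {for x, continuous ('D_(e_ i) c)}.
  by move=> /(_ 1%N)[_ /(_ (e_ i))].
have nc (c : 'rV[R]_3 -> R) : smooth W c -> \forall d \near (0 : 'rV[R]_3),
    [/\ forall s, 0 <= s <= 1 -> `|c (b p s + d) - c (b p s)| <= eps,
        forall s, 0 <= s <= 1 -> `|'D_(e_ 0) c (b p s + d) - 'D_(e_ 0) c (b p s)| <= eps &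
        (forall s, 0 <= s <= 1 -> `|'D_(e_ 1) c (b p s + d) - 'D_(e_ 1) c (b p s)| <= eps) /\
        (forall s, 0 <= s <= 1 -> `|'D_(e_ 2%:R) c (b p s + d) - 'D_(e_ 2%:R) c (b p s)| <= eps)].
  move=> sc.
  have cc x : W x -> {for x, continuous c} by exact: (Ck_continuous (sc 0%N)).
  have n0 := along_tube eps0 Bp cc.
  have n1 := along_tube eps0 Bp (cD c 0 sc).
  have n2 := along_tube eps0 Bp (cD c 1 sc).
  have n3 := along_tube eps0 Bp (cD c 2%:R sc).
  have := near_and (near_and n0 n1) (near_and n2 n3).
  apply: near_sub => d [[a0 a1] [a2 a3]].
  by split; [exact: a0|exact: a1|split; [exact: a2|exact: a3]].
have /nbhs_ballP[d /= d0 dP] := near_and (nc P sP) (nc Q sQ).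
have d2 : 0 < d / 2 by rewrite divr_gt0.
have /nbhs_ballP[t0 /= t00 tP] := near_and (open_near oB Bp) (b_close d2 Bp).
have nv : 0 < `|v| + 1 by rewrite ltr_wpDl.
have n1 : \forall h \near (0 : R)^', `|h| < t0 / (`|v| + 1).
  by apply: dnbhs0_lt; rewrite divr_gt0.
have n2 : \forall h \near (0 : R)^', h != 0 by exact: nbhs_dnbhs_neq.
apply: filterS (filterI n1 n2) => h [hr h0].
pose q := h *: v + p.
have bq : ball p t0 q.
  rewrite -ball_normE/= distrC /q addrK normrZ.
  apply: (@le_lt_trans _ _ (`|h| * (`|v| + 1))); first by rewrite ler_wpM2l// lerDl.
  by rewrite -ltr_pdivlMr.
have [Bq close] := tP q bq.
have [zp [zpE dzp]] := ray_ode Bp; have [zq [zqE dzq]] := ray_ode Bq.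
pose D s := h^-1 * (zq s - zp s) - w s.
have diff s : 0 <= s <= 1 -> b q s - b p s = h *: (a s + D s *: e_ 2%:R).
  move=> s01; rewrite /b /a /D -zpE// -zqE//; apply/rowP => i; rewrite !mxE eqxx/=.
  by case: eqP => _ /=; field.
have inc (c : 'rV[R]_3 -> R) : smooth W c ->
    (forall x, W x -> `|'D_(e_ 2%:R) c x| <= L) ->
    (forall x, ball 0 d x ->
      [/\ forall s, 0 <= s <= 1 -> `|c (b p s + x) - c (b p s)| <= eps,
        forall s, 0 <= s <= 1 -> `|'D_(e_ 0) c (b p s + x) - 'D_(e_ 0) c (b p s)| <= eps &
        (forall s, 0 <= s <= 1 -> `|'D_(e_ 1) c (b p s + x) - 'D_(e_ 1) c (b p s)| <= eps) /\
        (forall s, 0 <= s <= 1 -> `|'D_(e_ 2%:R) c (b p s + x) - 'D_(e_ 2%:R) c (b p s)| <= eps)]) ->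
    forall s, 0 <= s <= 1 -> exists y z,
      [/\ c (b q s) - c (b p s) = h * ('D_(a s) c (b p s) + y + D s * z),
        `|c (b q s) - c (b p s)| <= eps, `|y| <= 3 * M * eps & `|z| <= L].
  move=> sc cL cd s s01.
  have Wq := Wb Bq s01; have Wp := Wb Bp s01.
  have [t [/andP[t1 t2] Wt E]] := increment sc Wq Wp.
  have cl := close s s01.
  have bd1 : ball 0 d (b q s - b p s).
    rewrite -ball_normE/= sub0r normrN (le_lt_trans cl)//.
    by rewrite ltr_pdivrMr// ltr_pMr// ltr1n.
  have bd2 : ball 0 d (t *: (b q s - b p s)).
    rewrite -ball_normE/= sub0r normrN normrZ (ger0_norm t1).
    apply: (@le_lt_trans _ _ (d / 2)); last by rewrite ltr_pdivrMr// ltr_pMr// ltr1n.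
    by rewrite -[leRHS]mul1r ler_pM.
  have [k1 _ _] := cd _ bd1; have [_ k2 [k3 k4]] := cd _ bd2.
  have {}k1 := k1 s s01; rewrite (addrC (b p s)) subrK in k1.
  have {}k2 := k2 s s01; have {}k3 := k3 s s01; have {}k4 := k4 s s01.
  rewrite (addrC (b p s)) in k2 k3 k4.
  move: E k2 k3 k4 Wt; set x := t *: _ + _ => E k2 k3 k4 Wt.
  have dx : differentiable c x by exact: (Ck_differentiable (sc 1%N)).
  have dp : differentiable c (b p s) by exact: (Ck_differentiable (sc 1%N)).
  exists ('D_(a s) c x - 'D_(a s) c (b p s)), ('D_(e_ 2%:R) c x).
  split; [|exact: k1| |exact: cL].
    rewrite E diff// (deriveE _ dx) linearZ/= linearD linearZ/=.
    rewrite -!(deriveE _ dx).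
    move: ('D_(a s) c x) ('D_(e_ 2%:R) c x) ('D_(a s) c _) => u1 u2 u3.
    by rewrite -[h *: _]/(h * _) -[D s *: _]/(D s * _); ring.
  rewrite (derive3 _ dx) (derive3 _ dp).
  move: k2 k3 k4.
  set A0 := 'D_(e_ 0) c x; set A1 := 'D_(e_ 1) c x; set A2 := 'D_(e_ 2%:R) c x.
  set B0 := 'D_(e_ 0) c _; set B1 := 'D_(e_ 1) c _; set B2 := 'D_(e_ 2%:R) c _.
  move=> k2 k3 k4.
  have -> : a s 0 0 * A0 + a s 0 1 * A1 + a s 0 2%:R * A2 -
      (a s 0 0 * B0 + a s 0 1 * B1 + a s 0 2%:R * B2) =
      a s 0 0 * (A0 - B0) + a s 0 1 * (A1 - B1) + a s 0 2%:R * (A2 - B2) by ring.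
  by apply: sum3_bound k2 k3 k4; exact: aM.
have dD (s : R) : 0 <= s <= 1 -> is_derive s 1 D
    (h^-1 * (speed q s - speed p s) - variation p v w s).
  move=> s01; have dq := dzq s s01; have dp := dzp s s01; have dws := dw s s01.
  have H1 := is_deriveB dq dp.
  by have := is_deriveB (is_deriveZ h^-1 H1) dws; exact.
have D0 : D 0 = 0.
  have z01 : 0 <= (0 : R) <= 1 by rewrite lexx ler01.
  rewrite /D zqE// zpE// !Z_ray0// w0 /q !mxE.
  by rewrite addrK mulKf// subrr.
have est s : 0 <= s <= 1 ->
    `|h^-1 * (speed q s - speed p s) - variation p v w s| <= eps * K + 2^-1 * `|D s|.
  move=> s01.
  have [y1 [z1 [E1 x1 hy1 hz1]]] := inc P sP PL (fun x bx => (dP x bx).1) s s01.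
  have [y2 [z2 [E2 x2 hy2 hz2]]] := inc Q sQ QL (fun x bx => (dP x bx).2) s s01.
  rewrite /speed /variation -/(a s).
  have -> : q 0 0 = h * v 0 0 + p 0 0 by rewrite !mxE.
  have -> : q 0 1 = h * v 0 1 + p 0 1 by rewrite !mxE.
  move: E1 E2 x1 x2.
  set A1 := 'D_(a s) P _; set A2 := 'D_(a s) Q _.
  set Pq := P (b q s); set Pp := P (b p s); set Qq := Q (b q s); set Qp := Q (b p s).
  move=> E1 E2 x1 x2.
  have -> : h^-1 * ((h * v 0 0 + p 0 0) * Pq + (h * v 0 1 + p 0 1) * Qq
      - (p 0 0 * Pp + p 0 1 * Qp))
      - (v 0 0 * Pp + v 0 1 * Qp + (p 0 0 * A1 + p 0 1 * A2)) =
      v 0 0 * (Pq - Pp) + v 0 1 * (Qq - Qp)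
      + (p 0 0 * (h^-1 * (Pq - Pp) - A1) + p 0 1 * (h^-1 * (Qq - Qp) - A2)) by field.
  have -> : h^-1 * (Pq - Pp) - A1 = y1 + D s * z1 by rewrite E1 mulKf//; ring.
  have -> : h^-1 * (Qq - Qp) - A2 = y2 + D s * z2 by rewrite E2 mulKf//; ring.
  have g1 : `|v 0 0 * (Pq - Pp)| <= `|v 0 0| * eps by rewrite normrM ler_wpM2l.
  have g2 : `|v 0 1 * (Qq - Qp)| <= `|v 0 1| * eps by rewrite normrM ler_wpM2l.
  have g3 i y z : `|y| <= 3 * M * eps -> `|z| <= L ->
      `|p 0 i * (y + D s * z)| <= r * (3 * M * eps) + r * L * `|D s|.
    move=> hy hz; rewrite -(mulrA r L) -(mulrDr r) normrM; apply: ler_pM => //; first exact: coordB.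
    apply: le_trans (ler_normD _ _) (lerD hy _).
    by rewrite normrM mulrC ler_wpM2r.
  have g4 : 2 * r * L * `|D s| <= 2^-1 * `|D s| by rewrite ler_wpM2r.
  have l1 := lerD (lerD g1 g2) (lerD (g3 0 y1 z1 hy1 hz1) (g3 1 y2 z2 hy2 hz2)).
  apply: le_trans (le_trans _ l1) _.
    apply: le_trans (ler_normD _ _) _; apply: lerD; exact: ler_normD.
  apply: (@le_trans _ _ (eps * (K - 1) + 2 * r * L * `|D s|)).
    by rewrite le_eqVlt; apply/orP; left; apply/eqP; rewrite /K; ring.
  by apply: lerD g4; rewrite (ler_pM2l eps0) gerBl.
have := half_gronwall dD D0 est.
have o01 : 0 <= (1 : R) <= 1 by rewrite lexx ler01.
rewrite /D zqE// zpE// !ray1 distrC => fin; apply: le_trans fin _.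
by rewrite le_eqVlt; apply/orP; left; apply/eqP; rewrite /eps; field; rewrite gt_eqF.
Qed.

Let dP x : W x -> differentiable P x.
Proof. exact: (Ck_differentiable (sP 1%N)). Qed.
Let dQ x : W x -> differentiable Q x.
Proof. exact: (Ck_differentiable (sQ 1%N)). Qed.

Lemma derive_over_ray (c : 'rV[R]_3 -> R) (p : 'rV[R]_3) (zeta : R -> R) (s z' : R) :
  differentiable c (emb (ray s p) (zeta s)) -> is_derive s 1 zeta z' ->
  is_derive s 1 (fun s => c (emb (ray s p) (zeta s)))
    (p 0 0 * 'D_(e_ 0) c (emb (ray s p) (zeta s))
     + p 0 1 * 'D_(e_ 1) c (emb (ray s p) (zeta s))
     + z' * 'D_(e_ 2%:R) c (emb (ray s p) (zeta s))).
Proof.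
move=> dc dz.
pose g (t : R) := emb (ray t p) (zeta t).
have dg i : is_derive s 1 (fun t => g t 0 i) (emb p z' 0 i).
  have [->|i2] := eqVneq i 2%:R.
    by rewrite mxE eqxx; under eq_fun do rewrite mxE eqxx.
  rewrite mxE (negbTE i2); under eq_fun do rewrite !mxE (negbTE i2) /rayw i2 expr1.
  have := is_deriveM (is_derive_id s (1 : R)) (is_derive_cst (p 0 i) s 1).
  move=> H; apply: (is_derive_eq H).
  by rewrite scaler0 add0r; exact: mulr1.
have dg' : differentiable g s.
  apply/derivable1_diffP; apply/derivable_mxP => i j.
  by rewrite [i]ord1; have [] := dg j.
have Dg : 'D_1 g s = emb p z'.
  rewrite derive_mx; last exact/derivable1_diffP.
  apply/matrixP => i j; rewrite [i]ord1 mxE.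
  by rewrite (@derive_val _ _ _ _ _ _ _ (dg j)).
have dcg : differentiable (c \o g) s by exact: differentiable_comp.
have H : derivable (c \o g) s 1 by exact/derivable1_diffP.
suff E : 'D_1 (c \o g) s = p 0 0 * 'D_(e_ 0) c (g s) + p 0 1 * 'D_(e_ 1) c (g s)
    + z' * 'D_(e_ 2%:R) c (g s) by exact: (DeriveDef H E).
have Dg' : 'd g s 1 = emb p z' by rewrite -(deriveE _ dg').
rewrite (deriveE _ dcg) (diff_comp dg' dc)/= Dg' -(deriveE _ dc).
rewrite (derive3 _ dc) ![emb p z' 0 _]mxE eqxx.
by [].
Qed.

(** The integrability condition says precisely that s P for i = 0, and s Q for i = 1, evaluated
    along the graph, solves the linearized equation with initial value 0. At s = 1 this is the
    claimed partial derivative. *)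
Lemma Z_partial01 (p : 'rV[R]_3) : B p ->
  (forall x, W x -> 'D_(e_ 1) P x + 'D_(e_ 2%:R) P x * Q x =
                    'D_(e_ 0) Q x + 'D_(e_ 2%:R) Q x * P x) ->
  [/\ derivable Z p (e_ 0), 'D_(e_ 0) Z p = P (emb p (Z p)),
      derivable Z p (e_ 1) & 'D_(e_ 1) Z p = Q (emb p (Z p))].
Proof.
move=> Bp integr; have [z [zE dz]] := ray_ode Bp.
have bE s : 0 <= s <= 1 -> emb (ray s p) (z s) = b p s by move=> s01; rewrite zE.
have o01 : 0 <= (1 : R) <= 1 by rewrite lexx ler01.
have main (c : 'rV[R]_3 -> R) (i : 'I_3) : i != 2%:R -> smooth W c ->
   (forall s, 0 <= s <= 1 -> forall w, variation p (e_ i) w s =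
      c (b p s) + (p 0 0 * (s * 'D_(e_ i) P (b p s) + w s * 'D_(e_ 2%:R) P (b p s))
       + p 0 1 * (s * 'D_(e_ i) Q (b p s) + w s * 'D_(e_ 2%:R) Q (b p s)))) ->
   (* The left-hand side is the derivative of c along the lifted ray. For c = P and c = Q the
      equation reduces to a multiple of the integrability condition. *)
   (forall x, W x -> p 0 0 * 'D_(e_ 0) c x + p 0 1 * 'D_(e_ 1) c x
     + (p 0 0 * P x + p 0 1 * Q x) * 'D_(e_ 2%:R) c x =
     p 0 0 * ('D_(e_ i) P x + c x * 'D_(e_ 2%:R) P x)
      + p 0 1 * ('D_(e_ i) Q x + c x * 'D_(e_ 2%:R) Q x)) ->
   derivable Z p (e_ i) /\ 'D_(e_ i) Z p = c (emb p (Z p)).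
  move=> i2 sc Hv Hc.
  pose w s := s * c (emb (ray s p) (z s)).
  have dw (s : R) : 0 <= s <= 1 -> is_derive s 1 w (variation p (e_ i) w s).
    move=> s01; have dc : differentiable c (emb (ray s p) (z s)).
      by rewrite bE//; apply: (Ck_differentiable (sc 1%N)); exact: Wb.
    have D1 := derive_over_ray dc (dz s s01).
    apply: (is_derive_eq (is_deriveM (is_derive_id s (1 : R)) D1)).
    rewrite Hv// /w bE//; have := Hc _ (Wb Bp s01); rewrite /speed.
    move: ('D_(e_ 0) c _) ('D_(e_ 1) c _) ('D_(e_ 2%:R) c _) ('D_(e_ i) P _) ('D_(e_ 2%:R) P _) ('D_(e_ i) Q _) ('D_(e_ 2%:R) Q _).
    move=> c0 c1 c2 P0 P2 Q0 Q2 E.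
    rewrite -[_ *: _ + _]/(s * _ + c (b p s) * 1) E; ring.
  have w0 : w 0 = e_ i 0 2%:R.
    by rewrite /w mul0r mxE (eq_sym 2%:R) (negbTE i2) andbF.
  have [dZ ->] := Z_derivative Bp dw w0.
  by split; [exact: dZ|rewrite /w mul1r bE// /b ray1].
have varE i s w c : 0 <= s <= 1 -> i != 2%:R -> smooth W c ->
    'D_(emb (ray s (e_ i)) w) c (b p s) =
    s * 'D_(e_ i) c (b p s) + w * 'D_(e_ 2%:R) c (b p s).
  move=> s01 i2 sc; have dc : differentiable c (b p s).
    by apply: (Ck_differentiable (sc 1%N)); exact: Wb.
  have -> : emb (ray s (e_ i)) w = s *: e_ i + w *: e_ 2%:R.
    apply/rowP => j; rewrite !mxE !eqxx/=.
    have [->|j2] := eqVneq j 2%:R.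
      by rewrite (eq_sym 2%:R) (negbTE i2) mulr0 add0r mulr1.
    by rewrite mulr0 addr0 /rayw j2 expr1.
  by rewrite (deriveE _ dc) linearD !linearZ/= -!(deriveE _ dc).
have [d0 D0] : derivable Z p (e_ 0) /\ 'D_(e_ 0) Z p = P (emb p (Z p)).
  apply: main => // [s s01 w|x Wx].
    rewrite /variation !varE//; rewrite !mxE/= mul1r mul0r addr0.
    by [].
  have := integr x Wx.
  move: ('D_(e_ 0) P x) ('D_(e_ 1) P x) ('D_(e_ 2%:R) P x) ('D_(e_ 0) Q x) ('D_(e_ 2%:R) Q x).
  by move=> P0 P1 P2 Q0 Q2 E; rewrite -(addrK (P2 * Q x) P1) E; ring.
have [d1 D1] : derivable Z p (e_ 1) /\ 'D_(e_ 1) Z p = Q (emb p (Z p)).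
  apply: main => // [s s01 w|x Wx].
    rewrite /variation !varE//; rewrite !mxE/= mul1r mul0r add0r.
    by [].
  have := integr x Wx.
  move: ('D_(e_ 1) P x) ('D_(e_ 2%:R) P x) ('D_(e_ 0) Q x) ('D_(e_ 1) Q x) ('D_(e_ 2%:R) Q x).
  by move=> P1 P2 Q0 Q1 Q2 E; rewrite -(addrK (P2 * Q x) P1) E; ring.
by [].
Qed.

Let growth (p : 'rV[R]_3) : R :=
  p 0 0 * rayint 0 (along Z ('D_(e_ 2%:R) P)) p
  + p 0 1 * rayint 0 (along Z ('D_(e_ 2%:R) Q)) p.

(** In the label direction the linearized equation is scalar and homogeneous with initial value 1,
    hence solved by an exponential. Its positivity makes (x, y, q) -> (x, y, Z) a local
    diffeomorphism. *)
Lemma Z_partial2 (p : 'rV[R]_3) : B p ->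
  derivable Z p (e_ 2%:R) /\ 'D_(e_ 2%:R) Z p = expR (growth p).
Proof.
move=> Bp.
have cPz x : W x -> {for x, continuous ('D_(e_ 2%:R) P)}.
  by have [_ /(_ (e_ 2%:R))] := sP 1%N; apply.
have cQz x : W x -> {for x, continuous ('D_(e_ 2%:R) Q)}.
  by have [_ /(_ (e_ 2%:R))] := sQ 1%N; apply.
have k1 := comp_cont01 Bp cPz; have k2 := comp_cont01 Bp cQz.
pose g s := p 0 0 * 'D_(e_ 2%:R) P (b p s) + p 0 1 * 'D_(e_ 2%:R) Q (b p s).
have cx c (k : R) : cont01 c -> cont01 (fun t => k * c t).
  by move=> ck t t01; apply: continuousM; [exact: cst_continuous|exact: ck].
have cg : cont01 g.
  by move=> s s01; apply: continuousD; [exact: cx k1 _ s01|exact: cx k2 _ s01].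
have [K dK] := primitive01 cg.
pose w s := expR (K s - K 0).
have gE : K 1 - K 0 = growth p.
  rewrite -(int01_FTC cg dK) /g int01D; [|exact: cx|exact: cx].
  rewrite !int01Z// /growth.
  by congr (_ * _ + _ * _); apply: eq_int01 => s _; rewrite expr0 mul1r.
have dw (s : R) : 0 <= s <= 1 -> is_derive s 1 w (variation p (e_ 2%:R) w s).
  move=> s01; have dKs := dK s s01.
  have dK0 : is_derive s 1 (fun s => K s - K 0) (g s).
    by apply: (is_derive_eq (is_deriveB dKs (is_derive_cst (K 0) s 1))); rewrite subr0.
  have df : differentiable (fun s => K s - K 0) s by apply/derivable1_diffP; case: dK0.
  have [dex dexE] := @derive_expR_comp R R _ s 1 df.
  apply: DeriveDef; first by apply/derivable1_diffP.
  rewrite -[LHS]/('D_1 (expR \o (fun s => K s - K 0)) s) dexE.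
  rewrite (@derive_val _ _ _ _ _ _ _ dK0) -/(w s) /g.
  have E : emb (ray s (e_ 2%:R)) (w s) = w s *: e_ 2%:R.
    apply/rowP => j; rewrite !mxE !eqxx/=.
    by have [_|_] := eqVneq j 2%:R; rewrite ?mulr1 ?mulr0.
  have Wp := Wb Bp s01.
  rewrite /variation E (derive_dirZ _ _ (dP Wp)) (derive_dirZ _ _ (dQ Wp)).
  rewrite !mxE/= !mul0r !add0r.
  by rewrite mulrDr !(mulrCA (w s)).
have w0 : w 0 = e_ 2%:R 0 2%:R by rewrite /w subrr expR0 mxE.
have [dZ ->] := Z_derivative Bp dw w0.
by split; [exact: dZ|rewrite /w gE].
Qed.

(** All three partial derivatives are expressed through Z itself, by P and Q on the graph and by the
    exponential of ray integrals, so regularity of Z at order k gives order k + 1. *)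
Lemma Z_smooth :
  (forall x, W x -> 'D_(e_ 1) P x + 'D_(e_ 2%:R) P x * Q x =
                    'D_(e_ 0) Q x + 'D_(e_ 2%:R) Q x * P x) ->
  smooth B Z.
Proof.
move=> integr; elim=> [|k IH]; first exact: cZ.
have Ce : Ck k B (fun p => emb p (Z p)).
  by apply: Ck_emb; [exact: oB|exact: Ck_id|exact: IH].
have Ca c : Ck k W c -> Ck k B (along Z c).
  move=> Cc; apply: (@Ck_comp _ _ _ k B W c) => //; first exact: coordinatized_rV.
  by move=> p Bp; exact: admissible_emb.
apply: Ck_partials => // [p i Bp|].
  have [d0 _ d1 _] := Z_partial01 Bp integr; have [d2 _] := Z_partial2 Bp.
  by move: i; apply: forall3; [exact: d0|exact: d1|exact: d2].
apply: forall3.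
- apply: (@Ck_ext _ _ _ _ _ (along Z P)) => // [p Bp|]; last exact: Ca.
  by have [_ -> _ _] := Z_partial01 Bp integr.
- apply: (@Ck_ext _ _ _ _ _ (along Z Q)) => // [p Bp|]; last exact: Ca.
  by have [_ _ _ ->] := Z_partial01 Bp integr.
- apply: (@Ck_ext _ _ _ _ _ (fun p => expR (growth p))) => // [p Bp|].
    by have [_ ->] := Z_partial2 Bp.
  apply: Ck_expR => //; apply: CkD => //.
    apply: CkM; [exact: oB|exact: Ck_coord|].
    by apply: Ck_rayint => //; apply: Ca; have [_] := sP k.+1; apply.
  apply: CkM; [exact: oB|exact: Ck_coord|].
  by apply: Ck_rayint => //; apply: Ca; have [_] := sQ k.+1; apply.
Qed.

End Solution.

End Frobenius.

(** * Leaves of an integrable plane field and primitives along them *)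

Section Leaves.
Context {R : realType}.

(** Frobenius' theorem for dz = P dx + Q dy: the hypothesis says that the fields e_0 + P e_2 and e_1
    + Q e_2 commute. *)
Theorem integrable_leaves (O : set 'rV[R]_3) (P Q : 'rV[R]_3 -> R) :
  open O -> O 0 -> smooth O P -> smooth O Q ->
  (forall x, O x -> 'D_(e_ 1) P x + 'D_(e_ 2%:R) P x * Q x =
                    'D_(e_ 0) Q x + 'D_(e_ 2%:R) Q x * P x) ->
  exists r Z, [/\ 0 < r, smooth (ball (0 : 'rV[R]_3) r) Z, Z 0 = 0 &
    forall p, ball 0 r p -> [/\ O (emb p (Z p)), 'D_(e_ 0) Z p = P (emb p (Z p)),
      'D_(e_ 1) Z p = Q (emb p (Z p)) & 0 < 'D_(e_ 2%:R) Z p]].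
Proof.
move=> oO O0 sP sQ integr.
have near_bound (c : 'rV[R]_3 -> R) : {for 0, continuous c} ->
    \forall x \near (0 : 'rV[R]_3), `|c x| <= `|c 0| + 1.
  move=> cc; apply: near_sub (near_dist_lt cc ltr01) => x /ltW h.
  rewrite -[c x](subrK (c 0)) addrC; apply: le_trans (ler_normD _ _) _.
  by rewrite lerD// distrC.
have c0 (c : 'rV[R]_3 -> R) : smooth O c -> {for 0, continuous c}.
  by move=> sc; exact: (Ck_continuous (sc 0%N)).
have c1 (c : 'rV[R]_3 -> R) : smooth O c -> {for 0, continuous ('D_(e_ 2%:R) c)}.
  by move=> /(_ 1%N)[_ /(_ (e_ 2%:R))]; apply.
have b1 := near_bound _ (c0 _ sP); have b2 := near_bound _ (c0 _ sQ).
have b3 := near_bound _ (c1 _ sP); have b4 := near_bound _ (c1 _ sQ).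
have /nbhs_ballP[rho /= rho0 HW] :=
  near_and (open_near oO O0) (near_and (near_and b1 b2) (near_and b3 b4)).
pose C := `|P 0| + `|Q 0| + 1.
pose L := `|'D_(e_ 2%:R) P 0| + `|'D_(e_ 2%:R) Q 0| + 1.
have C0 : 0 <= C by rewrite !addr_ge0.
have L0 : 0 <= L by rewrite !addr_ge0.
(* With r = rho / d one has 2r + 2rC + 4rL rho = rho, from which the three inequalities r <= rho, r
   + 2rC < rho and 2rL <= 1/2 follow at once. *)
pose d := 2 + 2 * C + 4 * L * rho.
have L4 : 0 <= 4 * L * rho by rewrite !mulr_ge0// ltW.
have d0 : 0 < d by rewrite /d; lra.
pose r := rho / d.
have r0 : 0 < r by rewrite divr_gt0.
have rE : r * d = rho by rewrite /r divfK// gt_eqF.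
have rC0 : 0 <= r * C by rewrite mulr_ge0// ltW.
have rL0 : 0 <= r * (L * rho) by rewrite mulr_ge0 ?(ltW r0)// mulr_ge0// ltW.
have rE' : 2 * r + 2 * (r * C) + 4 * (r * (L * rho)) = rho.
  by rewrite -[RHS]rE /d; ring.
have r_rho : r <= rho by lra.
have rC : r + 2 * r * C < rho by rewrite -mulrA; lra.
have rL : 2 * r * L <= 2^-1.
  rewrite -(ler_pM2r rho0); have -> : 2 * r * L * rho = 2 * (r * (L * rho)) by ring.
  by lra.
have WO : ball 0 rho `<=` O by move=> x /HW[].
have sP' := smooth_subset WO sP; have sQ' := smooth_subset WO sQ.
have PC a : ball 0 rho a -> `|P a| <= C.
  by move=> /HW[_ [[h _] _]]; apply: le_trans h _; rewrite /C lerD2r lerDl.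
have QC a : ball 0 rho a -> `|Q a| <= C.
  by move=> /HW[_ [[_ h] _]]; apply: le_trans h _; rewrite /C lerD2r lerDr.
have PL a : ball 0 rho a -> `|'D_(e_ 2%:R) P a| <= L.
  by move=> /HW[_ [_ [h _]]]; apply: le_trans h _; rewrite /L lerD2r lerDl.
have QL a : ball 0 rho a -> `|'D_(e_ 2%:R) Q a| <= L.
  by move=> /HW[_ [_ [_ h]]]; apply: le_trans h _; rewrite /L lerD2r lerDr.
have [Z aZ fZ] := picard_fixpoint r0 r_rho C0 L0 rC rL sP' sQ' PC QC PL QL.
have integr' x : ball 0 rho x -> 'D_(e_ 1) P x + 'D_(e_ 2%:R) P x * Q x =
                    'D_(e_ 0) Q x + 'D_(e_ 2%:R) Q x * P x.
  by move=> /WO; exact: integr.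
have B0 : ball 0 r (0 : 'rV[R]_3) by exact: ballxx.
exists r, Z; split.
- exact: r0.
- exact: (Z_smooth r0 r_rho rC rL sP' sQ' PL QL aZ fZ integr').
- have := Z_ray0 fZ B0.
  by rewrite (_ : ray 0 0 = 0) ?mxE//; apply/rowP => i; rewrite !mxE mulr0.
- move=> p Bp; split.
  + by apply: WO; exact: (admissible_emb r_rho rC aZ Bp).
  + by have [] := Z_partial01 r0 r_rho rC rL sP' sQ' PL QL aZ fZ Bp integr'.
  + by have [] := Z_partial01 r0 r_rho rC rL sP' sQ' PL QL aZ fZ Bp integr'.
  + have [_ ->] := Z_partial2 r0 r_rho rC rL sP' sQ' PL QL aZ fZ Bp.
    exact: expR_gt0.
Qed.

(** The Poincare lemma in (x, y) with the label as a parameter: h is the integral of the form b0 dx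
    + b1 dy along the ray. *)
Lemma fiberwise_primitive (r : R) (b0 b1 : 'rV[R]_3 -> R) :
  let B := ball (0 : 'rV[R]_3) r in
  smooth B b0 -> smooth B b1 ->
  (forall x, B x -> 'D_(e_ 1) b0 x = 'D_(e_ 0) b1 x) ->
  exists2 h, smooth B h & forall p, B p ->
    'D_(e_ 0) h p = b0 p /\ 'D_(e_ 1) h p = b1 p.
Proof.
move=> B s0 s1 closed_b.
have oB : open B by exact: ball_open.
have sB : raystable B by exact: raystable_ball.
pose h (p : 'rV[R]_3) := p 0 0 * rayint 0 b0 p + p 0 1 * rayint 0 b1 p.
have sh : smooth B h.
  move=> k; apply: CkD; first exact: oB.
    by apply: CkM; [exact: oB|exact: Ck_coord|exact: Ck_rayint].
  by apply: CkM; [exact: oB|exact: Ck_coord|exact: Ck_rayint].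
exists h => // p Bp.
have dcoord i j : is_derive p (e_ i) (fun x : 'rV[R]_3 => x 0 j) (j == i)%:R.
  have dx : derivable (fun x : 'rV[R]_3 => x) p (e_ i) by exact: derivable_id.
  have H := (derivable_mxP _ _ _).1 dx 0 j.
  apply: DeriveDef => //; have := derive_mx dx; rewrite derive_id.
  by move=> /matrixP/(_ 0 j); rewrite !mxE.
have d0 i : is_derive p (e_ i) (rayint 0 b0) (rayint (rayw i) ('D_(e_ i) b0) p).
  have [D E] := rayint_derivative 0 i oB sB Bp (s0 1%N); exact: DeriveDef D E.
have d1 i : is_derive p (e_ i) (rayint 0 b1) (rayint (rayw i) ('D_(e_ i) b1) p).
  have [D E] := rayint_derivative 0 i oB sB Bp (s1 1%N); exact: DeriveDef D E.
have dh i : 'D_(e_ i) h p =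
    p 0 0 * rayint (rayw i) ('D_(e_ i) b0) p + (0 == i)%:R * rayint 0 b0 p
    + (p 0 1 * rayint (rayw i) ('D_(e_ i) b1) p + (1 == i)%:R * rayint 0 b1 p).
  have H := is_deriveD (is_deriveM (dcoord i 0) (d0 i)) (is_deriveM (dcoord i 1) (d1 i)).
  rewrite -[LHS]/('D_(e_ i) ((fun x : 'rV[R]_3 => x 0 0) * rayint 0 b0
    + (fun x : 'rV[R]_3 => x 0 1) * rayint 0 b1) p).
  rewrite (@derive_val _ _ _ _ _ _ _ H).
  by rewrite -![_ *: _]/(_ * _) ![rayint 0 _ p * _]mulrC.
have cc (c : 'rV[R]_3 -> R) (j : 'I_3) : smooth B c ->
    cont01 (fun s => s ^+ 1 * 'D_(e_ j) c (ray s p)).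
  move=> /(_ 1%N)[_ /(_ (e_ j)) cDj].
  exact: (@rayint_cont01 _ 1 _ B p sB Bp cDj).
have c0 (c : 'rV[R]_3 -> R) : smooth B c -> cont01 (fun s => s ^+ 0 * c (ray s p)).
  by move=> sc; exact: (@rayint_cont01 _ 0 _ B p sB Bp (sc 0%N)).
have cx c (k : R) : cont01 c -> cont01 (fun t => k * c t).
  by move=> ck t t01; apply: continuousM; [exact: cst_continuous|exact: ck].
have cD (c c' : R -> R) : cont01 c -> cont01 c' -> cont01 (fun t => c t + c' t).
  by move=> k1 k2 t t01; apply: continuousD; [exact: k1|exact: k2].
(* This is the derivative of s c(ray s p) integrated from 0 to 1. Closedness then turns the cross
   term in the derivative of h into the one needed here. *)
have main (c : 'rV[R]_3 -> R) : smooth B c ->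
    p 0 0 * rayint 1 ('D_(e_ 0) c) p + p 0 1 * rayint 1 ('D_(e_ 1) c) p
      + rayint 0 c p = c p.
  move=> sc.
  pose g s := p 0 0 * (s ^+ 1 * 'D_(e_ 0) c (ray s p))
    + p 0 1 * (s ^+ 1 * 'D_(e_ 1) c (ray s p)) + s ^+ 0 * c (ray s p).
  have cg : cont01 g.
    by apply: (cD _ _ _ (c0 _ sc)); apply: cD; apply: cx; exact: cc.
  have dg (s : R) : 0 <= s <= 1 -> is_derive s 1 (fun s => s * c (ray s p)) (g s).
    move=> s01.
    have E t : emb (ray t p) (p 0 2%:R) = ray t p.
      apply/rowP => i; rewrite !mxE; case: eqP => // ->.
      by rewrite /rayw eqxx expr0 mul1r.
    have dc : differentiable c (emb (ray s p) (p 0 2%:R)).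
      by rewrite E; apply: (Ck_differentiable (sc 1%N)); exact: sB.
    have H := derive_over_ray dc (is_derive_cst (p 0 2%:R) s 1).
    have {}H : is_derive s 1 (fun s => c (ray s p)) (p 0 0 * 'D_(e_ 0) c (ray s p)
        + p 0 1 * 'D_(e_ 1) c (ray s p) + 0 * 'D_(e_ 2%:R) c (ray s p)).
      by move: H; rewrite E; under eq_fun do rewrite E.
    apply: (is_derive_eq (is_deriveM (is_derive_id s (1 : R)) H)).
    rewrite /g expr1 expr0 -[_ *: _ + _]/(s * _ + c (ray s p) * 1).
    by move: ('D_(e_ 0) c _) ('D_(e_ 1) c _) ('D_(e_ 2%:R) c _) => u0 u1 u2; ring.
  have := int01_FTC cg dg; rewrite ray1 mul1r mul0r subr0 => <-.
  rewrite /g int01D; [|by apply: (cD); apply: cx; exact: cc|exact: c0].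
  rewrite int01D; [|by apply: cx; exact: cc|by apply: cx; exact: cc].
  by rewrite (int01Z _ (cc c 0 sc)) (int01Z _ (cc c 1 sc)).
have ext m c c' : (forall q, B q -> c q = c' q) -> rayint m c p = rayint m c' p.
  by move=> cc'; apply: eq_int01 => s s01; rewrite cc'//; exact: sB.
have E1 := ext 1%N _ _ closed_b.
have M0 := main _ s0; have M1 := main _ s1.
have -> : 'D_(e_ 0) h p = p 0 0 * rayint 1 ('D_(e_ 0) b0) p + 1 * rayint 0 b0 p
    + (p 0 1 * rayint 1 ('D_(e_ 0) b1) p + 0 * rayint 0 b1 p) by exact: dh.
have -> : 'D_(e_ 1) h p = p 0 0 * rayint 1 ('D_(e_ 1) b0) p + 0 * rayint 0 b0 p
    + (p 0 1 * rayint 1 ('D_(e_ 1) b1) p + 1 * rayint 0 b1 p) by exact: dh.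
rewrite -M0 -M1 E1.
move: (rayint 1 ('D_(e_ 0) b0) p) (rayint 1 ('D_(e_ 0) b1) p)
  (rayint 1 ('D_(e_ 1) b1) p) (rayint 0 b0 p) (rayint 0 b1 p) => u0 u1 u2 u3 u4.
by split; ring.
Qed.

End Leaves.

(** * Pointwise algebra of the BPS equations *)

Section Cross.
Context {R : realType}.
Implicit Types (u v w m n : 'rV[R]_3) (A B E F T S g : 'M[R]_3).

Definition cross v w : 'rV[R]_3 :=
  \row_i (if i == 0 then v 0 1 * w 0 2%:R - v 0 2%:R * w 0 1
          else if i == 1 then v 0 2%:R * w 0 0 - v 0 0 * w 0 2%:R
          else v 0 0 * w 0 1 - v 0 1 * w 0 0).

Lemma cross0 v w : cross v w 0 0 = v 0 1 * w 0 2%:R - v 0 2%:R * w 0 1.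
Proof. by rewrite mxE. Qed.
Lemma cross1 v w : cross v w 0 1 = v 0 2%:R * w 0 0 - v 0 0 * w 0 2%:R.
Proof. by rewrite mxE. Qed.
Lemma cross2 v w : cross v w 0 2%:R = v 0 0 * w 0 1 - v 0 1 * w 0 0.
Proof. by rewrite mxE. Qed.
Definition crossE := (cross0, cross1, cross2).

(** The cofactor matrix, written by rows as cross products. It is the map that E induces on cross
    products, hence on 2-forms encoded by vectors. *)
Definition cof E : 'M[R]_3 :=
  \matrix_(i, j) (if i == 0 then cross (row 1 E) (row 2%:R E)
                  else if i == 1 then cross (row 2%:R E) (row 0 E)
                  else cross (row 0 E) (row 1 E)) 0 j.

Lemma cof0 E j : cof E 0 j = cross (row 1 E) (row 2%:R E) 0 j.
Proof. by rewrite mxE. Qed.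
Lemma cof1 E j : cof E 1 j = cross (row 2%:R E) (row 0 E) 0 j.
Proof. by rewrite mxE. Qed.
Lemma cof2 E j : cof E 2%:R j = cross (row 0 E) (row 1 E) 0 j.
Proof. by rewrite mxE. Qed.

Lemma rowE3 E (i j : 'I_3) : row i E 0 j = E i j. Proof. by rewrite mxE. Qed.
Definition cofE := (cof0, cof1, cof2, cross0, cross1, cross2, rowE3).

Lemma pairing3 u v : pairing u v = u 0 0 * v 0 0 + u 0 1 * v 0 1 + u 0 2%:R * v 0 2%:R.
Proof. by rewrite /pairing mxE sum3 !mxE. Qed.

Lemma mulmx3 (v : 'rV[R]_3) A (j : 'I_3) :
  (v *m A) 0 j = v 0 0 * A 0 j + v 0 1 * A 1 j + v 0 2%:R * A 2%:R j.
Proof. by rewrite mxE sum3. Qed.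

Lemma rowP3 u v : u 0 0 = v 0 0 -> u 0 1 = v 0 1 -> u 0 2%:R = v 0 2%:R -> u = v.
Proof. by move=> h0 h1 h2; apply/rowP; apply: forall3. Qed.

Lemma matrixP3 A B : (forall i j : 'I_3, A i j = B i j) -> A = B.
Proof. by move=> h; apply/matrixP. Qed.

Lemma det3 A : \det A = pairing (row 0 A) (cross (row 1 A) (row 2%:R A)).
Proof.
rewrite (expand_det_row _ 0) sum3 pairing3 !crossE !rowE3 /cofactor.
rewrite !(expand_det_row _ ord0) !big_ord_recl !big_ord0 /cofactor !det_mx11 !mxE.
(* Indexing the entries by natural numbers identifies the different expressions for one ordinal that
   the expansions produce. *)
pose f (i j : nat) := A (inord i) (inord j).
have Af i j : A i j = f i j by rewrite /f !inord_val.
by rewrite !Af /= /bump/=; ring.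
Qed.

Lemma cross_mul v w E : cross (v *m E) (w *m E) = cross v w *m cof E.
Proof.
apply: rowP3; rewrite !(mulmx3, crossE, cofE); ring.
Qed.

Lemma det_rows u v w : \det (\matrix_(k < 3) [:: u; v; w]`_k) = pairing u (cross v w).
Proof.
rewrite det3; congr (pairing _ (cross _ _)); apply/rowP => j; by rewrite !mxE.
Qed.

Lemma mul_cof_tr E : E *m (cof E)^T = (\det E)%:M.
Proof.
apply: matrixP3 => i j; rewrite mxE sum3 ![(cof E)^T _ _]mxE [RHS]mxE det3 pairing3.
by move: i j; apply: forall3; apply: forall3; rewrite !cofE/=; ring.
Qed.

Lemma tr_cof_mul E : (cof E)^T *m E = (\det E)%:M.
Proof.
apply: matrixP3 => i j; rewrite mxE sum3 ![(cof E)^T _ _]mxE [RHS]mxE det3 pairing3.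
by move: i j; apply: forall3; apply: forall3; rewrite !cofE/=; ring.
Qed.

Lemma cofM A B : cof (A *m B) = cof A *m cof B.
Proof.
apply: matrixP3 => i j; rewrite [RHS]mxE sum3.
have E k : row k (A *m B) = row k A *m B by rewrite row_mul.
by move: i; apply: forall3; rewrite !(cof0, cof1, cof2) !E cross_mul mulmx3 !(cof0, cof1, cof2).
Qed.

Lemma cof_id : cof 1%:M = 1%:M :> 'M[R]_3.
Proof.
by have := mul_cof_tr 1%:M; rewrite mul1mx det1 => /(congr1 trmx); rewrite trmxK trmx1.
Qed.

Lemma cof_unit E : E \in unitmx -> cof E = \det E *: (invmx E)^T.
Proof.
move=> uE; have := mul_cof_tr E => /(congr1 (mulmx (invmx E))).
by rewrite mulKmx// mul_mx_scalar => /(congr1 trmx); rewrite trmxK linearZ.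
Qed.

Lemma det_rank1 u v : \det (1%:M + u^T *m v) = 1 + pairing u v :> R.
Proof.
rewrite det3 !pairing3 !crossE !rowE3.
have E (i j : 'I_3) : (1%:M + u^T *m v) i j = (i == j)%:R + u 0 i * v 0 j.
  by rewrite !mxE big_ord1 !mxE.
by rewrite !E/=; ring.
Qed.

Lemma cross_basis (c : 'rV[R]_3) : exists (l : 'I_3 -> R) (v w : 'I_3 -> 'rV[R]_3),
  c = \sum_i l i *: cross (v i) (w i).
Proof.
exists (fun i => c 0 i), (fun i => if i == 0 then e_ 1 else if i == 1 then e_ 2%:R else e_ 0),
  (fun i => if i == 0 then e_ 2%:R else if i == 1 then e_ 0 else e_ 1).
by rewrite sum3/=; apply: rowP3; rewrite !mxE/=; ring.
Qed.

Lemma eq_on_cross A B : (forall v w, cross v w *m A = cross v w *m B) -> A = B.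
Proof.
move=> H; apply/row_matrixP => i; rewrite !rowE.
have [l [v [w ->]]] := cross_basis (delta_mx 0 i).
by rewrite !mulmx_suml; apply: eq_bigr => k _; rewrite -!scalemxAl H.
Qed.

Definition axial F : 'rV[R]_3 :=
  \row_i (if i == 0 then F 1 2%:R else if i == 1 then F 2%:R 0 else F 0 1).

Lemma antisym_entries F : F^T = - F -> forall i j, F j i = - F i j.
Proof. by move=> /matrixP aF i j; have := aF i j; rewrite !mxE. Qed.

Lemma antisym_diag F : F^T = - F -> forall i, F i i = 0.
Proof.
move=> /antisym_entries aF i; have := aF i i => /eqP.
by rewrite -addr_eq0 -mulr2n mulrn_eq0 => /eqP.
Qed.

Lemma bil3 F v w : bil F v w = \sum_i \sum_j v 0 i * F i j * w 0 j.
Proof.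
rewrite /bil mxE exchange_big/=; apply: eq_bigr => j _.
by rewrite mxE mulr_suml; apply: eq_bigr => i _; rewrite mxE.
Qed.

Lemma bil_axial F v w : F^T = - F -> bil F v w = pairing (cross v w) (axial F).
Proof.
move=> aF; rewrite bil3 !sum3 pairing3 !crossE ![axial F _ _]mxE/= !(antisym_diag aF).
rewrite (antisym_entries aF 0 1) (antisym_entries aF 1 2%:R) (antisym_entries aF 2%:R 0).
by ring.
Qed.

Lemma axial_inj F : F^T = - F -> axial F = 0 -> F = 0.
Proof.
move=> aF /rowP f0.
have := f0 0; have := f0 1; have := f0 2%:R; rewrite !mxE/= => h2 h1 h0.
apply: matrixP3; apply: forall3; apply: forall3; rewrite mxE ?(antisym_diag aF)//.
- by rewrite (antisym_entries aF 2%:R 0) h1 oppr0.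
- by rewrite (antisym_entries aF 0 1) h2 oppr0.
- by rewrite (antisym_entries aF 1 2%:R) h0 oppr0.
Qed.

Lemma bil_congr F T v w : bil (T *m F *m T^T) v w = bil F (v *m T) (w *m T).
Proof. by rewrite /bil trmx_mul !mulmxA. Qed.

Lemma antisym_congr F T : F^T = - F -> (T *m F *m T^T)^T = - (T *m F *m T^T).
Proof. by move=> aF; rewrite !trmx_mul trmxK aF mulNmx mulmxN mulmxA. Qed.

Lemma pairing_mul u v A : pairing (u *m A) v = pairing u (v *m A^T).
Proof. by rewrite /pairing trmx_mul trmxK mulmxA. Qed.

Lemma pairingC u v : pairing u v = pairing v u.
Proof. by rewrite !pairing3; ring. Qed.

Lemma pairing_ext u v : (forall c, pairing c u = pairing c v) -> u = v.
Proof.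
move=> H; have h i : u 0 i = v 0 i.
  have := H (e_ i); rewrite !pairing3 /e_ !mxE.
  by move: i; apply: forall3 => /=; lra.
by apply/rowP.
Qed.

Lemma eq_on_cross_row u v : (forall a b, pairing (cross a b) u = pairing (cross a b) v) -> u = v.
Proof.
move=> H; suff: u^T = v^T by move/(congr1 trmx); rewrite !trmxK.
have E (c z : 'rV[R]_3) : c *m z^T = (pairing c z)%:M.
  by apply/matrixP => i j; rewrite !ord1 !mxE eqxx mulr1n /pairing mxE.
apply/row_matrixP => i; rewrite !rowE.
have [l [a [b ->]]] := cross_basis (delta_mx 0 i).
by rewrite !mulmx_suml; apply: eq_bigr => k _; rewrite -!scalemxAl !E H.
Qed.

Lemma axial_congr F T : F^T = - F -> axial (T *m F *m T^T) = axial F *m (cof T)^T.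
Proof.
move=> aF; apply: eq_on_cross_row => a b.
rewrite -bil_axial; last exact: antisym_congr.
by rewrite bil_congr bil_axial// cross_mul pairing_mul.
Qed.

End Cross.

(** * The BPS equations at a point as matrix identities *)

Section PointwiseBPS.
Context {R : realType}.
Implicit Types (u v w m n f a : 'rV[R]_3) (A B E F T S g gM gN : 'M[R]_3).

Definition posdef g : Prop := g^T = g /\ forall v, v != 0 -> 0 < bil g v v.

Definition rdet g : R := Num.sqrt (\det g).

Lemma row_eq0 v : (v == 0) = [&& v 0 0 == 0, v 0 1 == 0 & v 0 2%:R == 0].
Proof.
apply/eqP/and3P => [->|[/eqP h0 /eqP h1 /eqP h2]]; first by rewrite !mxE.
by apply: rowP3; rewrite !mxE.
Qed.

(** Sylvester's criterion from three test vectors: e_0, then a combination of e_0 and e_1, then the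
    cross product c of the first two rows, for which g(c, c) is the second leading minor times det
    g. *)
Lemma posdef_det g : posdef g -> 0 < \det g.
Proof.
move=> [/matrixP sg pg].
have g10 : g 1 0 = g 0 1 by have := sg 0 1; rewrite mxE.
have g20 : g 2%:R 0 = g 0 2%:R by have := sg 0 2%:R; rewrite mxE.
have g21 : g 2%:R 1 = g 1 2%:R by have := sg 1 2%:R; rewrite mxE.
have g00 : 0 < g 0 0.
  have e0 : e_ 0 != 0 :> 'rV[R]_3 by rewrite row_eq0 /e_ !mxE/= oner_eq0.
  have := pg _ e0; rewrite bil3 !sum3 /e_ !mxE/=.
  by rewrite !(mul0r, mulr0, mul1r, mulr1, addr0).
pose u : 'rV[R]_3 := \row_i (if i == 0 then - g 0 1 else if i == 1 then g 0 0 else 0).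
have u0 : u != 0 by rewrite row_eq0 !mxE/= (gt_eqF g00) !andbF.
have minor : 0 < g 0 0 * g 1 1 - g 0 1 * g 0 1.
  have := pg u u0; have -> : bil g u u = g 0 0 * (g 0 0 * g 1 1 - g 0 1 * g 0 1).
    by rewrite bil3 !sum3 !mxE/= g10 g20 g21; ring.
  by rewrite pmulr_rgt0.
pose c := cross (row 0 g) (row 1 g).
have c2 : c 0 2%:R = g 0 0 * g 1 1 - g 0 1 * g 0 1 by rewrite crossE !rowE3 g10.
have c0 : c != 0 by rewrite row_eq0 c2 (gt_eqF minor) !andbF.
have := pg c c0.
have -> : bil g c c = c 0 2%:R * \det g.
  by rewrite bil3 !sum3 det3 !pairing3 !crossE !rowE3 g10 g20 g21; ring.
by rewrite c2 pmulr_rgt0.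
Qed.

Lemma posdef_unit g : posdef g -> g \in unitmx.
Proof. by move=> pg; rewrite unitmxE unitfE gt_eqF// posdef_det. Qed.

Lemma posdef_sym g : posdef g -> g^T = g. Proof. by case. Qed.

Lemma invmx_sym g : g^T = g -> (invmx g)^T = invmx g.
Proof. by move=> sg; rewrite trmx_inv sg. Qed.

Lemma posdef_congr g T : T \in unitmx -> posdef g -> posdef (T *m g *m T^T).
Proof.
move=> uT [sg pg]; split; first by rewrite !trmx_mul trmxK sg mulmxA.
move=> v v0; rewrite bil_congr; apply: pg; apply: contraNneq v0 => h.
by rewrite -(mulmxK uT v) h mul0mx.
Qed.

Lemma posdef_inv g : posdef g -> posdef (invmx g).
Proof.
move=> pg; have := posdef_congr _ pg (T := invmx g).
rewrite unitmx_inv (posdef_unit pg) => /(_ isT).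
by rewrite (invmx_sym (posdef_sym pg)) mulVmx ?posdef_unit// mul1mx.
Qed.

Lemma rdet_gt0 g : posdef g -> 0 < rdet g.
Proof. by move=> pg; rewrite sqrtr_gt0 posdef_det. Qed.

Lemma rdet_sqr g : posdef g -> rdet g * rdet g = \det g.
Proof. by move=> pg; rewrite -expr2 sqr_sqrtr// ltW// posdef_det. Qed.

Lemma rdet_congr g T : 0 < \det T -> rdet (T *m g *m T^T) = \det T * rdet g.
Proof.
move=> dT; rewrite /rdet !det_mulmx det_tr mulrAC -expr2 sqrtrM ?sqr_ge0//.
by rewrite sqrtr_sqr gtr0_norm.
Qed.

Lemma volE g u v w : vol g u v w = rdet g * pairing u (cross v w).
Proof. by rewrite /vol det_rows. Qed.

Lemma scale_entry (c : R) (X : 'M[R]_1) : (c *: X) 0 0 = c * X 0 0.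
Proof. by rewrite mxE. Qed.

Lemma SigmaE g v w : Sigma g v w = rdet g *: (cross v w *m invmx g).
Proof.
rewrite /Sigma /sharp scalemxAl; congr (_ *m _); apply/rowP => k.
rewrite !mxE volE; congr (_ * _).
by rewrite /pairing /e_ -rowE !mxE.
Qed.

Lemma hodge1_vecE g E v w : g^T = g ->
  hodge1_vec g E v w = rdet g *: (cross v w *m invmx g *m E).
Proof.
move=> sg; apply/rowP => k; rewrite !mxE /hodge1 volE /sharp; congr (_ * _).
rewrite pairing_mul (invmx_sym sg) /pairing.
by rewrite mxE; apply: eq_bigr => j _; rewrite !mxE mulrC.
Qed.

Lemma scalar_row v w f (X : 'rV[R]_3) : (pairing (cross v w) f) *: X = cross v w *m (f^T *m X).
Proof.
rewrite mulmxA; apply/rowP => j; by rewrite !mxE big_ord1.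
Qed.

(* A vector-valued 2-form is determined by its values on the decomposable
   bivectors, encoded as cross products: F(v, w) = (v x w) . axial F. *)
Definition bps1_mx gM gN m E F : Prop :=
  rdet gM *: (invmx gM *m E *m gN) = rdet gN *: cof E + 3 *: ((axial F)^T *m m).

Definition bps2_mx (al be ga : R) gN m n E F : Prop :=
  al *: (rdet gN *: (cof E *m invmx gN)) + be *: ((axial F)^T *m sharp gN m)
    + ga *: ((axial F)^T *m n) = 0.

Lemma bps_eqsP al be ga gM gN m n E F : gM^T = gM -> gN \in unitmx -> F^T = - F ->
  bps_eqs al be ga gM gN m n E F <->
  bps1_mx gM gN m E F /\ bps2_mx al be ga gN m n E F.
Proof.
move=> sM uN aF.
have L v w : hodge1_vec gM E v w
      - (pull_Sigma gN E v w + 3 *: pull_vec F (sharp gN m) v w) =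
    cross v w *m (rdet gM *: (invmx gM *m E)
      - (rdet gN *: (cof E *m invmx gN) + 3 *: ((axial F)^T *m sharp gN m))).
  rewrite hodge1_vecE// /pull_Sigma SigmaE cross_mul /pull_vec bil_axial// scalar_row.
  by rewrite mulmxBr mulmxDr -!scalemxAr !mulmxA.
have L2 v w : al *: pull_Sigma gN E v w + be *: pull_vec F (sharp gN m) v w
      + ga *: pull_vec F n v w =
    cross v w *m (al *: (rdet gN *: (cof E *m invmx gN))
     + be *: ((axial F)^T *m sharp gN m) + ga *: ((axial F)^T *m n)).
  rewrite /pull_Sigma SigmaE cross_mul /pull_vec bil_axial// !scalar_row.
  by rewrite !mulmxDr -!scalemxAr !mulmxA.
have eq1 : bps1_mx gM gN m E F <-> rdet gM *: (invmx gM *m E) =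
    rdet gN *: (cof E *m invmx gN) + 3 *: ((axial F)^T *m sharp gN m).
  rewrite /bps1_mx /sharp; split => H.
    have := congr1 (fun X => X *m invmx gN) H.
    rewrite -!scalemxAl !mulmxDl -!scalemxAl mulmxK// mulmxA => ->; by [].
  have := congr1 (fun X => X *m gN) H.
  by rewrite -!scalemxAl !mulmxDl -!scalemxAl !mulmxA !mulmxKV// -mulmxA mulmxKV.
split => [H|[/eq1 H1 H2] v w].
  split.
    apply/eq1; apply/eqP; rewrite -subr_eq0; apply/eqP.
    apply: eq_on_cross => v w; rewrite mulmx0 -L.
    by have [] := H v w.
  apply: eq_on_cross => v w; rewrite mulmx0 -L2.
  by have [] := H v w.
split; first by rewrite L H1 subrr mulmx0.
by rewrite L2 H2 mulmx0.
Qed.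

Lemma cof_frame E E' T S : T \in unitmx -> S \in unitmx -> E *m S = T *m E' ->
  \det S *: cof E = \det T *: ((invmx T)^T *m cof E' *m S^T).
Proof.
move=> uT uS /(congr1 cof); rewrite !cofM (cof_unit uS) (cof_unit uT).
move=> /(congr1 (fun X => X *m S^T)).
rewrite -scalemxAr -!scalemxAl => <-; rewrite -!mulmxA -trmx_mul.
by rewrite mulmxV// trmx1 mulmx1.
Qed.

(** Naturality under a change T of the frame at the source and S at the target. Both determinants
    must be positive since the factors [rdet] then scale by det T and det S; reversing an
    orientation would change a sign. *)
Lemma bps1_frame gM gM' gN gN' m m' E E' F F' T S :
  0 < \det T -> 0 < \det S -> gM' \in unitmx -> F'^T = - F' ->
  gM = T *m gM' *m T^T -> gN = S *m gN' *m S^T -> m = m' *m S^T ->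
  E *m S = T *m E' -> F = T *m F' *m T^T ->
  bps1_mx gM' gN' m' E' F' -> bps1_mx gM gN m E F.
Proof.
move=> dT dS uM aF gME gNE mE EE FE; rewrite /bps1_mx => H.
have uT : T \in unitmx by rewrite unitmxE unitfE gt_eqF.
have uS : S \in unitmx by rewrite unitmxE unitfE gt_eqF.
have uTt : T^T \in unitmx by rewrite unitmx_tr.
have iM : invmx gM = (invmx T)^T *m invmx gM' *m invmx T.
  have : gM *m ((invmx T)^T *m invmx gM' *m invmx T) = 1%:M.
    rewrite gME -!mulmxA trmx_inv (mulKVmx uTt) (mulKVmx uM) mulmxV//.
  move=> h; have uM1 : gM \in unitmx by case: (mulmx1_unit h).
  by rewrite -[LHS]mulmx1 -h mulKmx.
rewrite gME gNE rdet_congr// rdet_congr// -gME iM FE axial_congr// mE (cof_unit uT).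
have cE := cof_frame uT uS EE.
rewrite (mulrC (\det S) (rdet gN')) -(scalerA (rdet gN')) cE.
have -> : (invmx T)^T *m invmx gM' *m invmx T *m E *m (S *m gN' *m S^T) =
    (invmx T)^T *m (invmx gM' *m E' *m gN') *m S^T.
  rewrite -!mulmxA; congr (_ *m (_ *m _)); rewrite !mulmxA -(mulmxA (invmx T)) EE.
  by rewrite mulKmx.
rewrite -scalerA.
have -> : rdet gM' *: ((invmx T)^T *m (invmx gM' *m E' *m gN') *m S^T) =
  (invmx T)^T *m (rdet gM' *: (invmx gM' *m E' *m gN')) *m S^T.
  by rewrite -scalemxAr -scalemxAl.
rewrite H mulmxDr mulmxDl scalerDr; congr (_ + _).
  by rewrite -scalemxAr -scalemxAl scalerA mulrC -scalerA.
rewrite -scalemxAr -scalemxAl scalerA [_ * 3]mulrC -scalerA; congr (_ *: _).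
by rewrite trmx_mul trmxK -scalemxAl -scalemxAl !mulmxA.
Qed.

(** Multiplication by E^T on the left and n^T on the right kills the moment term, because m and n
    pair to 0, and turns the cofactor term into a multiple of det E = 0. Contracting with n gN
    leaves the squared norm of x = n gN E^T. *)
Lemma bps1_singular gM gN m n E F : posdef gM -> posdef gN -> pairing m n = 0 ->
  bps1_mx gM gN m E F -> \det E = 0 -> n *m gN *m E^T = 0.
Proof.
move=> pM pN mn H dE; set x := n *m gN *m E^T.
have mn0 : m *m n^T = 0 by apply/matrixP => i j; rewrite !ord1 [RHS]mxE; exact: mn.
have : E^T *m (rdet gM *: (invmx gM *m E *m gN)) *m n^T = 0.
  rewrite H mulmxDr mulmxDl -!scalemxAr -!scalemxAl -!mulmxA mn0 !mulmx0 scaler0 addr0.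
  have -> : E^T *m (cof E *m n^T) = (\det E)%:M *m n^T.
    by rewrite mulmxA; congr (_ *m _); rewrite -[LHS]trmxK trmx_mul trmxK tr_cof_mul tr_scalar_mx.
  by rewrite dE mul_scalar_mx scale0r scaler0.
move=> /(congr1 (fun X => n *m gN *m X)); rewrite mulmx0.
have -> : n *m gN *m (E^T *m (rdet gM *: (invmx gM *m E *m gN)) *m n^T) =
    rdet gM *: (x *m invmx gM *m x^T).
  rewrite /x !trmx_mul trmxK (posdef_sym pN) -!scalemxAr -!scalemxAl -scalemxAr.
  by rewrite !mulmxA.
move=> h; apply/eqP; apply: contra_eqT h => x0.
apply/eqP => /matrixP/(_ 0 0); rewrite !mxE => /eqP.
rewrite mulf_eq0 (gt_eqF (rdet_gt0 pM))/= => /eqP h.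
have := (posdef_inv pM).2 x x0; rewrite /bil mxE.
by rewrite h ltxx.
Qed.

(** The same contraction with det E kept: it equates det E |n|^2 with a positive multiple of the
    squared norm of x, which is nonzero because E is invertible. *)
Lemma bps1_det_gt0 gM gN m n E F : posdef gM -> posdef gN -> pairing m n = 0 ->
  bps1_mx gM gN m E F -> n != 0 -> E \in unitmx -> 0 < \det E.
Proof.
move=> pM pN mn H n0 uE; set x := n *m gN *m E^T.
have mn0 : m *m n^T = 0 by apply/matrixP => i j; rewrite !ord1 [RHS]mxE; exact: mn.
have x0 : x != 0.
  apply: contraNneq n0 => h; have : x *m invmx E^T *m invmx gN = 0 by rewrite h !mul0mx.
  by rewrite /x mulmxK ?unitmx_tr// mulmxK ?posdef_unit// => ->.
have E1 : n *m gN *m (E^T *m (rdet gM *: (invmx gM *m E *m gN)) *m n^T) =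
    rdet gM *: (x *m invmx gM *m x^T).
  rewrite /x !trmx_mul trmxK (posdef_sym pN) -!scalemxAr -!scalemxAl -scalemxAr.
  by rewrite !mulmxA.
have cE : E^T *m cof E = (\det E)%:M.
  by rewrite -[LHS]trmxK trmx_mul trmxK tr_cof_mul tr_scalar_mx.
have E2 : E^T *m (rdet gM *: (invmx gM *m E *m gN)) *m n^T = rdet gN *: (\det E *: n^T).
  rewrite H mulmxDr mulmxDl -!scalemxAr -!scalemxAl -!mulmxA mn0 !mulmx0 scaler0 addr0.
  by rewrite mulmxA cE mul_scalar_mx.
have E3 := congr1 (fun X : 'M[R]_1 => X 0 0) E1.
have p1 : 0 < bil (invmx gM) x x by exact: (posdef_inv pM).2.
have p2 : 0 < bil gN n n by exact: pN.2.
have E4 : rdet gN * (\det E * bil gN n n) = rdet gM * bil (invmx gM) x x by move: E3; rewrite E2 -!scalemxAr !scale_entry.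
have : 0 < rdet gN * (\det E * bil gN n n) by rewrite E4 mulr_gt0// rdet_gt0.
by rewrite pmulr_rgt0 ?rdet_gt0// pmulr_lgt0.
Qed.

Lemma det_mul_row f v : \det (f^T *m v) = 0.
Proof.
have fE (i j : 'I_3) : (f^T *m v) i j = f 0 i * v 0 j by rewrite !mxE big_ord1 !mxE.
by rewrite det3 pairing3 !crossE !rowE3 !fE; ring.
Qed.

Lemma mul_row_eq0 f v : f^T *m v = 0 -> f != 0 -> v = 0.
Proof.
move=> h f0; apply: contraNeq f0 => /eqP v0; apply/eqP/rowP => i; rewrite mxE.
apply/eqP; apply: contra_notT v0 => fi; apply/rowP => j; rewrite mxE.
have := congr1 (fun X : 'M[R]_3 => X i j) h; rewrite !mxE big_ord1 !mxE => /eqP.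
by rewrite mulf_eq0 (negPf fi) => /eqP.
Qed.

(** The terms with be and ga share the factor f^T, so their sum is a single outer product, of
    determinant 0; this excludes al != 0. Then be m^sharp + ga n = 0, and pairing with m isolates
    be. *)
Lemma bps2_coefficients al be ga gN m n E F : posdef gN -> F^T = - F ->
  E \in unitmx -> F != 0 -> m != 0 -> n != 0 -> pairing m n = 0 ->
  bps2_mx al be ga gN m n E F -> [/\ al = 0, be = 0 & ga = 0].
Proof.
move=> pN aF uE F0 m0 n0 mn H.
have uN := posdef_unit pN; have sN := rdet_gt0 pN.
have f0 : axial F != 0 by apply: contraNneq F0 => /(axial_inj aF) ->.
have dE : \det E != 0 by rewrite -unitfE -unitmxE.
have al0 : al = 0.
  apply/eqP; apply: contraT => al0.
  have h : cof E *m invmx gN =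
      (axial F)^T *m (- (al * rdet gN)^-1 *: (be *: sharp gN m + ga *: n)).
    rewrite -scalemxAr mulmxDr -!scalemxAr.
    have a0 : al * rdet gN != 0 by rewrite mulf_neq0// gt_eqF.
    apply: (scalerI a0); rewrite [RHS]scalerA mulrN mulfV// scaleN1r; apply/eqP.
    by rewrite -addr_eq0 addrA -scalerA H.
  have := congr1 (fun X : 'M[R]_3 => \det X) h; rewrite det_mul_row det_mulmx det_inv => /eqP.
  rewrite mulf_eq0 invr_eq0 (gt_eqF (posdef_det pN)) orbF => /eqP dc.
  have := congr1 (fun X : 'M[R]_3 => \det X) (mul_cof_tr E).
  rewrite det_mulmx det_tr dc mulr0 det_scalar => /esym/eqP.
  by rewrite expf_eq0 (negPf dE).
move: H; rewrite /bps2_mx al0 scale0r add0r !(scalemxAr _ (axial F)^T) -mulmxDr => /mul_row_eq0/(_ f0) h.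
have p2 : 0 < pairing m (sharp gN m).
  rewrite pairingC /sharp; exact: (posdef_inv pN).2.
have be0 : be = 0.
  have := congr1 (pairing m) h.
  have -> : pairing m (be *: sharp gN m + ga *: n) = be * pairing m (sharp gN m) + ga * pairing m n.
    by rewrite !pairing3 !mxE; ring.
  have -> : pairing m 0 = 0 by rewrite /pairing trmx0 mulmx0 mxE.
  by rewrite mn mulr0 addr0 => /eqP; rewrite mulf_eq0 (gt_eqF p2) orbF => /eqP.
split=> //; move: h; rewrite be0 scale0r add0r => /eqP.
by rewrite scaler_eq0 (negPf n0) orbF => /eqP.
Qed.

Lemma cross_triple u f v : cross u (cross f v) = pairing u v *: f - pairing u f *: v.
Proof. by apply: rowP3; rewrite !mxE !pairing3/=; ring. Qed.

Lemma mul_antisym F v : F^T = - F -> v *m F = cross (axial F) v.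
Proof.
move=> aF; apply: rowP3; rewrite mulmx3 !crossE !(antisym_diag aF) ![axial F _ _]mxE/=.
all: rewrite ?(antisym_entries aF 0 1) ?(antisym_entries aF 1 2%:R) ?(antisym_entries aF 2%:R 0); ring.
Qed.

(** The metric that agrees with gN along m^sharp and is k gN on the plane where m vanishes. *)
Definition conformal gN m (k : R) : 'M[R]_3 :=
  let gmu := (pairing m (sharp gN m))^-1 *: (m^T *m m) in gmu + k *: (gN - gmu).

Definition kap gN m F : R := 1 + 3 * hodge3 gN (wedge21 F m).

Lemma kapE gN m F : F^T = - F -> kap gN m F = 1 + 3 * (pairing (axial F) m / rdet gN).
Proof.
move=> aF; rewrite /kap /hodge3; congr (1 + 3 * (_ / _)).
  rewrite /wedge21 !bil_axial// !pairing3 !crossE /e_ !mxE/=; ring.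
by rewrite volE pairing3 !crossE /e_ !mxE/=; ring.
Qed.

(** This is k times the inverse of [conformal gN m k], in a form that is meaningful before k is
    known to be nonzero. *)
Definition coconformal gN m (k : R) : 'M[R]_3 :=
  invmx gN + ((k - 1) / pairing m (sharp gN m)) *: ((sharp gN m)^T *m sharp gN m).

Lemma sharp_gt0 gN m : posdef gN -> m != 0 -> 0 < pairing m (sharp gN m).
Proof. by move=> pN m0; rewrite pairingC /sharp; exact: (posdef_inv pN).2. Qed.

Lemma mul_sharp_tr gN m : posdef gN -> gN *m (sharp gN m)^T = m^T.
Proof.
move=> pN; rewrite /sharp trmx_mul (invmx_sym (posdef_sym pN)) mulmxA.
by rewrite mulmxV ?posdef_unit// mul1mx.
Qed.

Lemma conformal_mul gN m k : posdef gN -> m != 0 ->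
  conformal gN m k *m coconformal gN m k = k%:M.
Proof.
move=> pN m0; have p := sharp_gt0 pN m0; have uN := posdef_unit pN.
set q := pairing m (sharp gN m) in p *.
have gX : gN *m ((sharp gN m)^T *m sharp gN m) = m^T *m sharp gN m.
  by rewrite mulmxA mul_sharp_tr.
have mX : m^T *m m *m ((sharp gN m)^T *m sharp gN m) = q *: (m^T *m sharp gN m).
  rewrite -mulmxA (mulmxA m) (_ : m *m (sharp gN m)^T = q%:M) ?mul_scalar_mx ?scalemxAr//.
  by apply/matrixP => i j; rewrite !ord1 [RHS]mxE eqxx mulr1n.
have mi : m^T *m m *m invmx gN = m^T *m sharp gN m by rewrite -mulmxA.
rewrite /conformal /coconformal -/q.
have -> : q^-1 *: (m^T *m m) + k *: (gN - q^-1 *: (m^T *m m)) =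
    k *: gN + ((1 - k) / q) *: (m^T *m m).
  apply/matrixP => i j; rewrite !mxE; ring.
rewrite mulmxDl !mulmxDr -!scalemxAl -!scalemxAr gX mX mi mulmxV// -!scalerA.
set X := m^T *m sharp gN m; clearbody X.
apply/matrixP => i j; rewrite !mxE; case: (i == j) => /=; field; exact: lt0r_neq0.
Qed.

Lemma det_coconformal gN m k : posdef gN -> m != 0 ->
  \det (coconformal gN m k) = k / \det gN.
Proof.
move=> pN m0; have p := sharp_gt0 pN m0; have uN := posdef_unit pN.
have -> : coconformal gN m k =
    (1%:M + (((k - 1) / pairing m (sharp gN m)) *: sharp gN m)^T *m m) *m invmx gN.
  by rewrite mulmxDl mul1mx linearZ/= -!scalemxAl -mulmxA.
rewrite det_mulmx det_inv det_rank1; congr (_ / _).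
have -> : forall c : R, pairing (c *: sharp gN m) m = c * pairing m (sharp gN m).
  by move=> c; rewrite !pairing3 !mxE; ring.
by rewrite mulfVK ?lt0r_neq0//; ring.
Qed.

(** With E = 1 both inverse metrics are symmetric, so f^T m^sharp is symmetric as well and f is a
    multiple of m^sharp. The right-hand side then becomes rdet gN times [coconformal], and only the
    scalar factors remain to be matched. *)
Lemma bps1_id g gN m F : posdef g -> posdef gN -> m != 0 -> F^T = - F ->
  bps1_mx g gN m 1%:M F <->
  sharp gN m *m F = 0 /\ g = conformal gN m (kap gN m F).
Proof.
move=> pg pN m0 aF; have p := sharp_gt0 pN m0.
have uN := posdef_unit pN; have ug := posdef_unit pg.
have sg := rdet_gt0 pg; have sN := rdet_gt0 pN.
set q := pairing m (sharp gN m) in p *; set f := axial F.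
set k := kap gN m F.
have kE : k = 1 + 3 * (pairing f m / rdet gN) by exact: kapE.
have eq1 : bps1_mx g gN m 1%:M F <->
    rdet g *: invmx g = rdet gN *: invmx gN + 3 *: (f^T *m sharp gN m).
  rewrite /bps1_mx mulmx1 cof_id; split => H.
    have := congr1 (fun X => X *m invmx gN) H.
    by rewrite -!scalemxAl !mulmxDl -!scalemxAl mulmxK// mul1mx -mulmxA.
  have := congr1 (fun X => X *m gN) H.
  by rewrite -!scalemxAl !mulmxDl -!scalemxAl mulVmx// -mulmxA mulmxKV.
have par : q *: f = pairing f m *: sharp gN m ->
    rdet gN *: invmx gN + 3 *: (f^T *m sharp gN m) = rdet gN *: coconformal gN m k.
  move=> h; have -> : f = (pairing f m / q) *: sharp gN m.
    by rewrite mulrC -scalerA -h scalerA mulVf ?scale1r// gt_eqF.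
  rewrite linearZ/= -scalemxAl /coconformal -/q kE scalerDr !scalerA.
  congr (_ + _ *: _); field; by rewrite !lt0r_neq0.
rewrite eq1; split => [H|[Hf gE]].
  have parf : q *: f = pairing f m *: sharp gN m.
    have sy : f^T *m sharp gN m = (sharp gN m)^T *m f.
      have h : 3 *: (f^T *m sharp gN m) = rdet g *: invmx g - rdet gN *: invmx gN.
        by rewrite H addrC addKr.
      have : (3 *: (f^T *m sharp gN m))^T = 3 *: (f^T *m sharp gN m).
        rewrite h linearB/= !linearZ/=.
        by rewrite (invmx_sym (posdef_sym pg)) (invmx_sym (posdef_sym pN)).
      rewrite linearZ/= trmx_mul trmxK => h3.
      by apply/esym/(scalerI _ h3); rewrite pnatr_eq0.
    have := congr1 (fun X => m *m X) sy; rewrite /= (mulmxA m f^T) (mulmxA m (sharp gN m)^T).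
    have E (c z : 'rV[R]_3) : c *m z^T = (pairing c z)%:M.
      by apply/matrixP => i j; rewrite !ord1 [RHS]mxE eqxx mulr1n.
    by rewrite !E !mul_scalar_mx (pairingC m) => ->.
  rewrite (par parf) in H.
  (* Compare determinants: in dimension three the determinant of rdet g times the inverse of g is
     rdet g. *)
  have sk : rdet g = rdet gN * k.
    have := congr1 (fun X : 'M[R]_3 => \det X) H; rewrite !detZ det_inv det_coconformal//.
    rewrite -!rdet_sqr// => h.
    have -> : rdet g = rdet g ^+ 3 / (rdet g * rdet g) by field; rewrite lt0r_neq0.
    by rewrite h; field; rewrite lt0r_neq0.
  have k0 : k != 0.
    by apply: contraTneq sg => k0; rewrite sk k0 mulr0 ltxx.
  split.
    rewrite mul_antisym// -/f.
    have -> : f = (pairing f m / q) *: sharp gN m.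
      by rewrite mulrC -scalerA -parf scalerA mulVf ?scale1r// gt_eqF.
    by apply: rowP3; rewrite !mxE/=; ring.
  have h2 : coconformal gN m k = k *: invmx g.
    apply: (scalerI (lt0r_neq0 sN)); rewrite -H sk scalerA; by [].
  have := conformal_mul k pN m0; rewrite h2 -scalemxAr => h3.
  have : conformal gN m k *m invmx g = 1%:M.
    by apply: (scalerI k0); rewrite h3 scale_scalar_mx mulr1.
  by move=> /(congr1 (fun X => X *m g)); rewrite mulmxKV// mul1mx.
(* In this direction k is positive because g is: on a nonzero vector killed by m, g is k times
   gN. *)
have k0 : 0 < k.
  have [v v0 mv] : exists2 v : 'rV[R]_3, v != 0 & pairing m v = 0.
    have [e ce] : exists e, cross m e != 0.
      move: m0; apply: contra_neqP => /forallNP h.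
      have c e : cross m e = 0 by apply/eqP/negPn/negP/h.
      have := c (e_ 0); have := c (e_ 1) => /rowP c1 /rowP c0.
      have := c0 2%:R; have := c1 2%:R; have := c0 1; rewrite !mxE/= => h1 h2 h3.
      apply: rowP3; rewrite mxE; lra.
    exists (cross m e) => //; by rewrite pairing3 !crossE; ring.
  have := pg.2 v v0; rewrite gE -/k.
  have -> : bil (conformal gN m k) v v = k * bil gN v v.
    have mm : bil (m^T *m m) v v = 0.
      have -> : bil (m^T *m m) v v = pairing m v * pairing m v.
        by rewrite bil3 !sum3 !pairing3 !mxE !big_ord1 !mxE; ring.
      by rewrite mv mulr0.
    rewrite /conformal -/q.
    have -> : bil (q^-1 *: (m^T *m m) + k *: (gN - q^-1 *: (m^T *m m))) v v =
      k * bil gN v v + (q^-1 - k * q^-1) * bil (m^T *m m) v v.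
      rewrite !bil3 !sum3; set X := m^T *m m; rewrite !mxE; ring.
    by rewrite mm mulr0 addr0.
  by rewrite pmulr_lgt0// pN.2.
have parf : q *: f = pairing f m *: sharp gN m.
  have := cross_triple m f (sharp gN m); rewrite -mul_antisym// Hf.
  have -> : cross m 0 = 0 by apply: rowP3; rewrite !mxE/=; ring.
  by move=> /esym/subr0_eq; rewrite (pairingC f m).
rewrite (par parf).
have gQ : g *m coconformal gN m k = k%:M by rewrite gE conformal_mul.
have iQ : coconformal gN m k = k *: invmx g.
  by rewrite -[LHS](mulKmx ug) gQ mul_mx_scalar.
have d : \det g = k * k * \det gN.
  have := congr1 (fun X : 'M[R]_3 => \det X) gQ.
  rewrite det_mulmx det_coconformal// det_scalar => h.
  apply: (mulIf (x := k / \det gN)); first by rewrite mulf_neq0 ?invr_eq0 ?gt_eqF// posdef_det.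
  rewrite h; field; by rewrite gt_eqF ?posdef_det.
rewrite iQ scalerA; congr (_ *: _).
rewrite /rdet d sqrtrM ?mulr_ge0 ?ltW//.
by rewrite -expr2 sqrtr_sqr gtr0_norm// mulrC.
Qed.

(* The curvature in the frame in which E becomes the identity. *)
Definition flatten_curv E F := invmx E *m F *m (invmx E)^T.

(** E itself is used as a change of frame at the source, which reduces the equation to the case E =
    1. *)
Lemma bps1_standard gM gN m E F : posdef gM -> posdef gN -> m != 0 ->
  0 < \det E -> F^T = - F ->
  bps1_mx gM gN m E F <->
  sharp gN m *m flatten_curv E F = 0 /\
  gM = E *m conformal gN m (kap gN m (flatten_curv E F)) *m E^T.
Proof.
move=> pM pN m0 dE aF.
have uE : E \in unitmx by rewrite unitmxE unitfE gt_eqF.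
have uEt : E^T \in unitmx by rewrite unitmx_tr.
have uiE : invmx E \in unitmx by rewrite unitmx_inv.
set F' := flatten_curv E F; have aF' : F'^T = - F' by exact: antisym_congr.
pose g' := invmx E *m gM *m (invmx E)^T.
have pg' : posdef g' by exact: posdef_congr.
have gME : gM = E *m g' *m E^T.
  by rewrite /g' !mulmxA mulmxV// mul1mx trmx_inv mulmxKV.
have FE : F = E *m F' *m E^T.
  by rewrite /F' /flatten_curv !mulmxA mulmxV// mul1mx trmx_inv mulmxKV.
have eq : bps1_mx gM gN m E F <-> bps1_mx g' gN m 1%:M F'.
  split; last first.
    apply: (bps1_frame (T := E) (S := 1%:M)) => //; rewrite ?det1 ?trmx1 ?mulmx1 ?mul1mx//.
    exact: posdef_unit.
  apply: (bps1_frame (T := invmx E) (S := 1%:M)) => //.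
  all: rewrite ?det1 ?trmx1 ?mulmx1 ?mul1mx ?mulVmx ?det_inv ?invr_gt0//.
  exact: posdef_unit.
rewrite eq bps1_id//; split => -[h1 h2]; split => //.
  by rewrite {1}gME h2.
apply: (can_inj (mulKmx uE)); apply: (can_inj (mulmxK uEt)).
by rewrite -h2 gME.
Qed.

(** The matrix 1 - a^T n fixes m^T since m and n pair to 0, so it also fixes the part g_mu; only the
    complementary part feels the shear. *)
Lemma std_metric_frame gN m n a F : pairing m n = 0 ->
  std_metric gN m n a F =
  (1%:M - a^T *m n) *m conformal gN m (kap gN m F) *m (1%:M - a^T *m n)^T.
Proof.
move=> mn; rewrite /std_metric -/(kap gN m F) /conformal.
set gmu := _ *: (m^T *m m); set E := 1%:M - _.
have Em : E *m m^T = m^T.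
  rewrite mulmxBl mul1mx -mulmxA (_ : n *m m^T = 0) ?mulmx0 ?subr0//.
  by apply/matrixP => i j; rewrite !ord1 [RHS]mxE -[LHS]/(pairing n m) pairingC.
have Eg : E *m gmu *m E^T = gmu.
  rewrite /gmu -scalemxAr -scalemxAl mulmxA Em -mulmxA; congr (_ *: (_ *m _)).
  by rewrite -[LHS]trmxK trmx_mul trmxK Em trmxK.
clearbody E gmu.
by rewrite mulmxDr mulmxDl Eg -scalemxAr -scalemxAl mulmxBr mulmxBl Eg.
Qed.

Lemma kap_congr gN m E F : F^T = - F -> \det E = 1 -> m *m E^T = m ->
  kap gN m (E *m F *m E^T) = kap gN m F.
Proof.
move=> aF dE mE; have uE : E \in unitmx by rewrite unitmxE dE unitr1.
rewrite !kapE//; last exact: antisym_congr.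
rewrite axial_congr// pairing_mul trmxK cof_unit// dE scale1r.
by rewrite -{1}mE trmx_inv mulmxK// unitmx_tr.
Qed.

End PointwiseBPS.

(** * Exterior calculus in coordinates *)

Section Calculus.
Context {R : realType}.
Implicit Types (U : set 'rV[R]_3).

Lemma derive_comp (V W Z : normedModType R) (f : V -> W) (g : W -> Z) x v :
  differentiable f x -> differentiable g (f x) ->
  'D_v (g \o f) x = 'D_('D_v f x) g (f x).
Proof.
move=> df dg; have dgf := differentiable_comp df dg.
by rewrite (deriveE v dgf) (deriveE ('D_v f x) dg) (deriveE v df) (diff_comp df dg).
Qed.

Lemma derive_jacobian m n (f : 'rV[R]_m -> 'rV[R]_n) x v : differentiable f x ->
  'D_v f x = v *m 'J f x.
Proof. by move=> df; rewrite (deriveE v df) /jacobian mul_rV_lin1. Qed.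

Lemma row_jacobian m n (f : 'rV[R]_m -> 'rV[R]_n) x i : differentiable f x ->
  row i ('J f x) = 'D_(delta_mx 0 i) f x.
Proof. by move=> df; rewrite (derive_jacobian _ df) rowE. Qed.

Lemma jacobian_comp m n p (f : 'rV[R]_m -> 'rV[R]_n) (g : 'rV[R]_n -> 'rV[R]_p) x :
  differentiable f x -> differentiable g (f x) ->
  'J (g \o f) x = 'J f x *m 'J g (f x).
Proof.
move=> df dg; apply/row_matrixP => i; rewrite (row_jacobian i (differentiable_comp df dg)).
by rewrite (derive_comp _ df dg) (derive_jacobian _ dg) row_mul (row_jacobian _ df).
Qed.

Lemma near_eq_jacobian m n (f g : 'rV[R]_m -> 'rV[R]_n) x : {near x, f =1 g} ->
  differentiable f x -> 'J f x = 'J g x.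
Proof.
move=> fg df; have dg := near_eq_differentiable fg df.
apply/row_matrixP => i.
apply: (etrans (row_jacobian i df)); apply: (etrans _ (esym (row_jacobian i dg))).
exact: near_eq_derive.
Qed.

Definition grad (h : 'rV[R]_3 -> R) (u : 'rV[R]_3) : 'rV[R]_3 := \row_k 'D_(e_ k) h u.

Lemma derive_grad (h : 'rV[R]_3 -> R) u v : differentiable h u ->
  'D_v h u = pairing (grad h u) v.
Proof.
move=> dh; rewrite (derive3 _ dh) pairing3 ![grad _ _ _ _]mxE.
by move: ('D_(e_ 0) h u) ('D_(e_ 1) h u) ('D_(e_ 2%:R) h u) => a b c; ring.
Qed.

Lemma grad_comp (h : 'rV[R]_3 -> R) (f : 'rV[R]_3 -> 'rV[R]_3) u :
  differentiable f u -> differentiable h (f u) ->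
  grad (h \o f) u = grad h (f u) *m ('J f u)^T.
Proof.
move=> df dh; apply: pairing_ext => v; rewrite !(pairingC v).
rewrite -(derive_grad v (differentiable_comp df dh)) (derive_comp _ df dh).
by rewrite (derive_grad _ dh) pairing_mul trmxK (derive_jacobian _ df).
Qed.

Lemma Ck_grad n U h : open U -> Ck n.+1 U h -> Ck n U (grad h).
Proof.
move=> oU [_ dh]; apply/Ck_mxP => // i j; rewrite ord1.
by apply: (Ck_ext oU _ (dh (e_ j))) => x _; rewrite mxE.
Qed.

Lemma extdE (om : 'rV[R]_3 -> 'rV[R]_3) u i j : differentiable om u ->
  extd om u i j = 'D_(e_ i) (fun x => om x 0 j) u - 'D_(e_ j) (fun x => om x 0 i) u.
Proof.
move=> dom; rewrite /extd [LHS]mxE [in X in _ + X]mxE [in X in _ - X]mxE.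
have dd k : derivable om u (e_ k) by exact: diff_derivable.
by rewrite !jacobianE// !(derive_mx (dd _)) !mxE.
Qed.

Lemma extd_antisym (om : 'rV[R]_3 -> 'rV[R]_3) u : (extd om u)^T = - extd om u.
Proof. by rewrite /extd linearB/= trmxK opprB. Qed.

Lemma extd_grad U h u : open U -> U u -> Ck 2 U h -> extd (grad h) u = 0.
Proof.
move=> oU Uu ch; have cg := Ck_grad oU ch.
apply/matrixP => i j; rewrite (extdE _ _ (Ck_differentiable cg Uu)) mxE.
have E k : (fun x => grad h x 0 k) = 'D_(e_ k) h by apply/funext => x; rewrite mxE.
by rewrite !E (schwarz_derive (e_ i) (e_ j) oU Uu ch) subrr.
Qed.

Lemma jacobian_entry (f : 'rV[R]_3 -> 'rV[R]_3) u i j : differentiable f u ->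
  'J f u i j = 'D_(e_ i) (fun x => f x 0 j) u.
Proof.
move=> df; rewrite (jacobianE i j df).
have d : derivable f u (delta_mx 0 i) by exact: diff_derivable.
by rewrite (derive_mx d) mxE.
Qed.

Lemma jacobianD (f g : 'rV[R]_3 -> 'rV[R]_3) u : differentiable f u ->
  differentiable g u -> 'J (fun x => f x + g x) u = 'J f u + 'J g u.
Proof.
move=> df dg; apply/row_matrixP => i.
have dfg : differentiable (fun x => f x + g x) u by exact: (differentiableD df dg).
have -> : row i ('J f u + 'J g u) = row i ('J f u) + row i ('J g u) by exact: linearD.
apply: (etrans (row_jacobian i dfg)).
apply: (etrans _ (esym (f_equal2 +%R (row_jacobian i df) (row_jacobian i dg)))).
by apply: deriveD; exact: diff_derivable.
Qed.

Lemma extdD (f g : 'rV[R]_3 -> 'rV[R]_3) u : differentiable f u ->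
  differentiable g u -> extd (fun x => f x + g x) u = extd f u + extd g u.
Proof.
move=> df dg; rewrite /extd (jacobianD df dg).
by move: ('J f u) ('J g u) => A B; rewrite linearD/= opprD addrACA.
Qed.

Lemma differentiable_scale (h : 'rV[R]_3 -> R) (f : 'rV[R]_3 -> 'rV[R]_3) u :
  differentiable h u -> differentiable f u -> differentiable (fun x => h x *: f x) u.
Proof.
move=> dh /differentiable_mxP df; apply/differentiable_mxP => i j.
have -> : (fun x => (h x *: f x) i j) = (fun x => h x * f x i j).
  by apply/funext => x; rewrite mxE.
exact: differentiableM.
Qed.

Lemma jacobian_scale (h : 'rV[R]_3 -> R) (f : 'rV[R]_3 -> 'rV[R]_3) u :
  differentiable h u -> differentiable f u ->
  'J (fun x => h x *: f x) u = (grad h u)^T *m f u + h u *: 'J f u.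
Proof.
move=> dh df; apply/matrixP => i j.
rewrite (jacobian_entry i j (differentiable_scale dh df)).
have -> : (fun x => (h x *: f x) 0 j) = (fun x => h x * f x 0 j).
  by apply/funext => x; rewrite mxE.
have dfj : differentiable (fun x => f x 0 j) u by exact: (differentiable_mxP _ _).1.
have -> : 'D_(e_ i) (fun x => h x * f x 0 j) u =
    h u *: 'D_(e_ i) (fun x => f x 0 j) u + f u 0 j *: 'D_(e_ i) h u.
  by apply: deriveM; exact: diff_derivable.
rewrite -(jacobian_entry i j df); move: ('J f u) => J.
rewrite [RHS]mxE [in X in _ = X + _]mxE big_ord1 [in X in _ = X + _]mxE.
rewrite [grad _ _ _ _]mxE [X in _ = _ + X]mxE addrC; congr (_ + _); exact: mulrC.
Qed.

Lemma extd_scale (h : 'rV[R]_3 -> R) (f : 'rV[R]_3 -> 'rV[R]_3) u :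
  differentiable h u -> differentiable f u ->
  extd (fun x => h x *: f x) u =
    (grad h u)^T *m f u - (f u)^T *m grad h u + h u *: extd f u.
Proof.
move=> dh df; rewrite /extd (jacobian_scale dh df).
move: (grad h u) ('J f u) => a B.
by rewrite linearD/= linearZ/= trmx_mul trmxK scalerBr opprD addrACA.
Qed.

Lemma grad_pairing (f g : 'rV[R]_3 -> 'rV[R]_3) u : differentiable f u ->
  differentiable g u ->
  grad (fun x => pairing (f x) (g x)) u = g u *m ('J f u)^T + f u *m ('J g u)^T.
Proof.
move=> df dg; apply/rowP => i.
have dfj j : differentiable (fun x => f x 0 j) u by exact: (differentiable_mxP _ _).1.
have dgj j : differentiable (fun x => g x 0 j) u by exact: (differentiable_mxP _ _).1.
have -> : (fun x => pairing (f x) (g x)) = \sum_j (fun x => f x 0 j * g x 0 j).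
  by apply/funext => x; rewrite fct_sumE sum3 pairing3.
have dfg j : derivable (fun x => f x 0 j * g x 0 j) u (e_ i).
  by apply: derivableM; exact: diff_derivable.
rewrite [LHS]mxE (derive_sum dfg) [RHS]mxE [in X in X + _]mxE [in X in _ + X]mxE.
rewrite -big_split/=; apply: eq_bigr => j _.
have -> : 'D_(e_ i) (fun x => f x 0 j * g x 0 j) u =
    f u 0 j *: 'D_(e_ i) (fun x => g x 0 j) u + g u 0 j *: 'D_(e_ i) (fun x => f x 0 j) u.
  by apply: deriveM; exact: diff_derivable.
have J (h : 'rV[R]_3 -> 'rV[R]_3) : differentiable h u ->
    'D_(e_ i) (fun x => h x 0 j) u = ('J h u)^T j i.
  by move=> dh; apply: (etrans (esym (jacobian_entry i j dh))); rewrite [RHS]mxE.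
apply: (etrans (addrC _ _)).
exact: (f_equal2 (fun a b => g u 0 j * a + f u 0 j * b) (J f df) (J g dg)).
Qed.

Lemma Ck_extd n U om : open U -> Ck n.+1 U om -> Ck n U (extd om).
Proof.
move=> oU com; have cJ := Ck_jacobian oU com.
by apply: CkB => //; exact: Ck_trmx.
Qed.

Definition pull (f om : 'rV[R]_3 -> 'rV[R]_3) (u : 'rV[R]_3) : 'rV[R]_3 :=
  om (f u) *m ('J f u)^T.

Lemma Ck_pull n U W (f om : 'rV[R]_3 -> 'rV[R]_3) : open U -> open W ->
  (forall x, U x -> W (f x)) -> Ck n.+1 U f -> Ck n W om -> Ck n U (pull f om).
Proof.
move=> oU oW UW cf com; have cJ := Ck_jacobian oU cf.
have c1 := Ck_comp_mx (@coordinatized_rV R 3) oU oW UW com (CkW cf).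
exact: (Ck_mulmx oU c1 (Ck_trmx oU cJ)).
Qed.

(** The Jacobian of the pullback is the congruent Jacobian of om plus a combination of Hessians of
    the components of f. The latter is symmetric and drops out of the antisymmetrization. *)
Lemma extd_pull U W (f om : 'rV[R]_3 -> 'rV[R]_3) u : open U -> open W ->
  (forall x, U x -> W (f x)) -> Ck 2 U f -> Ck 1 W om -> U u ->
  extd (pull f om) u = 'J f u *m extd om (f u) *m ('J f u)^T.
Proof.
move=> oU oW UW cf com Uu.
have df x : U x -> differentiable f x by move=> Ux; exact: (Ck_differentiable cf Ux).
have dom x : U x -> differentiable om (f x).
  by move=> /UW Wx; exact: (Ck_differentiable com Wx).
have cJ : Ck 1 U (fun x => 'J f x) by exact: Ck_jacobian.
have domf : differentiable (om \o f) u by apply: differentiable_comp; [exact: df|exact: dom].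
pose hess k := \matrix_(i, j) 'D_(e_ i) ('D_(e_ j) (fun x => f x 0 k)) u.
have hessT k : (hess k)^T = hess k.
  have ck : Ck 2 U (fun x => f x 0 k) by exact: (Ck_mxP _ _ oU).1.
  apply/matrixP => i j; rewrite [LHS]mxE [LHS]mxE [RHS]mxE.
  exact: (schwarz_derive (e_ i) (e_ j) oU Uu ck).
have dJ k j : differentiable (fun x => 'J f x j k) u.
  by have c := (Ck_mxP _ _ oU).1 cJ j k; exact: (Ck_differentiable c Uu).
have hessE k i j : 'D_(e_ i) (fun x => 'J f x j k) u = hess k i j.
  rewrite [RHS]mxE; apply: near_eq_derive.
  have := open_near oU Uu; apply: near_sub => x Ux.
  exact: (jacobian_entry j k (df x Ux)).
have dp : differentiable (pull f om) u.
  exact: (Ck_differentiable (Ck_pull oU oW UW cf com) Uu).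
have key : 'J (pull f om) u = 'J f u *m 'J om (f u) *m ('J f u)^T
    + \sum_k om (f u) 0 k *: hess k.
  apply/matrixP => i j; rewrite (jacobian_entry i j dp).
  have -> : (fun x => pull f om x 0 j) = \sum_k (fun x => (om \o f) x 0 k * 'J f x j k).
    apply/funext => x; rewrite fct_sumE /pull mxE; apply: eq_bigr => k _.
    by rewrite [X in _ * X]mxE.
  have domk k : differentiable (fun x => (om \o f) x 0 k) u.
    by exact: (differentiable_mxP _ _).1.
  have dd k : derivable (fun x => (om \o f) x 0 k * 'J f x j k) u (e_ i).
    by apply: derivableM; exact: diff_derivable.
  rewrite (derive_sum dd) [RHS]mxE summxE [X in X + _]mxE -big_split/=.
  apply: eq_bigr => k _.
  have -> : 'D_(e_ i) (fun x => (om \o f) x 0 k * 'J f x j k) u =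
      (om \o f) u 0 k *: 'D_(e_ i) (fun x => 'J f x j k) u
      + 'J f u j k *: 'D_(e_ i) (fun x => (om \o f) x 0 k) u.
    by apply: deriveM; exact: diff_derivable.
  rewrite hessE -(jacobian_entry i k domf) (jacobian_comp (df u Uu) (dom u Uu)).
  move: ('J f u *m 'J om (f u)) ('J f u) => X J.
  apply: (etrans (addrC _ _)); congr (_ + _); last by rewrite [RHS]mxE.
  by apply: (etrans (mulrC _ _)); congr (_ * _); rewrite [RHS]mxE.
have sumT : (\sum_k om (f u) 0 k *: hess k)^T = \sum_k om (f u) 0 k *: hess k.
  by rewrite linear_sum; apply: eq_bigr => k _; rewrite linearZ/= hessT.
rewrite /extd key linearD/= sumT !trmx_mul trmxK.
move: ('J f u) ('J om (f u)) (\sum_k _) => A B C.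
by rewrite opprD addrACA subrr addr0 mulmxBr mulmxBl mulmxA.
Qed.

Lemma open_preim (V W : normedModType R) (U : set V) (O : set W) (f : V -> W) :
  open U -> open O -> (forall u, U u -> {for u, continuous f}) ->
  open (U `&` f @^-1` O).
Proof.
move=> oU oO cf; rewrite openE => u [Uu Ofu].
apply: (near_and (P := U) (Q := f @^-1` O)); first exact: open_near.
exact: (cf u Uu _ (open_near oO Ofu)).
Qed.

Lemma open_neq0 (V : normedModType R) (U : set V) (h : V -> R) : open U ->
  (forall u, U u -> {for u, continuous h}) -> open (U `&` [set u | h u != 0]).
Proof. by move=> oU ch; exact: (open_preim oU (@open_neq R 0) ch). Qed.

Lemma derive_quotient (V : normedModType R) (f g : V -> R) (x v : V) :
  differentiable f x -> differentiable g x -> g x != 0 ->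
  'D_v (fun y => - (f y * (g y)^-1)) x =
    - ('D_v f x * g x - f x * 'D_v g x) / g x ^+ 2.
Proof.
move=> df dg g0.
have d1 : derivable f x v by exact: (diff_derivable df).
have d2 : derivable g x v by exact: (diff_derivable dg).
have dV := derivableV g0 d2.
rewrite (deriveN (derivableM d1 dV)) (deriveM d1 dV) (deriveV g0 d2) /GRing.scale/=.
move: ('D_v f x) ('D_v g x) => a b.
by move: (f x) (g x) g0 => y z z0; field.
Qed.

(** Here (x, y, z) are the components of th and the other letters their partial derivatives. The
    planes ker th have slopes P = -x/z and Q = -y/z, and the vanishing of th /\ d th is the
    Frobenius condition for P and Q after clearing denominators. *)
Lemma leaf_integrability (x y z b c d f g h i : R) : z != 0 ->
  x * (f - h) + y * (g - c) + z * (b - d) = 0 ->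
  - (d * z - x * f) / z ^+ 2 + - (g * z - x * i) / z ^+ 2 * - (y * z^-1) =
  - (b * z - y * c) / z ^+ 2 + - (h * z - y * i) / z ^+ 2 * - (x * z^-1).
Proof.
move=> z0 H; apply/eqP; rewrite -subr_eq0; apply/eqP.
apply: (mulIf (expf_neq0 3 z0)); rewrite mul0r.
by transitivity (z * (x * (f - h) + y * (g - c) + z * (b - d)));
  [field | rewrite H mulr0].
Qed.

Lemma derive_coord (i j : 'I_3) (p : 'rV[R]_3) :
  'D_(e_ i) (@rV_coord R 3 j) p = (i == j)%:R.
Proof.
have c : continuous (@rV_coord R 3 j) by exact: rV_coord_continuous.
have d : differentiable (@rV_coord R 3 j) p by exact: linear_differentiable.
transitivity (@rV_coord R 3 j (e_ i)); last by rewrite /rV_coord /e_ mxE eqxx eq_sym.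
by rewrite (deriveE (e_ i) d) (diff_lin p c).
Qed.

(* [pairing (th u) (axial (extd om u))] is the coefficient of th /\ d om. By the
   first condition the planes ker th are tangent to surfaces, and by the second
   one A is closed along them. *)
Lemma closed_on_leaves_normal O (th A : 'rV[R]_3 -> 'rV[R]_3) :
  open O -> O 0 -> smooth O th -> smooth O A -> th 0 0 2%:R != 0 ->
  (forall u, O u -> pairing (th u) (axial (extd th u)) = 0) ->
  (forall u, O u -> pairing (th u) (axial (extd A u)) = 0) ->
  exists V h, [/\ open V, V 0, V `<=` O & smooth V h] /\
    forall u a, V u -> pairing (th u) a = 0 -> pairing (A u + grad h u) a = 0.
Proof.
move=> oO O0 sth sA th0 fr cl.
have cth k n : Ck n O (fun u => th u 0 k) by apply: (Ck_mxP _ _ oO).1; exact: sth.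
have cth2 u : O u -> {for u, continuous (fun u => th u 0 2%:R)}.
  by move=> Ou; exact: (Ck_continuous (cth 2%:R 0%N) Ou).
pose O2 := O `&` [set u | th u 0 2%:R != 0].
have oO2 : open O2 by exact: open_neq0.
have O20 : O2 0 by [].
have O2O : O2 `<=` O by move=> u [].
have O2n u : O2 u -> th u 0 2%:R != 0 by case.
pose P u := - (th u 0 0 * (th u 0 2%:R)^-1).
pose Q u := - (th u 0 1 * (th u 0 2%:R)^-1).
have cV n : Ck n O2 (fun u => (th u 0 2%:R)^-1).
  by apply: CkV => //; exact: Ck_subset (cth _ _).
have sP : smooth O2 P.
  by move=> n; apply: CkN => //; apply: CkM => //; exact: Ck_subset (cth _ _).
have sQ : smooth O2 Q.
  by move=> n; apply: CkN => //; apply: CkM => //; exact: Ck_subset (cth _ _).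
have dth k u : O u -> differentiable (fun u => th u 0 k) u.
  by move=> Ou; exact: (Ck_differentiable (cth k 1%N) Ou).
have int u : O2 u -> 'D_(e_ 1) P u + 'D_(e_ 2%:R) P u * Q u =
    'D_(e_ 0) Q u + 'D_(e_ 2%:R) Q u * P u.
  move=> O2u; have Ou := O2O u O2u; have n2 := O2n u O2u.
  have dthu : differentiable th u by apply/differentiable_mxP => i j; rewrite ord1; exact: dth.
  have dPQ k j := derive_quotient (e_ j) (dth k u Ou) (dth 2%:R u Ou) n2.
  rewrite (dPQ 0 1) (dPQ 0 2%:R) (dPQ 1 0) (dPQ 1 2%:R).
  apply: (leaf_integrability _ n2); have := fr u Ou.
  by rewrite pairing3 ![axial _ _ _]mxE/= !(extdE _ _ dthu).
have [r [Z [r0 sZ Z0 HZ]]] := integrable_leaves oO2 O20 sP sQ int.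
set B := ball (0 : 'rV[R]_3) r in sZ HZ.
have oB : open B by exact: ball_open.
have B0 : B 0 by exact: ballxx.
(* [L] straightens the leaves: they are the images of the planes of constant label. *)
pose L p := emb p (Z p).
have sL : smooth B L by move=> n; apply: Ck_emb => //; exact: Ck_id.
have BL p : B p -> O2 (L p) by move=> /HZ[].
have dL p : B p -> differentiable L p by move=> Bp; exact: (Ck_differentiable (sL 1%N) Bp).
have JL p i j : B p -> 'J L p i j = if j == 2%:R then 'D_(e_ i) Z p else (i == j)%:R.
  move=> Bp; rewrite (jacobian_entry i j (dL p Bp)); case: ifPn => j2.
    by congr ('D_(e_ i) _ p); apply/funext => x; rewrite mxE j2.
  have -> : (fun x => L x 0 j) = @rV_coord R 3 j.
    by apply/funext => x; rewrite mxE (negPf j2).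
  exact: derive_coord.
have detJ p : B p -> \det ('J L p) = 'D_(e_ 2%:R) Z p.
  move=> Bp; rewrite det3 pairing3 !crossE !rowE3 !(JL _ _ _ Bp)/=.
  move: ('D_(e_ 0) Z p) ('D_(e_ 1) Z p) ('D_(e_ 2%:R) Z p) => a b c.
  by rewrite !(mul0r, mulr0, mul1r, mulr1, subr0, sub0r, addr0, add0r, oppr0).
have uJ : 'J L 0 \in unitmx.
  by rewrite unitmxE (detJ _ B0) unitfE gt_eqF//; have [] := HZ 0 B0.
pose a0 p : 'rV[R]_3 := row 0 ('J L p).
pose a1 p : 'rV[R]_3 := row 1 ('J L p).
(* The form th annihilates the two tangent vectors [a0], [a1] of the leaf, hence is a multiple of
   their cross product; the factor is its last component. *)
have thL p : B p -> th (L p) = th (L p) 0 2%:R *: cross (a0 p) (a1 p).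
  move=> Bp; have n2 := O2n _ (BL p Bp); have [_ Z0p Z1p _] := HZ p Bp.
  apply: rowP3; rewrite [RHS]mxE !crossE !rowE3 !(JL _ _ _ Bp)/= ?Z0p ?Z1p.
  - by rewrite !(mul0r, mulr0, mul1r, mulr1, subr0, sub0r) /P opprK mulrC mulfVK.
  - by rewrite !(mul0r, mulr0, mul1r, mulr1, subr0, sub0r) /Q opprK mulrC mulfVK.
  - by rewrite !(mul0r, mulr0, mul1r, mulr1, subr0, sub0r).
pose B' := pull L A.
have sB' : smooth B B'.
  move=> n; apply: (Ck_pull oB oO _ (sL n.+1) (sA n)) => p Bp.
  exact: O2O (BL p Bp).
have closed p : B p -> 'D_(e_ 1) (fun p => B' p 0 0) p = 'D_(e_ 0) (fun p => B' p 0 1) p.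
  move=> Bp; have BO q : B q -> O (L q) by move=> /BL; exact: O2O.
  have := extd_pull oB oO BO (sL 2) (sA 1%N) Bp.
  move=> /(congr1 (fun X : 'M[R]_3 => X 0 1)).
  rewrite (extdE 0 1 (Ck_differentiable (sB' 1%N) Bp)).
  have -> : ('J L p *m extd A (L p) *m ('J L p)^T) 0 1 = bil (extd A (L p)) (a0 p) (a1 p).
    rewrite /bil /a0 /a1 tr_row -row_mul; move: ('J L p) (extd A _) => J F.
    by rewrite [LHS]mxE [RHS]mxE; apply: eq_bigr => k _; rewrite [X in _ = X * _]mxE [X in _ = _ * X]mxE.
  rewrite bil_axial; last exact: extd_antisym.
  have := cl (L p) (BO p Bp); rewrite {1}(thL p Bp).
  have -> : forall (c : R) (x y : 'rV[R]_3), pairing (c *: x) y = c * pairing x y.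
    by move=> c x y; rewrite !pairing3 !mxE; ring.
  move=> /eqP; rewrite mulf_eq0 (negPf (O2n _ (BL p Bp)))/= => /eqP ->.
  by move=> /subr0_eq.
have sB'k k : smooth B (fun p => B' p 0 k).
  by move=> n; apply: (Ck_mxP _ _ oB).1; exact: sB'.
have [k sk dk] := fiberwise_primitive (sB'k 0) (sB'k 1) closed.
have [U' [V [G [[oU' U0 U'B oV sG] [U'V VU' _]]]]] := inverse_function oB B0 sL uJ.
have L0 : L 0 = 0 by apply/rowP => j; rewrite !mxE Z0; case: ifP.
(* The sign makes the derivative of h cancel A along the leaves. *)
pose h u := - k (G u).
have sh : smooth V h.
  move=> n; apply: CkN => //.
  by apply: (Ck_comp (@coordinatized_rV R 3) oV _ (sk n) (sG n)) => y /VU'[/U'B].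
exists V, h; split.
  split=> //; first by rewrite -L0; have [] := U'V 0 U0.
  by move=> u /VU'[/U'B/BL/O2O + <-].
move=> u a Vu tha.
have [U'p Lp] := VU' u Vu; set p := G u in U'p Lp; have Bp := U'B p U'p.
have hL : {near p, k =1 (fun q => - (h \o L) q)}.
  have := open_near oU' U'p; apply: near_sub => q U'q.
  by rewrite /h /= opprK; have [_ ->] := U'V q U'q.
have dh : differentiable h (L p) by rewrite Lp; exact: (Ck_differentiable (sh 1%N) Vu).
have dkp : differentiable k p by exact: (Ck_differentiable (sk 1%N) Bp).
have dhL : differentiable (h \o L) p by apply: differentiable_comp => //; exact: dL.
have dhk i : 'D_(e_ i) k p = - pairing (grad h (L p)) (row i ('J L p)).
  rewrite (near_eq_derive (e_ i) hL).
  have e : 'D_(e_ i) (fun q => - (h \o L) q) p = - 'D_(e_ i) (h \o L) p.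
    by apply: deriveN; exact: diff_derivable.
  rewrite e (derive_comp (e_ i) (dL p Bp) dh) (derive_grad _ dh); congr (- pairing _ _).
  exact/esym/(row_jacobian i (dL p Bp)).
have Bi i : B' p 0 i = pairing (A (L p)) (row i ('J L p)).
  by rewrite /B' /pull pairing3 mulmx3 ![(_^T) _ _]mxE !rowE3.
have kill i : i = 0 \/ i = 1 -> pairing (A (L p) + grad h (L p)) (row i ('J L p)) = 0.
  have D (x y z : 'rV[R]_3) : pairing (x + y) z = pairing x z + pairing y z.
    by rewrite !pairing3 !mxE; ring.
  have [d0 d1] := dk p Bp.
  by case=> ->; rewrite D -Bi ?d0 ?d1 -?d0 -?d1 dhk addNr.
rewrite -Lp in tha *.
have ab : a = a 0 0 *: a0 p + a 0 1 *: a1 p.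
  move: tha; rewrite (thL p Bp) => /eqP.
  have -> : forall (c : R) (x y : 'rV[R]_3), pairing (c *: x) y = c * pairing x y.
    by move=> c x y; rewrite !pairing3 !mxE; ring.
  rewrite mulf_eq0 (negPf (O2n _ (BL p Bp)))/= pairing3 !crossE !rowE3 !(JL _ _ _ Bp)/=.
  have S (J : 'M[R]_3) (x y : R) j : (x *: row 0 J + y *: row 1 J) 0 j = x * J 0 j + y * J 1 j.
    by rewrite !mxE.
  move=> /eqP H; apply: rowP3; rewrite /a0 /a1 S !(JL _ _ _ Bp)/=; first by ring.
    by ring.
  move: ('D_(e_ 0) Z p) ('D_(e_ 1) Z p) H => x y H.
  by apply/eqP; rewrite -subr_eq0 -H; apply/eqP; ring.
have K0 := kill 0 (or_introl erefl); have K1 := kill 1 (or_intror erefl).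
rewrite ab; transitivity (a 0 0 * pairing (A (L p) + grad h (L p)) (a0 p)
  + a 0 1 * pairing (A (L p) + grad h (L p)) (a1 p)).
  by move: (A _ + _) (a0 p) (a1 p) => x y z; rewrite !pairing3 !mxE; ring.
by rewrite /a0 /a1 K0 K1 !mulr0 addr0.
Qed.

End Calculus.

(** * Solutions in coordinates *)

Section IntegrableForms.
Context {R : realType}.
Implicit Types (U : set 'rV[R]_3).

Lemma affine_jacobian (B : 'M[R]_3) (f : 'rV[R]_3 -> 'rV[R]_3) x :
  (forall y, f (y + x) = y *m B + f x) -> differentiable f x /\ 'J f x = B.
Proof.
move=> fB; have [df Df] : differentiable f x /\ forall v, 'D_v f x = v *m B.
  apply: differentiable_eps_mx => e e0.
  have H y : `|f (y + x) - f x - y *m B| <= e * `|y|.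
    by rewrite fB addrK subrr normr0 mulr_ge0// ltW.
  by apply: near_sub (near0_norm_lt _ ltr01) => y _; exact: H.
split=> //; apply/row_matrixP => i; apply: (etrans (row_jacobian i df)).
by rewrite Df rowE.
Qed.

Lemma pairingDl (x y z : 'rV[R]_3) : pairing (x + y) z = pairing x z + pairing y z.
Proof. by rewrite !pairing3 !mxE; ring. Qed.

Lemma pairingZl (c : R) (x y : 'rV[R]_3) : pairing (c *: x) y = c * pairing x y.
Proof. by rewrite !pairing3 !mxE; ring. Qed.

Lemma pairing_axial_congr (B F : 'M[R]_3) (k : 'rV[R]_3) : F^T = - F ->
  pairing (k *m B^T) (axial (B *m F *m B^T)) = \det B * pairing k (axial F).
Proof.
move=> aF; rewrite axial_congr// pairing_mul trmxK -[axial F *m _ *m B]mulmxA.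
by rewrite tr_cof_mul mul_mx_scalar pairingC pairingZl pairingC.
Qed.

(** Reduction to the normalized position: a translation moves u0 to the origin, and exchanging two
    coordinates makes the last component of th nonzero. Both conditions are preserved, being
    multiplied by the determinant of the linear part. *)
Lemma closed_on_leaves O (th A : 'rV[R]_3 -> 'rV[R]_3) u0 :
  open O -> O u0 -> smooth O th -> smooth O A -> th u0 != 0 ->
  (forall u, O u -> pairing (th u) (axial (extd th u)) = 0) ->
  (forall u, O u -> pairing (th u) (axial (extd A u)) = 0) ->
  exists V h, [/\ open V, V u0, V `<=` O & smooth V h] /\
    forall u a, V u -> pairing (th u) a = 0 -> pairing (A u + grad h u) a = 0.
Proof.
move=> oO O0 sth sA th0 fr cl.
have [k thk] : exists k, th u0 0 k != 0.
  apply: contra_notP (negP th0) => /forallNP h; apply/eqP/rowP => k.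
  by rewrite mxE; apply/eqP/negPn/negP/h.
pose T : 'M[R]_3 := tperm_mx k 2%:R.
have TT : T *m T = 1%:M by rewrite /T /tperm_mx -perm_mxM perm.tperm2 perm_mx1.
have Tt : T^T = T by rewrite /T /tperm_mx tr_perm_mx perm.tpermV.
pose L x : 'rV[R]_3 := x *m T + u0.
pose L' u : 'rV[R]_3 := (u - u0) *m T.
have LL' u : L (L' u) = u by rewrite /L /L' -mulmxA TT mulmx1 subrK.
have L'L u : L' (L u) = u by rewrite /L /L' addrK -mulmxA TT mulmx1.
have dJL x : differentiable L x /\ 'J L x = T.
  by apply: affine_jacobian => y; rewrite /L mulmxDl addrA.
have dJL' x : differentiable L' x /\ 'J L' x = T.
  by apply: affine_jacobian => y; rewrite /L' -addrA mulmxDl.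
have sL n : Ck n setT L.
  apply: CkD; [exact: openT| |exact: Ck_cst].
  by apply: Ck_mulmx; [exact: openT|exact: Ck_id|exact: Ck_cst].
have sL' n : Ck n setT L'.
  apply: Ck_mulmx; [exact: openT| |exact: Ck_cst].
  by apply: CkB; [exact: openT|exact: Ck_id|exact: Ck_cst].
have cL x : {for x, continuous L} by exact: (Ck_continuous (sL 0%N)).
have cL' x : {for x, continuous L'} by exact: (Ck_continuous (sL' 0%N)).
pose O1 := setT `&` L @^-1` O.
have oO1 : open O1 by exact: (open_preim openT oO (fun u _ => cL u)).
have O1O u : O1 u -> O (L u) by case.
have sL1 n : Ck n O1 L by exact: Ck_subset (sL n).
have L0 : L 0 = u0 by rewrite /L mul0mx add0r.
have O10 : O1 0 by split=> //=; rewrite L0.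
have s1 om : smooth O om -> smooth O1 (pull L om).
  by move=> som n; exact: (Ck_pull oO1 oO O1O (sL1 n.+1) (som n)).
have x1 om x : smooth O om -> O1 x ->
    pull L om x = om (L x) *m T^T /\ extd (pull L om) x = T *m extd om (L x) *m T^T.
  move=> som O1x; rewrite (extd_pull oO1 oO O1O (sL1 2) (som 1%N) O1x).
  by rewrite /pull (dJL x).2.
have th10 : pull L th 0 0 2%:R != 0.
  have -> : pull L th 0 = th u0 *m T by rewrite (x1 _ _ sth O10).1 L0 Tt.
  by rewrite /T -xcolE mxE perm.tpermR.
have fr1 u : O1 u -> pairing (pull L th u) (axial (extd (pull L th) u)) = 0.
  move=> O1u; have [-> ->] := x1 _ _ sth O1u.
  by rewrite pairing_axial_congr ?fr ?mulr0//; [exact: O1O|exact: extd_antisym].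
have cl1 u : O1 u -> pairing (pull L th u) (axial (extd (pull L A) u)) = 0.
  move=> O1u; have [-> _] := x1 _ _ sth O1u; have [_ ->] := x1 _ _ sA O1u.
  by rewrite pairing_axial_congr ?cl ?mulr0//; [exact: O1O|exact: extd_antisym].
have [V1 [h1 [[oV1 V10 V1O sh1] H1]]] :=
  closed_on_leaves_normal oO1 O10 (s1 _ sth) (s1 _ sA) th10 fr1 cl1.
pose V := setT `&` L' @^-1` V1.
have oV : open V by exact: (open_preim openT oV1 (fun u _ => cL' u)).
exists V, (fun u => h1 (L' u)); split.
  split=> //; first by split=> //=; rewrite -L0 L'L.
    by move=> u [_ /V1O/O1O]; rewrite LL'.
  move=> n; apply: (Ck_comp (@coordinatized_rV R 3) oV _ (sh1 n)); first by move=> x [].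
  exact: Ck_subset (sL' n).
move=> u a [_ V1u] tha; set x := L' u in V1u.
have O1x := V1O x V1u; have Lx : L x = u by exact: LL'.
have dh1 : differentiable h1 x by exact: (Ck_differentiable (sh1 1%N) V1u).
have -> : grad (fun u => h1 (L' u)) u = grad h1 x *m T^T.
  by rewrite (grad_comp (f := L') (h := h1) (dJL' u).1 dh1) (dJL' u).2.
have aT : a = a *m T *m T by rewrite -mulmxA TT mulmx1.
have := H1 x (a *m T) V1u.
have [-> _] := x1 _ _ sth O1x; have [-> _] := x1 _ _ sA O1x; rewrite Lx.
rewrite pairing_mul trmxK -aT => /(_ tha).
by rewrite {2}aT !pairingDl !pairing_mul !trmxK -aT.
Qed.

End IntegrableForms.

Section TargetAlgebra.
Context {R : realType}.
Implicit Types (n X k : 'rV[R]_3) (N J K L D g : 'M[R]_3).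

Lemma jacobian_mulmx (w : 'rV[R]_3) (X : 'rV[R]_3 -> 'rV[R]_3)
    (g : 'rV[R]_3 -> 'M[R]_3) y :
  differentiable X y -> differentiable g y -> differentiable (fun y => X y *m g y) y ->
  w *m 'J (fun y => X y *m g y) y = w *m 'J X y *m g y + X y *m 'D_w g y.
Proof.
move=> dX dg dXg; apply: (etrans (esym (derive_jacobian w dXg))).
apply: (etrans (derive_mulmx (diff_derivable dX) (diff_derivable dg))).
by congr (_ *m _ + _); exact: derive_jacobian.
Qed.

(** With J and N the Jacobians of X and n, the first hypothesis is L_n (X^flat) = 0 and the second
    L_n g = 0; nondegeneracy of g leaves [n, X] = 0. *)
Lemma bracket_algebra n X N J D g : g \in unitmx ->
  n *m J *m g + X *m D + X *m g *m N^T = 0 -> N *m g + D + g *m N^T = 0 ->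
  n *m J = X *m N.
Proof.
move=> ug h1 h2; have : X *m (N *m g + D + g *m N^T) = 0 by rewrite h2 mulmx0.
rewrite !mulmxDr !mulmxA -[RHS]h1 => /addIr/addIr.
by move=> /(congr1 (fun Y => Y *m invmx g)); rewrite !mulmxK.
Qed.

(** The formula dk(n, X) = n(k(X)) - X(k(n)) - k([n, X]): the first two hypotheses differentiate
    k(X) = 0 and k(n) = 0, the third says that the bracket vanishes. *)
Lemma bracket_pairing n X k N J K : X *m J^T + k *m K^T = 0 ->
  n *m J^T + k *m N^T = 0 -> n *m K = X *m N -> bil (J - J^T) n X = 0.
Proof.
move=> /(congr1 (fun v => pairing v n)) h1 /(congr1 (fun v => pairing v X)) h2 h3.
have p0 (v : 'rV[R]_3) : pairing 0 v = 0 by rewrite /pairing mul0mx mxE.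
move: h1 h2; rewrite /= !pairingDl !p0 !pairing_mul !trmxK h3 => h1 h2.
have -> : bil (J - J^T) n X = pairing X (n *m J) - pairing n (X *m J).
  rewrite /bil mulmxBr mulmxBl.
  rewrite [LHS]mxE [X in _ + X]mxE -/(pairing (n *m J) X) -/(pairing (n *m J^T) X).
  by rewrite (pairingC (n *m J)) pairing_mul trmxK.
by move: h1 h2; set a := pairing X _; set b := pairing n _; lra.
Qed.

End TargetAlgebra.

(** * The Killing field and the moment map in a chart of the target *)

Section Target.
Context {R : realType}.
Variables (O : set 'rV[R]_3) (g : 'rV[R]_3 -> 'M[R]_3) (m n : 'rV[R]_3 -> 'rV[R]_3).
Hypotheses (oO : open O) (sg : smooth O g) (sm : smooth O m) (sn : smooth O n).
Hypothesis pg : forall y, O y -> posdef (g y).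
Hypothesis dm : forall y, O y -> axial (extd m y) = rdet (g y) *: n y.
Hypothesis mn : forall y, O y -> pairing (m y) (n y) = 0.
Hypothesis killing : forall y, O y ->
  'J n y *m g y + 'D_(n y) g y + g y *m ('J n y)^T = 0.

Let msharp y := sharp (g y) (m y).
Let df (V W : normedModType R) (U : set V) (h : V -> W) x : smooth U h -> U x -> differentiable h x.
Proof. by move=> sh Ux; exact: (Ck_differentiable (sh 1%N) Ux). Qed.

Lemma near_eq_grad (h : 'rV[R]_3 -> R) y : (\near y, h y = 0) -> grad h y = 0.
Proof.
move=> h0; apply/rowP => i; rewrite !mxE.
have -> : 'D_(e_ i) h y = 'D_(e_ i) (fun=> 0 : R) y by exact: near_eq_derive.
exact: derive_cst.
Qed.

Lemma grad_pairing0 (x y : 'rV[R]_3 -> 'rV[R]_3) u : O u -> smooth O x -> smooth O y ->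
  (forall u, O u -> pairing (x u) (y u) = 0) ->
  y u *m ('J x u)^T + x u *m ('J y u)^T = 0.
Proof.
move=> Ou sx sy xy; rewrite -grad_pairing; [|exact: df sx Ou|exact: df sy Ou].
by apply: near_eq_grad; have := open_near oO Ou; apply: near_sub => v /xy.
Qed.

(** Cartan's formula for L_n m: the form dm = iota_n V is annihilated by n, and m(n) = 0. *)
Lemma lie_moment y : O y -> n y *m 'J m y + m y *m ('J n y)^T = 0.
Proof.
move=> Oy; have h := grad_pairing0 Oy sm sn mn.
have : n y *m extd m y = 0.
  rewrite mul_antisym ?extd_antisym// dm//.
  by apply: rowP3; rewrite !mxE/=; ring.
by rewrite /extd mulmxBr => /subr0_eq ->.
Qed.

Lemma smooth_msharp : smooth O msharp.
Proof.
move=> k; apply: Ck_mulmx => //.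
by apply: Ck_invmx => // y Oy; exact: posdef_unit (pg Oy).
Qed.

(** The field n commutes with m^sharp, because its flow preserves both m and the metric. *)
Lemma lie_msharp y : O y -> n y *m 'J msharp y = msharp y *m 'J n y.
Proof.
move=> Oy; have ug := posdef_unit (pg Oy); have dX := df smooth_msharp Oy.
have dg := df sg Oy.
have mE : {near y, (fun y => msharp y *m g y) =1 m}.
  have := open_near oO Oy; apply: near_sub => z Oz.
  by rewrite /msharp /sharp mulmxKV// posdef_unit//; exact: pg.
have dXg : differentiable (fun y => msharp y *m g y) y.
  have sXg : smooth O (fun y => msharp y *m g y) by move=> k; exact: (Ck_mulmx oO (smooth_msharp k) (sg k)).
  exact: df sXg Oy.
apply: (bracket_algebra ug _ (killing Oy)).
rewrite -(jacobian_mulmx (n y) dX dg dXg) (near_eq_jacobian mE dXg).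
have -> : msharp y *m g y = m y by rewrite /msharp /sharp mulmxKV.
exact: lie_moment.
Qed.

(* Its kernel is spanned by nu and mu^sharp, which commute. *)
Definition leaf_form y := cross (n y) (msharp y).

Lemma smooth_cross k (V : normedModType R) (U : set V) (v w : V -> 'rV[R]_3) : open U ->
  Ck k U v -> Ck k U w -> Ck k U (fun x => cross (v x) (w x)).
Proof.
move=> oU cv cw; apply/(Ck_mxP _ _ oU) => i j.
have c (h : V -> 'rV[R]_3) a : Ck k U h -> Ck k U (fun x => h x 0 a).
  by move=> /(Ck_mxP _ _ oU); apply.
rewrite ord1; move: j; apply: forall3.
- apply: (@Ck_ext _ _ _ _ _ (fun x => v x 0 1 * w x 0 2%:R - v x 0 2%:R * w x 0 1)) => //.
    by move=> x _; rewrite crossE.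
  by apply: CkB => //; apply: CkM => //; exact: c.
- apply: (@Ck_ext _ _ _ _ _ (fun x => v x 0 2%:R * w x 0 0 - v x 0 0 * w x 0 2%:R)) => //.
    by move=> x _; rewrite crossE.
  by apply: CkB => //; apply: CkM => //; exact: c.
- apply: (@Ck_ext _ _ _ _ _ (fun x => v x 0 0 * w x 0 1 - v x 0 1 * w x 0 0)) => //.
    by move=> x _; rewrite crossE.
  by apply: CkB => //; apply: CkM => //; exact: c.
Qed.

Lemma cross_perpl (v w : 'rV[R]_3) : pairing (cross v w) v = 0.
Proof. by rewrite pairing3 !crossE; ring. Qed.

Lemma cross_perpr (v w : 'rV[R]_3) : pairing (cross v w) w = 0.
Proof. by rewrite pairing3 !crossE; ring. Qed.

Lemma leaf_form_integrable y : O y ->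
  pairing (leaf_form y) (axial (extd leaf_form y)) = 0.
Proof.
move=> Oy; have sX := smooth_msharp.
have sk : smooth O leaf_form by move=> k; apply: smooth_cross.
rewrite {1}/leaf_form -bil_axial ?extd_antisym//.
have h1 := grad_pairing0 Oy sk sX (fun u _ => cross_perpr _ _).
have h2 := grad_pairing0 Oy sk sn (fun u _ => cross_perpl _ _).
exact: (bracket_pairing h1 h2 (lie_msharp Oy)).
Qed.

Let b y := n y *m g y.
Let q y := pairing (n y) (b y).

(** The form b dual to n is invariant by the Killing equation, so Cartan's formula gives iota_n db =
    - d(b(n)). *)
Lemma lie_dual_killing y : O y -> n y *m extd b y = - grad q y.
Proof.
move=> Oy; have dn := df sn Oy; have dg := df sg Oy.
have sb : smooth O b by move=> k; apply: Ck_mulmx.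
have db := df sb Oy.
have e1 : n y *m 'J b y = n y *m 'J n y *m g y + n y *m 'D_(n y) g y.
  exact: (jacobian_mulmx (n y) dn dg db).
have e2 : n y *m 'J b y = - (b y *m ('J n y)^T).
  apply: (etrans e1); apply/eqP; rewrite -addr_eq0; apply/eqP.
  by rewrite /b -!mulmxA -!mulmxDr killing// mulmx0.
have -> : grad q y = b y *m ('J n y)^T + n y *m ('J b y)^T by exact: grad_pairing.
by rewrite /extd mulmxBr e2 opprD.
Qed.

Lemma killing_norm_invariant y : O y -> pairing (n y) (grad q y) = 0.
Proof.
move=> Oy; have := cross_perpr (axial (extd b y)) (n y).
rewrite -mul_antisym ?extd_antisym// lie_dual_killing//.
move: (grad q y) => z h; rewrite pairingC; move: h; rewrite !pairing3 !mxE; lra.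
Qed.

End Target.

(** * Algebra at points where the covariant differential is singular *)

Section SingularAlgebra.
Context {R : realType}.
Implicit Types (m n w : 'rV[R]_3) (E F gM gN B : 'M[R]_3).

Lemma cof_mul_row (f v : 'rV[R]_3) : cof (f^T *m v) = 0.
Proof.
have fE (i j : 'I_3) : (f^T *m v) i j = f 0 i * v 0 j by rewrite !mxE big_ord1 !mxE.
apply: matrixP3 => i j; rewrite [RHS]mxE; move: i j; apply: forall3; apply: forall3.
all: by rewrite !cofE !fE; ring.
Qed.

(** The rows of E lie in the plane orthogonal to b, so the cross product of any two of them is a
    multiple of b. *)
Lemma cof_annihilated E (b : 'rV[R]_3) : b != 0 -> b *m E^T = 0 ->
  exists a : 'rV[R]_3, cof E = a^T *m b.
Proof.
move=> b0 bE.
have bb : pairing b b != 0.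
  apply: contraNneq b0 => h; rewrite row_eq0; move: h; rewrite pairing3 => h.
  have p (x : R) : 0 <= x * x by rewrite -expr2 sqr_ge0.
  have := p (b 0 0); have := p (b 0 1); have := p (b 0 2%:R) => h2 h1 h0.
  have z (x : R) : x * x = 0 -> x == 0 by move=> /eqP; rewrite mulf_eq0 orbb.
  by apply/and3P; split; apply: z; lra.
have br i : pairing b (row i E) = 0.
  by have := congr1 (fun X : 'rV[R]_3 => X 0 i) bE; rewrite pairing3 mulmx3 !mxE.
have par x y : pairing b x = 0 -> pairing b y = 0 ->
    pairing b b *: cross x y = pairing b (cross x y) *: b.
  move=> bx by0; have h : cross (cross x y) b = 0.
    have := cross_triple b x y; rewrite bx by0 !scale0r subr0 => /rowP h.
    apply: rowP3; move: (h 0) (h 1) (h 2%:R); rewrite !crossE !mxE/=; lra.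
  have := cross_triple b (cross x y) b; rewrite h.
  have -> : cross b 0 = 0 by apply: rowP3; rewrite !mxE/=; ring.
  by move=> /esym/subr0_eq.
exists ((pairing b b)^-1 *: (b *m (cof E)^T)).
apply: (scalerI bb); rewrite linearZ/= -scalemxAl scalerA mulfV// scale1r trmx_mul trmxK.
apply/row_matrixP => i; rewrite linearZ/= -mulmxA row_mul.
have cE : exists x y, row i (cof E) = cross x y /\ (pairing b x = 0 /\ pairing b y = 0).
  move: i; apply: forall3.
  - by exists (row 1 E), (row 2%:R E); split; [apply/rowP => j; rewrite !mxE|].
  - by exists (row 2%:R E), (row 0 E); split; [apply/rowP => j; rewrite !mxE|].
  - by exists (row 0 E), (row 1 E); split; [apply/rowP => j; rewrite !mxE|].
have [x [y [-> [bx by0]]]] := cE; rewrite (par x y bx by0) mulmxA.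
rewrite (_ : cross x y *m b^T = (pairing b (cross x y))%:M) ?mul_scalar_mx//.
by apply/matrixP => k l; rewrite !ord1 [RHS]mxE eqxx mulr1n pairingC.
Qed.

(** Writing cof E = a^T b with b = n^flat makes f a multiple of a, so the right-hand side of the
    equation is an outer product with first factor a^T. Then E is an outer product too, its
    cofactors vanish, and so does f. *)
Lemma bps1_singular_flat gM gN m n E F w : posdef gM -> posdef gN -> n != 0 ->
  n *m gN *m E^T = 0 -> bps1_mx gM gN m E F -> axial F = w *m (cof E)^T ->
  axial F = 0.
Proof.
move=> pM pN n0 nE H fw; have uM := posdef_unit pM; have uN := posdef_unit pN.
have b0 : n *m gN != 0.
  by apply: contraNneq n0 => h; rewrite -(mulmxK uN n) h mul0mx.
have [a aE] := cof_annihilated b0 nE; set b := n *m gN in aE.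
have fa : axial F = pairing w b *: a.
  rewrite fw aE trmx_mul trmxK mulmxA.
  rewrite (_ : w *m b^T = (pairing w b)%:M) ?mul_scalar_mx//.
  by apply/matrixP => k l; rewrite !ord1 [RHS]mxE eqxx mulr1n.
have rE : rdet gM *: (invmx gM *m E *m gN) =
    a^T *m (rdet gN *: b + (3 * pairing w b) *: m).
  by rewrite H aE fa linearZ/= -scalemxAl mulmxDr -!scalemxAr scalerA.
set v := _ + _ in rE.
have EE : E = (a *m gM^T)^T *m ((rdet gM)^-1 *: (v *m invmx gN)).
  rewrite trmx_mul trmxK -scalemxAr -!mulmxA (mulmxA a^T) -rE -scalemxAl -scalemxAr.
  rewrite scalerA mulVf ?gt_eqF ?rdet_gt0// scale1r -!mulmxA mulmxV// mulmx1.
  by rewrite mulmxA mulmxV// mul1mx.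
by rewrite fw EE cof_mul_row trmx0 mulmx0.
Qed.

(** The long equation is the exterior derivative of phi^*(nu^flat) = q A, with B = d nu^flat.
    Expanding its left-hand side with n B = - gq reproduces the terms dq /\ A on the right, and E B
    E^T = q F remains. *)
Lemma singular_curvature n b a gq E F B (q : R) : B^T = - B -> n *m B = - gq ->
  pairing n gq = 0 ->
  (E + a^T *m n) *m B *m (E + a^T *m n)^T =
    (gq *m (E + a^T *m n)^T)^T *m a - a^T *m (gq *m (E + a^T *m n)^T) + q *: F ->
  b = axial B -> q *: axial F = b *m (cof E)^T.
Proof.
move=> aB nB ngq H ->.
have Bn : B *m n^T = gq^T.
  by rewrite -[LHS]trmxK trmx_mul trmxK aB mulmxN nB opprK.
have gn : gq *m n^T = 0.
  by apply/matrixP => i j; rewrite !ord1 [RHS]mxE -[LHS]/(pairing gq n) pairingC.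
have EBE : E *m B *m E^T = q *: F.
  move: H; have -> : gq *m (E + a^T *m n)^T = gq *m E^T.
    by rewrite linearD/= mulmxDr trmx_mul trmxK mulmxA gn mul0mx addr0.
  rewrite linearD/= trmx_mul trmxK mulmxDl mulmxDr !mulmxDl -!(mulmxA a^T) nB.
  have -> : E *m B *m (n^T *m a) = E *m gq^T *m a by rewrite mulmxA -(mulmxA E) Bn.
  have -> : - gq *m (n^T *m a) = 0 by rewrite mulNmx mulmxA gn mul0mx oppr0.
  rewrite mulmx0 addr0 mulNmx mulmxN trmx_mul trmxK.
  move: (E *m B *m E^T) (a^T *m _) (E *m gq^T *m a) (q *: F) => X Y Z W /matrixP h.
  by apply/matrixP => i j; have := h i j; rewrite !mxE; lra.
rewrite -axial_congr// EBE; apply/rowP => i; rewrite !mxE.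
by move: i; apply: forall3.
Qed.

End SingularAlgebra.

Section LocalSolutions.
Context {R : realType}.
Variables (ON : set 'rV[R]_3) (g : 'rV[R]_3 -> 'M[R]_3) (m n : 'rV[R]_3 -> 'rV[R]_3).
Hypotheses (oN : open ON) (sg : smooth ON g) (sm : smooth ON m) (sn : smooth ON n).
Hypothesis pg : forall y, ON y -> posdef (g y).
Hypothesis dm : forall y, ON y -> axial (extd m y) = rdet (g y) *: n y.
Hypothesis mn : forall y, ON y -> pairing (m y) (n y) = 0.
Hypothesis killing : forall y, ON y ->
  'J n y *m g y + 'D_(n y) g y + g y *m ('J n y)^T = 0.

Variables (O : set 'rV[R]_3) (f A : 'rV[R]_3 -> 'rV[R]_3) (G : 'rV[R]_3 -> 'M[R]_3).
Hypotheses (oO : open O) (ff : forall u, O u -> ON (f u)).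
Hypotheses (sf : smooth O f) (sA : smooth O A).
Hypothesis pG : forall u, O u -> posdef (G u).

Definition covariant_jacobian u : 'M[R]_3 := 'J f u - (A u)^T *m n (f u).
Let E := covariant_jacobian.
Let F := extd A.

Hypothesis bps : forall u, O u -> bps1_mx (G u) (g (f u)) (m (f u)) (E u) (F u).

Let s_f (h : 'rV[R]_3 -> 'rV[R]_3) : smooth ON h -> smooth O (fun u => h (f u)).
Proof. by move=> sh k; exact: (Ck_comp_mx (@coordinatized_rV R 3) oO oN ff (sh k) (sf k)). Qed.

Let sE : smooth O E.
Proof.
move=> k; apply: (CkB oO); first exact: (Ck_jacobian oO (sf k.+1)).
exact: (Ck_mulmx oO (Ck_trmx oO (sA k)) (s_f sn k)).
Qed.

Let open_row_neq0 (h : 'rV[R]_3 -> 'rV[R]_3) U : open U -> U `<=` O -> smooth O h ->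
  open (U `&` [set u | h u != 0]).
Proof.
move=> oU UO sh.
have -> : U `&` [set u | h u != 0] = U `&` [set u | pairing (h u) (h u) != 0].
  apply/seteqP; split=> u [Uu /= h0]; split=> //=.
    rewrite pairing3 gt_eqF// -!expr2.
    move: h0; rewrite row_eq0 !negb_and => /or3P[] h0.
    - by rewrite ltr_wpDr ?sqr_ge0// ltr_wpDr ?sqr_ge0// exprn_even_gt0.
    - by rewrite ltr_wpDr ?sqr_ge0// ltr_wpDl ?sqr_ge0// exprn_even_gt0.
    - by rewrite ltr_wpDl ?addr_ge0 ?sqr_ge0// exprn_even_gt0.
  by apply: contraNneq h0 => ->; rewrite pairing3 !mxE !mul0r !addr0.
apply: open_neq0 => // u Uu.
have c : Ck 0 O (fun u => (h u *m (h u)^T) 0 0).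
  exact: ((Ck_mxP _ _ oO).1 (Ck_mulmx oO (sh 0%N) (Ck_trmx oO (sh 0%N))) 0 0).
exact: (Ck_continuous c (UO u Uu)).
Qed.

Let open_unit U : open U -> U `<=` O -> open (U `&` [set u | E u \in unitmx]).
Proof.
move=> oU UO.
have -> : U `&` [set u | E u \in unitmx] = U `&` [set u | \det (E u) != 0].
  by apply/seteqP; split=> u [Uu /= h0]; split=> //=; move: h0; rewrite unitmxE unitfE.
apply: open_neq0 => // u Uu; exact: (Ck_continuous (Ck_det oO (sE 0%N)) (UO u Uu)).
Qed.

Let JE u : 'J f u = E u + (A u)^T *m n (f u).
Proof. by rewrite /E /covariant_jacobian subrK. Qed.

Let pg' u (Ou : O u) := pg (ff Ou).

Let sF : smooth O (fun u => axial (F u)).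
Proof.
move=> k; apply/(Ck_mxP _ _ oO) => i j; rewrite ord1.
have c a b : Ck k O (fun u => F u a b) by apply: (Ck_mxP _ _ oO).1; exact: (Ck_extd oO (sA k.+1)).
move: j; apply: forall3.
- by apply: (Ck_ext oO _ (c 1 2%:R)) => u _; rewrite [RHS]mxE.
- by apply: (Ck_ext oO _ (c 2%:R 0)) => u _; rewrite [RHS]mxE.
- by apply: (Ck_ext oO _ (c 0 1)) => u _; rewrite [RHS]mxE.
Qed.

(** The image of U under f need not be open, so the derivative of m at f(u) is not obviously zero.
    The chain rule kills it on the image of df and invariance of m along n; together on the image of
    E, which is everything. *)
Lemma moment_vanishing U u : open U -> U `<=` O -> U u ->
  (forall z, U z -> m (f z) = 0) -> E u \in unitmx -> n (f u) = 0.
Proof.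
move=> oU UO Uu m0 uE; have Ou := UO u Uu; have Ofu := ff Ou.
have dmf : differentiable m (f u) by exact: (Ck_differentiable (sm 1%N) Ofu).
have df : differentiable f u by exact: (Ck_differentiable (sf 1%N) Ou).
have J0 : 'J f u *m 'J m (f u) = 0.
  have c0 : {near u, (fun=> 0) =1 m \o f}.
    by have := open_near oU Uu; apply: near_sub => z Uz; rewrite /= m0.
  rewrite -(jacobian_comp df dmf).
  have dc : differentiable (fun=> 0 : 'rV[R]_3) u by exact: differentiable_cst.
  rewrite -(near_eq_jacobian c0 dc); apply/row_matrixP => i.
  by apply: (etrans (row_jacobian i dc)); rewrite derive_cst row0.
have := lie_moment oN sm sn dm mn Ofu; rewrite (m0 u Uu) mul0mx addr0 => nJ.
move: J0; rewrite JE mulmxDl -mulmxA nJ mulmx0 addr0 => EJ.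
have J1 : 'J m (f u) = 0 by rewrite -[LHS](mulKmx uE) EJ mulmx0.
have := dm Ofu; rewrite /extd J1 trmx0 subr0.
have -> : axial 0 = 0 :> 'rV[R]_3 by apply: rowP3; rewrite !mxE.
by move=> /esym/eqP; rewrite scaler_eq0 gt_eqF ?rdet_gt0//=; [move=> /eqP|exact: pg].
Qed.

(* If d^A phi is singular, its image is orthogonal to nu, so that the pullback of
   nu^flat is |nu|^2 A; its exterior derivative expresses F through the cofactors
   of d^A phi, and the BPS equation then makes these vanish. *)
Lemma curved_not_singular U u : open U -> U `<=` O -> U u ->
  (forall z, U z -> n (f z) *m g (f z) *m (E z)^T = 0) -> n (f u) != 0 -> F u = 0.
Proof.
move=> oU UO Uu nE n0; have Ou := UO u Uu; have Ofu := ff Ou.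
pose b y := n y *m g y; pose q y := pairing (n y) (b y).
have sb : smooth ON b by move=> k; exact: (Ck_mulmx oN (sn k) (sg k)).
have sq : smooth ON q.
  move=> k; exact: ((Ck_mxP _ _ oN).1 (Ck_mulmx oN (sn k) (Ck_trmx oN (sb k))) 0 0).
have df : differentiable f u by exact: (Ck_differentiable (sf 1%N) Ou).
have dq : differentiable q (f u) by exact: (Ck_differentiable (sq 1%N) Ofu).
have dA : differentiable A u by exact: (Ck_differentiable (sA 1%N) Ou).
have dqf : differentiable (q \o f) u by exact: differentiable_comp.
have pE z : U z -> pull f b z = (q \o f) z *: A z.
  move=> Uz; rewrite /pull JE linearD/= mulmxDr trmx_mul trmxK [b (f z) *m (E z)^T]nE//.
  rewrite add0r mulmxA (_ : b (f z) *m (n (f z))^T = (q (f z))%:M) ?mul_scalar_mx//.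
  by apply/matrixP => i j; rewrite !ord1 [RHS]mxE eqxx mulr1n /q pairingC.
have dp : differentiable (pull f b) u.
  by exact: (Ck_differentiable (Ck_pull oO oN ff (sf 2) (sb 1%N)) Ou).
have nearp : {near u, pull f b =1 (fun z => (q \o f) z *: A z)}.
  by have := open_near oU Uu; apply: near_sub => z Uz; exact: pE.
have e1 : extd (pull f b) u = extd (fun z => (q \o f) z *: A z) u.
  by rewrite /extd (near_eq_jacobian nearp dp).
move: e1; rewrite (extd_scale dqf dA) (extd_pull oO oN ff (sf 2) (sb 1%N) Ou).
rewrite (grad_comp df dq) JE => e1.
have aB := extd_antisym b (f u).
have nB := lie_dual_killing oN sg sn killing Ofu.
have nq := killing_norm_invariant oN sg sn killing Ofu.
have := singular_curvature aB nB nq e1 erefl.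
have q0 : 0 < q (f u).
  rewrite /q /b pairingC; exact: (pg' Ou).2.
move=> /(congr1 (fun v => (q (f u))^-1 *: v)); rewrite /= scalerA mulVf ?gt_eqF//.
rewrite scale1r scalemxAl => fE.
apply: (axial_inj (extd_antisym A u)).
exact: (bps1_singular_flat (pG Ou) (pg' Ou) n0 (nE u Uu) (bps Ou) fE).
Qed.

(** By contradiction on an open set where F and nu do not vanish. If E is invertible at some point,
    it is so nearby, where mu then vanishes and [moment_vanishing] applies; otherwise E is singular
    throughout and F is zero. *)
Lemma near_regular U u : open U -> U `<=` O -> U u -> F u != 0 -> n (f u) != 0 ->
  exists2 z, U z & [/\ F z != 0, n (f z) != 0, m (f z) != 0 & E z \in unitmx].
Proof.
move=> oU UO Uu Fu nu0; apply: contrapT => /forall2NP none.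
pose O0 := U `&` [set z | axial (F z) != 0].
have oO0 : open O0 by exact: (open_row_neq0 oU UO sF).
have O0O : O0 `<=` O by move=> z [/UO].
pose O1 := O0 `&` [set z | n (f z) != 0].
have oO1 : open O1 by exact: (open_row_neq0 oO0 O0O (s_f sn)).
have O1O : O1 `<=` O by move=> z [/O0O].
have F0 z : O z -> (axial (F z) != 0) = (F z != 0).
  move=> Oz; apply/idP/idP.
    by apply: contraNneq => ->; apply/eqP/rowP3; rewrite !mxE.
  by apply: contraNneq => /(axial_inj (extd_antisym A z)) h; apply/eqP.
have O1u : O1 u by split=> //; split=> //=; rewrite F0//; exact: UO.
have none1 z : O1 z -> m (f z) != 0 -> E z \notin unitmx.
  move=> [[Uz /=] ]; rewrite F0; last exact: UO.
  by move=> Fz nz mz; apply/negP => uE; case: (none z) => // h; apply: h.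
have [ez|nz] := pselect (exists z, O1 z /\ E z \in unitmx).
  have [z [zO1 uz]] := ez.
  pose O2 := O1 `&` [set z | E z \in unitmx].
  have oO2 : open O2 by exact: (open_unit oO1 O1O).
  have m0 y : O2 y -> m (f y) = 0.
    by move=> [yO1 uy]; apply/eqP; apply: contraTT uy; exact: none1.
  have O2O : O2 `<=` O by move=> y [/O1O].
  have := moment_vanishing oO2 O2O (conj zO1 uz) m0 uz.
  by move=> h; case: zO1 => _ /=; rewrite h eqxx.
have sing z : O1 z -> n (f z) *m g (f z) *m (E z)^T = 0.
  move=> O1z; have Oz := O1O z O1z.
  apply: (bps1_singular (pG Oz) (pg' Oz) (mn (ff Oz)) (bps Oz)).
  apply/eqP; apply: contra_notT nz => dE; exists z; split=> //.
  by rewrite unitmxE unitfE.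
have /eqP := curved_not_singular oO1 O1O O1u sing nu0.
by rewrite (negPf Fu).
Qed.

Lemma regular_gauge u0 : O u0 -> n (f u0) != 0 -> m (f u0) != 0 -> E u0 \in unitmx ->
  exists V h, [/\ open V, V u0, V `<=` O & smooth V h] /\
    forall u, V u -> [/\ n (f u) != 0, m (f u) != 0, E u \in unitmx,
      pairing (A u + grad h u) (n (f u) *m invmx (E u)) = 0 &
      pairing (A u + grad h u) (sharp (g (f u)) (m (f u)) *m invmx (E u)) = 0].
Proof.
move=> Ou0 n0 m0 uE0.
pose O0 := O `&` [set z | n (f z) != 0].
have oO0 : open O0 by exact: (open_row_neq0 oO _ (s_f sn)).
have O0O : O0 `<=` O by move=> z [].
pose O1 := O0 `&` [set z | m (f z) != 0].
have oO1 : open O1 by exact: (open_row_neq0 oO0 O0O (s_f sm)).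
have O1O : O1 `<=` O by move=> z [/O0O].
pose W := O1 `&` [set z | E z \in unitmx].
have oW : open W by exact: (open_unit oO1 O1O).
have WO : W `<=` O by move=> z [/O1O].
have W0 : W u0 by [].
pose k := leaf_form g m n; pose X y := sharp (g y) (m y).
have sX : smooth ON X by exact: smooth_msharp.
have sk : smooth ON k by move=> j; exact: (smooth_cross oN (sn j) (sX j)).
have Wf u : W u -> ON (f u) by move=> /WO/ff.
have sth : smooth W (pull f k).
  by move=> j; exact: (Ck_pull oW oN Wf (Ck_subset WO (sf j.+1)) (sk j)).
have kn y : pairing (k y) (n y) = 0 by exact: cross_perpl.
have kX y : pairing (k y) (X y) = 0 by exact: cross_perpr.
(* The form k kills n, so its pullbacks by df and by E agree; its kernel is E^-1 of the span of n
   and m^sharp. *)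
have thE u : pull f k u = k (f u) *m (E u)^T.
  rewrite /pull JE linearD/= mulmxDr trmx_mul trmxK mulmxA.
  rewrite (_ : k (f u) *m (n (f u))^T = 0) ?mul0mx ?addr0//.
  by apply/matrixP => i j; rewrite !ord1 [RHS]mxE; exact: kn.
have th0 : pull f k u0 != 0.
  rewrite thE; apply: contraNneq n0 => h.
  have k0 : k (f u0) = 0.
    have uT : (E u0)^T \in unitmx by rewrite unitmx_tr.
    by rewrite -[LHS](mulmxK uT) h mul0mx.
  have := cross_triple (m (f u0)) (n (f u0)) (X (f u0)); rewrite -[cross (n _) _]/(k (f u0)) k0.
  have -> : cross (m (f u0)) 0 = 0 by apply: rowP3; rewrite !mxE/=; ring.
  rewrite (mn (ff Ou0)) scale0r subr0 => /esym/eqP; rewrite scaler_eq0.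
  by rewrite gt_eqF//; apply: sharp_gt0 => //; exact: pg'.
have fr u : W u -> pairing (pull f k u) (axial (extd (pull f k) u)) = 0.
  move=> Wu; rewrite (extd_pull oW oN Wf (Ck_subset WO (sf 2)) (sk 1%N) Wu).
  rewrite /pull pairing_axial_congr ?extd_antisym//.
  rewrite (leaf_form_integrable oN sg sm sn pg dm mn killing (Wf u Wu)).
  by rewrite mulr0.
(* The coefficient of th /\ dA is det E times F on the two spanning vectors of the plane, and F
   annihilates the one that corresponds to m^sharp. *)
have cl u : W u -> pairing (pull f k u) (axial (extd A u)) = 0.
  move=> Wu; have Ou := WO u Wu; have [[[_ nu0] mu0] uE] := Wu.
  have dE := bps1_det_gt0 (pG Ou) (pg' Ou) (mn (ff Ou)) (bps Ou) nu0 uE.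
  have [XF _] := (bps1_standard (pG Ou) (pg' Ou) mu0 dE (extd_antisym A u)).1 (bps Ou).
  have XF0 : X (f u) *m invmx (E u) *m F u = 0.
    move: XF; rewrite /flatten_curv !mulmxA => XF.
    have uT : (invmx (E u))^T \in unitmx by rewrite unitmx_tr unitmx_inv.
    by rewrite -[LHS](mulmxK uT) XF mul0mx.
  have dE0 : \det (E u) != 0 by rewrite gt_eqF.
  have -> : pull f k u = \det (E u) *: cross (n (f u) *m invmx (E u)) (X (f u) *m invmx (E u)).
    rewrite cross_mul thE cof_unit ?unitmx_inv// det_inv invmxK -scalemxAr scalerA.
    by rewrite mulfV// scale1r.
  rewrite pairingZl -bil_axial ?extd_antisym//.
  have bs (B : 'M[R]_3) (v w : 'rV[R]_3) : B^T = - B -> w *m B = 0 -> bil B v w = 0.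
    move=> aB wB; rewrite /bil -mulmxA -[B *m w^T]trmxK trmx_mul trmxK aB mulmxN wB.
    by rewrite oppr0 trmx0 mulmx0 mxE.
  by rewrite bs ?mulr0// extd_antisym.
have sAW : smooth W A by move=> j; exact: Ck_subset WO (sA j).
have [V [h [[oV V0 VW sh] Vh]]] := closed_on_leaves oW W0 sth sAW th0 fr cl.
exists V, h; split; first by split=> //; move=> u /VW/WO.
move=> u Vu; have [[[_ nu0] mu0] uE] := VW u Vu.
have kill (x : 'rV[R]_3) : pairing (k (f u)) x = 0 ->
    pairing (A u + grad h u) (x *m invmx (E u)) = 0.
  move=> kx; apply: Vh => //; rewrite thE pairing_mul trmxK -mulmxA mulVmx//.
  by rewrite mulmx1.
by split=> //; apply: kill; [exact: kn|exact: kX].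
Qed.

End LocalSolutions.

(** * Manifolds and actions *)

Section ManifoldCalculus.
Context {R : realType}.

Definition img (M : manifold3 R) (c : chart M) : set 'rV[R]_3 := coord c @` dom c.

Lemma img_open (M : manifold3 R) (c : chart M) : open (img c).
Proof. exact: image_open. Qed.

Lemma img_coord (M : manifold3 R) (c : chart M) x : dom c x -> img c (coord c x).
Proof. by exists x. Qed.

Lemma coord_point (M : manifold3 R) (c : chart M) u : img c u -> coord c (point c u) = u.
Proof. by move=> [x dx <-]; rewrite coordK. Qed.

Lemma dom_point (M : manifold3 R) (c : chart M) u : img c u -> dom c (point c u).
Proof. by move=> [x dx <-]; rewrite coordK. Qed.

Lemma image_coordP (M : manifold3 R) (c : chart M) (U : set M) u :
  (coord c @` (U `&` dom c)) u <-> img c u /\ U (point c u).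
Proof.
split=> [[x [Ux dx] <-]|[iu Uu]]; first by split; [exact: img_coord|rewrite coordK].
by exists (point c u); [split=> //; exact: dom_point|exact: coord_point].
Qed.

Lemma near_setI (T : topologicalType) (x : T) (P Q : set T) : nbhs x P -> nbhs x Q ->
  nbhs x (P `&` Q).
Proof. exact: filterI. Qed.

Lemma pair_continuous (T U V : topologicalType) (f : T -> U) (g : T -> V) x :
  {for x, continuous f} -> {for x, continuous g} ->
  {for x, continuous (fun z => (f z, g z))}.
Proof.
move=> cf cg B [[P Q] /= [aP bQ] PQ].
have h1 : nbhs x (f @^-1` P) := cf _ aP.
have h2 : nbhs x (g @^-1` Q) := cg _ bQ.
by apply: filterS (filterI h1 h2) => z [? ?]; exact: PQ.
Qed.

Lemma open_coord_image (M : manifold3 R) (c : chart M) (U : set M) : open U ->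
  open (coord c @` (U `&` dom c)).
Proof.
move=> oU; rewrite openE => u /image_coordP[iu Uu].
have h1 : nbhs u (img c) by exact: open_near (@img_open _ c) iu.
have h2 : nbhs u (point c @^-1` U).
  by apply: (point_continuous iu); exact: open_nbhs_nbhs.
by move: (near_and h1 h2); apply: near_sub => v hv; apply/image_coordP.
Qed.

Lemma near_point (M : manifold3 R) (c : chart M) (x : M) (P : set M) : dom c x ->
  nbhs x P -> \forall u \near coord c x, img c u /\ P (point c u).
Proof.
move=> dx Px; apply: near_and; first exact: open_near (@img_open _ c) (img_coord dx).
by apply: (point_continuous (img_coord dx)); rewrite /= coordK.
Qed.

Definition differentiable_at (M N : manifold3 R) (f : M -> N) (c : chart M) (d : chart N)
  (x : M) : Prop := differentiable (local_rep f c d) (coord c x).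

Lemma near_local_rep (L M N : manifold3 R) (f : L -> M) (h : M -> N) c d e x :
  dom c x -> dom d (f x) -> {for x, continuous f} ->
  {near coord c x, local_rep h d e \o local_rep f c d =1 local_rep (h \o f) c e}.
Proof.
move=> dx dfx cf; have nd : nbhs x (f @^-1` dom d).
  by apply: cf; apply: open_nbhs_nbhs; split=> //; exact: dom_open.
have := near_point dx nd; apply: near_sub => u [iu du].
by rewrite /local_rep /= coordK.
Qed.

Lemma local_rep_coord (M N : manifold3 R) (f : M -> N) c d x : dom c x ->
  local_rep f c d (coord c x) = coord d (f x).
Proof. by move=> dx; rewrite /local_rep /= coordK. Qed.

Lemma jac_comp (L M N : manifold3 R) (f : L -> M) (h : M -> N) c d e x :
  dom c x -> dom d (f x) -> {for x, continuous f} ->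
  differentiable_at f c d x -> differentiable_at h d e (f x) ->
  differentiable_at (h \o f) c e x /\ jac (h \o f) c e x = jac f c d x *m jac h d e (f x).
Proof.
move=> dx dfx cf df dh; have nr := near_local_rep h e dx dfx cf.
have dh' : differentiable (local_rep h d e) (local_rep f c d (coord c x)).
  by rewrite local_rep_coord.
have dhf := differentiable_comp df dh'.
split; first exact: (near_eq_differentiable nr dhf).
rewrite /jac -(near_eq_jacobian nr dhf).
by rewrite (jacobian_comp df dh') local_rep_coord.
Qed.

Lemma smooth_map_differentiable (M N : manifold3 R) (U : set M) (f : M -> N) c d x :
  smooth_map U f -> U x -> dom c x -> dom d (f x) -> differentiable_at f c d x.
Proof.
move=> [_ sf] Ux dx dfx; apply: (Ck_differentiable (sf c d 1%N)).
by exists x.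
Qed.

Lemma smooth_map_id (M : manifold3 R) : smooth_map setT (idfun : M -> M).
Proof.
split=> [x _|c d]; first exact: cvg_id.
have := @transition_smooth R M c d; congr (smooth _ _).
by apply/seteqP; split=> u [x [dx ?] <-]; exists x => //; split=> //; case: dx.
Qed.

Lemma transition_differentiable (M : manifold3 R) (c d : chart M) x :
  dom c x -> dom d x -> differentiable_at idfun c d x.
Proof. by move=> dx dx'; exact: (smooth_map_differentiable (@smooth_map_id M)). Qed.

Lemma jac_id (M : manifold3 R) (c : chart M) x : dom c x -> jac idfun c c x = 1%:M.
Proof.
move=> dx; have n : {near coord c x, idfun =1 local_rep (idfun : M -> M) c c}.
  have := open_near (@img_open _ c) (img_coord dx); apply: near_sub => u iu.
  by rewrite /local_rep /= coord_point.
have [di Ji] : differentiable idfun (coord c x) /\ 'J idfun (coord c x) = 1%:M :> 'M[R]_3.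
  by apply: affine_jacobian => y; rewrite mulmx1.
by rewrite /jac -(near_eq_jacobian n di).
Qed.

Lemma jac_transition_pos (M : manifold3 R) (c d : chart M) x : dom c x -> dom d x ->
  0 < \det (jac idfun c d x).
Proof. by move=> dx dx'; exact: transition_oriented. Qed.

End ManifoldCalculus.

(** * The circle action: generator, orientation, Killing equation *)

Section ActionCalculus.
Context {R : realType} (N : manifold3 R) (a : u1_action N).
Implicit Types (c d : chart N) (y : N).

Definition flow c d (tu : R * 'rV[R]_3) : 'rV[R]_3 := coord d (a tu.1 (point c tu.2)).

Definition flow_dom c d : set (R * 'rV[R]_3)%type :=
  [set tu | img c tu.2 /\ dom d (a tu.1 (point c tu.2))].

Lemma flow_dom_open c d : open (flow_dom c d).
Proof.
rewrite openE => -[t u] [/= iu du].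
have h1 : nbhs (t, u) (snd @^-1` img c).
  apply: cvg_snd; exact: open_near (@img_open _ _ c) iu.
have cp : {for (t, u), continuous (fun tu : R * 'rV[R]_3 => (tu.1, point c tu.2))}.
  apply: (pair_continuous (f := fst) (g := point c \o snd)); first by move=> B; exact: cvg_fst.
  apply: (continuous_comp (f := snd) (g := point c)); first by move=> B; exact: cvg_snd.
  exact: point_continuous.
have h2 : nbhs (t, u) (fun tu : R * 'rV[R]_3 => dom d (a tu.1 (point c tu.2))).
  have := @act_continuous R N a (t, point c u) (dom d).
  have od : nbhs (a t (point c u)) (dom d).
    by apply: open_nbhs_nbhs; split=> //; exact: dom_open.
  by move=> /(_ od) h; have := cp _ h.
exact: (near_setI h1 h2).
Qed.

Lemma flow_smooth c d : smooth (flow_dom c d) (flow c d).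
Proof. exact: act_smooth. Qed.

Lemma flow_differentiable c d tu : flow_dom c d tu -> differentiable (flow c d) tu.
Proof. by move=> h; exact: (Ck_differentiable (@flow_smooth c d 1%N)). Qed.

Lemma derive_slicer (W : normedModType R) (F : R * 'rV[R]_3 -> W) t u v :
  'D_v (fun u => F (t, u)) u = 'D_((0, v) : R * 'rV[R]_3) F (t, u).
Proof.
rewrite /derive; set f1 := (X in lim (X @ _)); set f2 := (X in _ = lim (X @ _)).
suff -> : f1 = f2 by [].
apply/funext => h; rewrite /f1 /f2 /=; congr (h^-1 *: (F _ - _)); congr (_, _).
by rewrite /= scaler0 add0r.
Qed.

Lemma derive_slicel (W : normedModType R) (F : R * 'rV[R]_3 -> W) t u :
  'D_1 (fun t => F (t, u)) t = 'D_((1, 0) : R * 'rV[R]_3) F (t, u).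
Proof.
rewrite /derive; set f1 := (X in lim (X @ _)); set f2 := (X in _ = lim (X @ _)).
suff -> : f1 = f2 by [].
apply/funext => h; rewrite /f1 /f2 /=; congr (h^-1 *: (F _ - _)); congr (_, _).
by rewrite /= scaler0 add0r.
Qed.

(** The sign appears because [nu] is generated by exp(-t); the group law moves the base time from t
    to 0. *)
Lemma derive_flow_time c d y t : dom c y -> dom d (a t y) ->
  'D_((1, 0) : R * 'rV[R]_3) (flow c d) (t, coord c y) = - nu a d (coord d (a t y)).
Proof.
move=> dy day; rewrite -derive_slicel.
have S0 : flow_dom c d (t, coord c y) by split; [exact: img_coord|rewrite /= coordK].
pose w (s : R) := coord d (a s y).
have wE : w = (fun s => flow c d (s, coord c y)).
  by apply/funext => s; rewrite /w /flow /= coordK.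
have dw : differentiable w t.
  rewrite wE; apply: (differentiable_comp (f := fun s : R => (s, coord c y))).
    exact: differentiable_pair.
  exact: flow_differentiable.
rewrite -wE /nu derive1E.
have -> : (fun s : R => coord d (a (- s) (point d (coord d (a t y))))) = w \o (fun s => t - s).
  by apply/funext => s; rewrite /w /= coordK// -actD addrC.
have h : is_derive (0 : R) (1 : R) (fun s : R => t - s) (0 - 1) by exact: is_deriveB.
have dm : differentiable (fun s : R => t - s) (0 : R).
  by apply/derivable1_diffP; exact: (@ex_derive _ _ _ _ _ _ _ h).
have dw0 : differentiable w (t - 0) by rewrite subr0.
rewrite (derive_comp (1 : R) dm dw0) subr0.
have -> : 'D_1 (fun s : R => t - s) 0 = - 1 :> R.
  by rewrite (@derive_val _ _ _ _ _ _ _ h) sub0r.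
by rewrite (deriveE (- 1 : R) dw) (deriveE (1 : R) dw) linearN opprK.
Qed.

Lemma flow0 c u : img c u -> flow c c (0, u) = u.
Proof. by move=> iu; rewrite /flow /= act0 coord_point. Qed.

Lemma flow_dom0 c u : img c u -> flow_dom c c (0, u).
Proof. by move=> iu; split=> //=; rewrite act0; exact: dom_point. Qed.

Lemma nu_flow c u : img c u -> nu a c u = - 'D_((1, 0) : R * 'rV[R]_3) (flow c c) (0, u).
Proof.
move=> iu; have dp := dom_point iu.
have da : dom c (a 0 (point c u)) by rewrite act0.
have := derive_flow_time dp da; rewrite (coord_point iu) act0 (coord_point iu).
by move=> /(congr1 -%R); rewrite opprK => <-.
Qed.

Lemma nu_smooth c : smooth (img c) (nu a c).
Proof.
move=> n; apply: (@Ck_ext _ _ _ _ _ (fun u => - 'D_((1, 0) : R * 'rV[R]_3) (flow c c) (0, u))).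
- exact: img_open.
- by move=> u iu; rewrite -nu_flow.
apply: CkN; first exact: img_open.
have cD : Ck n (flow_dom c c) (fun tu => 'D_((1, 0) : R * 'rV[R]_3) (flow c c) tu).
  by have [_] := @flow_smooth c c n.+1; apply.
apply: (Ck_comp_mx (coordinatized_pair (@coordinatized_R R) (@coordinatized_rV R 3))
  (@img_open _ _ c) (@flow_dom_open c c) _ cD) => [u iu|].
  exact: flow_dom0.
apply: Ck_pair; [exact: img_open|exact: Ck_cst|exact: Ck_id].
Qed.

Lemma act_for_continuous t y : {for y, continuous (a t : N -> N)}.
Proof.
move=> B; have := @act_continuous R N a (t, y) B => h /h.
have cp : {for y, continuous (fun z : N => (t, z))}.
  exact: (pair_continuous (@cvg_cst _ t _ _ _) (@cvg_id _ _)).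
by move=> /cp.
Qed.

Lemma act_slice c d t : local_rep (a t) c d = (fun u => flow c d (t, u)).
Proof. by []. Qed.

Lemma act_differentiable c d t y : dom c y -> dom d (a t y) -> differentiable_at (a t) c d y.
Proof.
move=> dy day; rewrite /differentiable_at act_slice.
apply: (differentiable_comp (f := fun u : 'rV[R]_3 => (t, u))).
  exact: differentiable_pair.
by apply: flow_differentiable; split; [exact: img_coord|rewrite /= coordK].
Qed.

(** The group is abelian: a(t) commutes with a(-s), and this relation is differentiated at s = 0. *)
Lemma nu_act c d t y : dom c y -> dom d (a t y) ->
  nu a d (coord d (a t y)) = nu a c (coord c y) *m jac (a t) c d y.
Proof.
move=> dy day; have dj := act_differentiable dy day.
pose w (s : R) := coord c (a (- s) y).
have ac : continuous (fun s : R => a (- s) y).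
  move=> s B; have := @act_continuous R N a (- s, y) B => h /h.
  have cp : {for s, continuous (fun s : R => (- s, y))}.
    have co : {for s, continuous (fun s : R => - s)} 
      by exact: (Ck_continuous (CkN openT (@Ck_id R R 0 setT)) I).
    exact: (pair_continuous co (@cvg_cst _ y _ _ _)).
  by move=> /cp.
have nc : \forall s \near (0 : R), dom c (a (- s) y).
  by apply: (ac 0); apply: open_nbhs_nbhs; split; [exact: dom_open|rewrite oppr0 act0].
have S0 : flow_dom c c (- 0, coord c y) by rewrite oppr0; exact: (flow_dom0 (img_coord dy)).
have dw : differentiable w 0.
  have -> : w = (flow c c \o (fun s => (- s, coord c y))).
    by apply/funext => s; rewrite /w /flow /= coordK.
  apply: differentiable_comp; last exact: flow_differentiable.
  by apply: differentiable_pair; [exact: differentiableN|exact: differentiable_cst].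
have w0 : w 0 = coord c y by rewrite /w oppr0 act0.
have dj' : differentiable (local_rep (a t) c d) (w 0) by rewrite w0.
have -> : nu a d (coord d (a t y)) = 'D_1 (local_rep (a t) c d \o w) 0.
  rewrite /nu derive1E; apply: near_eq_derive; move: nc; apply: filterS => s ds.
  by rewrite /w /local_rep /= !coordK// -!actD addrC.
apply: (etrans (derive_comp (1 : R) dw dj')); rewrite w0.
apply: (etrans (derive_jacobian _ dj)); rewrite -/(jac (a t) c d y).
apply: (f_equal (fun v => v *m jac (a t) c d y)).
have wE : (fun s : R => coord c (a (- s) (point c (coord c y)))) = w.
  by apply/funext => s; rewrite coordK.
by rewrite /nu wE derive1E.
Qed.

(** The space derivative of the flow as a function of time and position jointly, so that it can
    itself be differentiated in time. *)
Definition flow_jac c d (tu : R * 'rV[R]_3) : 'M[R]_3 :=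
  \matrix_(i, j) 'D_((0, e_ i) : R * 'rV[R]_3) (fun tu => flow c d tu 0 j) tu.

Let flow_entry_smooth c d j n : Ck n (flow_dom c d) (fun tu => flow c d tu 0 j).
Proof. exact: ((Ck_mxP _ _ (@flow_dom_open c d)).1 (@flow_smooth c d n) 0 j). Qed.

Lemma flow_jac_smooth c d n : Ck n (flow_dom c d) (flow_jac c d).
Proof.
apply/(Ck_mxP _ _ (@flow_dom_open c d)) => i j.
have [_ D] := @flow_entry_smooth c d j n.+1.
by apply: (Ck_ext (@flow_dom_open c d) _ (D (0, e_ i))) => tu _; rewrite [RHS]mxE.
Qed.

Lemma derive_flow_space c d i tu : flow_dom c d tu ->
  'D_((0, e_ i) : R * 'rV[R]_3) (flow c d) tu = row i (flow_jac c d tu).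
Proof.
move=> h; have d1 : derivable (flow c d) tu (0, e_ i).
  exact: (diff_derivable (flow_differentiable h)).
by rewrite (derive_mx d1); apply/rowP => j; rewrite [LHS]mxE [RHS]mxE [RHS]mxE.
Qed.

Lemma flow_jacE c d t y : dom c y -> dom d (a t y) ->
  flow_jac c d (t, coord c y) = jac (a t) c d y.
Proof.
move=> dy day; have dj := act_differentiable dy day.
have h : flow_dom c d (t, coord c y) by split; [exact: img_coord|rewrite /= coordK].
apply/row_matrixP => i; rewrite -derive_flow_space// /jac (row_jacobian _ dj).
exact/esym/derive_slicer.
Qed.


Lemma jac_act_inv c d t y : dom c y -> dom d (a t y) ->
  jac (a t) c d y *m jac (a (- t)) d c (a t y) = 1%:M.
Proof.
move=> dy day; have aK : a (- t) (a t y) = y by rewrite -actD addNr act0.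
have dy' : dom c (a (- t) (a t y)) by rewrite aK.
have [_ <-] := jac_comp dy day (@act_for_continuous t y) (act_differentiable dy day)
  (act_differentiable day dy').
have -> : (a (- t) : N -> N) \o a t = idfun.
  by apply/funext => z /=; rewrite -actD addNr act0.
exact: jac_id.
Qed.

Lemma det_jac_act_neq0 c d t y : dom c y -> dom d (a t y) -> \det (jac (a t) c d y) != 0.
Proof.
move=> dy day; have [u _] := mulmx1_unit (jac_act_inv dy day).
by rewrite unitmxE unitfE in u; exact: u.
Qed.

Lemma jac_act_chart c d d' t y : dom c y -> dom d (a t y) -> dom d' (a t y) ->
  jac (a t) c d' y = jac (a t) c d y *m jac idfun d d' (a t y).
Proof.
move=> dy day day'.
by have [_ ->] := jac_comp dy day (@act_for_continuous t y) (act_differentiable dy day)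
  (transition_differentiable day day').
Qed.

Lemma near_jac_sign c d t y (s : R) : dom c y -> dom d (a t y) ->
  0 < s * \det (jac (a t) c d y) ->
  \forall t' \near t, exists2 d', dom d' (a t' y) & 0 < s * \det (jac (a t') c d' y).
Proof.
move=> dy day sp.
have S0 : flow_dom c d (t, coord c y) by split; [exact: img_coord|rewrite /= coordK].
have cdet : Ck 0 (flow_dom c d) (fun tu => s * \det (flow_jac c d tu)).
  apply: CkM; [exact: flow_dom_open|exact: Ck_cst|].
  by apply: Ck_det; [exact: flow_dom_open|exact: flow_jac_smooth].
have cp : {for t, continuous (fun t : R => (t, coord c y))}.
  exact: (pair_continuous (@cvg_id _ _) (@cvg_cst _ (coord c y) _ _ _)).
have n1 : nbhs t (fun t' => flow_dom c d (t', coord c y)).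
  by apply: (cp (flow_dom c d)); apply: open_nbhs_nbhs; split=> //; exact: flow_dom_open.
have n2 : nbhs t (fun t' => 0 < s * \det (flow_jac c d (t', coord c y))).
  apply: (cp (fun tu => 0 < s * \det (flow_jac c d tu))).
  have o0 : nbhs (s * \det (flow_jac c d (t, coord c y))) [set x : R | 0 < x].
    by apply: open_nbhs_nbhs; split; [exact: open_gt|rewrite /= flow_jacE].
  exact: (Ck_continuous cdet S0 o0).
apply: filterS (filterI n1 n2) => t' [[_ /=]]; rewrite coordK// => day' h.
by exists d; [exact: day'|rewrite -(flow_jacE dy day'); exact: h].
Qed.

(* The sign is locally constant in t, independent of the charts, and 1 at t = 0. *)
Lemma jac_act_pos c d t y : dom c y -> dom d (a t y) -> 0 < \det (jac (a t) c d y).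
Proof.
move=> dy day.
(* The times at which the determinant has the sign of s in some chart. [B 1] and [B (-1)] are open
   and complementary, so connectedness of the line decides. *)
pose B (s : R) := [set t' | exists2 d', dom d' (a t' y) & 0 < s * \det (jac (a t') c d' y)].
have oB s : open (B s).
  by rewrite openE => t' [d' da' h]; exact: near_jac_sign h.
have BC : ~` B (-1) = B 1.
  apply/seteqP; split=> t' /= h.
    have [d' da'] := dom_cover (a t' y); exists d' => //; rewrite mul1r.
    have := det_jac_act_neq0 dy da'; rewrite neq_lt => /orP[neg|//].
    by case: h; exists d' => //; rewrite mulN1r oppr_gt0.
  move=> [d2 da2]; case: h => d1 da1; rewrite mul1r mulN1r oppr_gt0.
  rewrite (jac_act_chart dy da1 da2) det_mulmx => p1.
  have p12 := mulr_gt0 p1 (jac_transition_pos da1 da2).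
  by move=> n12; have := lt_trans p12 n12; rewrite ltxx.
have con : connected [set: R] by apply/connected_intervalP => x z _ _ w _.
have B1T : B 1 = setT.
  apply: con.
  - exists 0, c; first by rewrite act0.
    have -> : (a 0 : N -> N) = idfun by apply/funext => z; rewrite act0.
    by rewrite jac_id// det1 mulr1.
  - by exists (B 1); [exact: oB|rewrite setTI].
  - exists (B 1); last by rewrite setTI.
    by rewrite -BC; apply: open_closedC.
have : B 1 t by rewrite B1T.
move=> [d' da']; rewrite mul1r => p'.
by rewrite (jac_act_chart dy da' day) det_mulmx; exact: (mulr_gt0 p' (jac_transition_pos da' day)).
Qed.

Variable g : metric_components N.
Hypotheses (g_riem : riemannian g) (a_isom : isometric g a).

Lemma metric_posdef c u : img c u -> posdef (g c u).
Proof.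
move=> [y dy <-]; have [_ sg pg _] := g_riem.
by split; [exact: sg|move=> v; exact: pg].
Qed.

Lemma metric_smooth c : smooth (img c) (g c).
Proof. by have [sg _ _ _] := g_riem; exact: sg. Qed.

(** The isometry condition is differentiated at time 0. Schwarz's theorem exchanges the time
    derivative with the space derivatives in the Jacobian of the flow, which yields minus the
    Jacobian of [nu]. *)
Lemma nu_killing c u : img c u ->
  'J (nu a c) u *m g c u + 'D_(nu a c u) (g c) u + g c u *m ('J (nu a c) u)^T = 0.
Proof.
move=> iu; pose S := flow_dom c c; have oS : open S := @flow_dom_open c c.
pose e : R * 'rV[R]_3 := (1, 0); pose p : R * 'rV[R]_3 := (0, u).
have Sp : S p by exact: flow_dom0.
pose K := flow_jac c c.
have dnu : differentiable (nu a c) u by exact: (Ck_differentiable (@nu_smooth c 1%N) iu).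
have dg : differentiable (g c) u by exact: (Ck_differentiable (@metric_smooth c 1%N) iu).
have dflow : differentiable (flow c c) p by exact: flow_differentiable.
have fp : flow c c p = u by exact: flow0.
have dtime tu : S tu -> 'D_e (flow c c) tu = - nu a c (flow c c tu).
  case: tu => t v [/= iv dv]; have dp := dom_point iv.
  by have := derive_flow_time dp dv; rewrite coord_point.
have K1 : K p = 1%:M.
  have da0 : dom c (a 0 (point c u)) by rewrite act0; exact: dom_point.
  have h := flow_jacE (dom_point iu) da0; rewrite (coord_point iu) in h.
  apply: (etrans h).
  have -> : (a 0 : N -> N) = idfun by apply/funext => y; rewrite act0.
  by apply: jac_id; exact: dom_point.
have dK : differentiable K p by exact: (Ck_differentiable (@flow_jac_smooth c c 1%N) Sp).
have DK : 'D_e K p = - 'J (nu a c) u.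
  have dKe : derivable K p e by exact: (diff_derivable dK).
  apply/matrixP => i j; rewrite (derive_mx dKe) [LHS]mxE [RHS]mxE.
  rewrite (jacobian_entry i j dnu).
  pose ei : R * 'rV[R]_3 := (0, e_ i).
  have -> : (fun tu => K tu i j) = 'D_ei (fun tu => flow c c tu 0 j).
    by apply/funext => tu; rewrite mxE.
  rewrite (schwarz_derive ei e oS Sp (@flow_entry_smooth c c j 2)).
  have ne : {near p, 'D_e (fun tu => flow c c tu 0 j) =1 (fun tu => - (nu a c (flow c c tu) 0 j))}.
    have := open_near oS Sp; apply: near_sub => tu Stu.
    have d1 : derivable (flow c c) tu e by exact: (diff_derivable (flow_differentiable Stu)).
    have := dtime tu Stu; rewrite (derive_mx d1) => /(congr1 (fun v : 'rV[R]_3 => v 0 j)).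
    by rewrite [LHS]mxE [RHS]mxE.
  rewrite (near_eq_derive ei ne).
  have dnf : differentiable (fun v : 'rV[R]_3 => - nu a c v 0 j) (flow c c p).
    by rewrite fp; apply: differentiableN; exact: (differentiable_mxP _ _).1.
  have De : 'D_ei (flow c c) p = e_ i.
    apply: (etrans (derive_flow_space i Sp)).
    by apply: (etrans (f_equal (row i) K1)); rewrite row1.
  have h := derive_comp ei dflow dnf; rewrite De fp in h; apply: (etrans h).
  by apply: deriveN; apply: diff_derivable; exact: (differentiable_mxP _ _).1.
pose G tu := g c (flow c c tu).
have dgp : differentiable (g c) (flow c c p) by rewrite fp.
have dG : differentiable G p by exact: (differentiable_comp dflow dgp).
have DG : 'D_e G p = - 'D_(nu a c u) (g c) u.
  have h := derive_comp e dflow dgp; rewrite (dtime p Sp) fp in h; apply: (etrans h).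
  by rewrite (deriveE _ dg) (deriveE _ dg) linearN.
have eq : {near p, (fun tu => K tu *m G tu *m (K tu)^T) =1 (fun tu => g c tu.2)}.
  have := open_near oS Sp; apply: near_sub => -[t v] [/= iv dv].
  have := a_isom (dom_point iv) dv.
  by rewrite -(flow_jacE (dom_point iv) dv) (coord_point iv) => <-.
have dKT : differentiable (fun tu => (K tu)^T) p.
  have cK : Ck 1 S (fun tu => (K tu)^T) by apply: Ck_trmx => //; exact: flow_jac_smooth.
  exact: (Ck_differentiable cK Sp).
have DKT : 'D_e (fun tu => (K tu)^T) p = ('D_e K p)^T.
  have d1 : derivable (fun tu => (K tu)^T) p e by exact: diff_derivable.
  have d2 : derivable K p e by exact: (diff_derivable dK).
  apply/matrixP => i j; rewrite (derive_mx d1) (derive_mx d2) [LHS]mxE [RHS]mxE [RHS]mxE.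
  by congr ('D_e _ p); apply/funext => tu; rewrite mxE.
have dKG : derivable (fun tu => K tu *m G tu) p e.
  by have [] := is_derive_mulmx (diff_derivable (v := e) dK) (diff_derivable (v := e) dG).
have L : 'D_e (fun tu => K tu *m G tu *m (K tu)^T) p =
    - ('J (nu a c) u *m g c u + 'D_(nu a c u) (g c) u + g c u *m ('J (nu a c) u)^T).
  apply: (etrans (derive_mulmx dKG (diff_derivable dKT))).
  have -> : 'D_e (fun tu => K tu *m G tu) p = 'D_e K p *m G p + K p *m 'D_e G p.
    exact: derive_mulmx (diff_derivable dK) (diff_derivable dG).
  rewrite DKT DK DG K1 /G fp; move: ('J _ u) ('D_(nu a c u) _ u) (g c u) => J D g'.
  by rewrite !mul1mx trmx1 mulmx1 mulNmx linearN/= mulmxN -!opprD.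
have Rz : 'D_e (fun tu : R * 'rV[R]_3 => g c tu.2) p = 0.
  have dgs : differentiable (g c) (snd p) by [].
  have cs : continuous (snd : R * 'rV[R]_3 -> 'rV[R]_3) by move=> x B; exact: cvg_snd.
  have ds : differentiable (snd : R * 'rV[R]_3 -> 'rV[R]_3) p by exact: linear_differentiable.
  apply: (etrans (derive_comp e ds dgs)).
  rewrite (deriveE e ds) (diff_lin p cs) /= (deriveE _ dg); exact: linear0.
by have := near_eq_derive e eq; rewrite L Rz => /eqP; rewrite oppr_eq0 => /eqP.
Qed.

End ActionCalculus.

(** * Gauge transformations *)

Section GaugeTransformations.
Context {R : realType} (M : manifold3 R) (P : u1_bundle M).
Implicit Types (U W : set M) (s : M -> total P) (h : M -> R) (c : chart M).

Lemma smooth_subset_image (T : normedModType R) c U W (f : 'rV[R]_3 -> T) : W `<=` U ->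
  smooth (coord c @` (U `&` dom c)) f -> smooth (coord c @` (W `&` dom c)) f.
Proof.
move=> WU sf n; apply: Ck_subset (sf n) => u [x [Wx dx] <-].
by exists x => //; split=> //; exact: WU.
Qed.

Lemma smooth_funW U W h : W `<=` U -> smooth_fun U h -> smooth_fun W h.
Proof. by move=> WU sh c; exact: smooth_subset_image (sh c). Qed.

Lemma smooth_funB U h h' : open U -> smooth_fun U h -> smooth_fun U h' ->
  smooth_fun U (fun x => h x - h' x).
Proof. by move=> oU sh sh' c n; apply: CkB; [exact: open_coord_image|exact: sh|exact: sh']. Qed.

Lemma local_sectionW U W s : W `<=` U -> local_section U s -> local_section W s.
Proof.
by move=> WU [ps ls]; split=> [x /WU/ps//|i x /WU Ux]; exact: ls.
Qed.

Lemma gauge_transformation U U' s s' x : open U -> open U' -> U x -> U' x ->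
  local_section U s -> local_section U' s' ->
  exists W h, [/\ open W, W x, W `<=` U `&` U', smooth_fun W h &
    forall y, W y -> s' y = ract (s y) (h y)].
Proof.
move=> oU oU' Ux U'x [_ ls] [_ ls']; have [i bx] := base_cover P x.
have [W1 [h1 [oW1 W1x sh1 E1]]] := ls i x Ux bx.
have [W2 [h2 [oW2 W2x sh2 E2]]] := ls' i x U'x bx.
pose W := (U `&` U') `&` (W1 `&` W2).
have oW : open W by apply: openI; exact: openI.
exists W, (fun y => h2 y - h1 y); split=> //; first by move=> y [].
  by apply: smooth_funB => //; [apply: smooth_funW sh2|apply: smooth_funW sh1] => y [_ []].
move=> y [_ [W1y W2y]]; rewrite E2// E1// -ractD; congr (ract _ _).
by rewrite addrC subrK.
Qed.

Lemma local_section_ract U s h : open U -> local_section U s -> smooth_fun U h ->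
  local_section U (fun y => ract (s y) (h y)).
Proof.
move=> oU [ps ls] sh; split=> [y Uy|i x Ux bx]; first by rewrite proj_ract ps.
have [W [k [oW Wx sk E]]] := ls i x Ux bx.
have oI : open (U `&` W) by exact: openI.
exists (U `&` W), (fun y => k y + h y); split=> //; last first.
  by move=> y [_ Wy]; rewrite E// -ractD.
move=> c n; have oc := open_coord_image (c := c) oI.
have IW : U `&` W `<=` W by move=> y [].
have IU : U `&` W `<=` U by move=> y [].
exact: (CkD oc (smooth_subset_image IW (sk c) n) (smooth_subset_image IU (sh c) n)).
Qed.

End GaugeTransformations.

(** The inhomogeneous term k^T n' enters through the change of d phi and through the change of A,
    and cancels in the covariant differential. *)
Lemma covd_gauge_algebra (R : realType) (J J' T S : 'M[R]_3) (A A' k n n' : 'rV[R]_3) :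
  T *m J' = J *m S + k^T *m n' -> A + k = A' *m T^T -> n' = n *m S ->
  (J - A^T *m n) *m S = T *m (J' - A'^T *m n').
Proof.
move=> JE AE nE; rewrite mulmxBl mulmxBr JE mulmxA.
have -> : T *m A'^T = (A + k)^T by rewrite AE trmx_mul trmxK.
rewrite -mulmxA -nE linearD/= mulmxDl.
by move: (J *m S) (k^T *m _) (A^T *m _) => X Y Z; rewrite opprD addrACA [Y - Y]subrr addr0.
Qed.

(** * Change of trivialisation and of charts *)

Section FrameChange.
Context {R : realType} (M : manifold3 R) (P : u1_bundle M) (N : manifold3 R).
Variables (a : u1_action N) (A : connection P) (phi : assoc_section P a).
Implicit Types (U W : set M) (s : M -> total P) (h : M -> R) (c : chart M) (d : chart N).

Lemma near_eq_extd (f g : 'rV[R]_3 -> 'rV[R]_3) u : {near u, f =1 g} ->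
  differentiable f u -> extd f u = extd g u.
Proof. by move=> fg df; rewrite /extd (near_eq_jacobian fg df). Qed.

Lemma field_continuous U s x : open U -> local_section U s -> U x ->
  {for x, continuous (phi \o s)}.
Proof. by move=> oU ls Ux; have [+ _] := field_smooth phi oU ls; apply. Qed.

Lemma field_differentiable U s c d x : open U -> local_section U s -> U x ->
  dom c x -> dom d (phi (s x)) -> differentiable_at (phi \o s) c d x.
Proof.
by move=> oU ls Ux; exact: (smooth_map_differentiable (field_smooth phi oU ls) Ux).
Qed.

Lemma smooth_fun_differentiable U h c x : smooth_fun U h -> U x -> dom c x ->
  differentiable (h \o point c) (coord c x).
Proof.
by move=> sh Ux dx; apply: (Ck_differentiable (sh c 1%N)); exists x.
Qed.

Lemma derive_flow_space_dir (c' d' : chart N) t (y : N) v : dom c' y -> dom d' (a t y) ->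
  'D_((0, v) : R * 'rV[R]_3) (flow a c' d') (t, coord c' y) = v *m jac (a t) c' d' y.
Proof.
move=> dy day; rewrite -derive_slicer.
exact: (derive_jacobian v (act_differentiable dy day)).
Qed.

(** In the new trivialisation phi is the flow at time -h applied to the old one. The chain rule in
    the time slot gives (-dh)(-nu) = dh nu, with [nu] taken at the new point. *)
Lemma jac_gauge U s s' h c d d' x : open U -> local_section U s -> smooth_fun U h ->
  (forall y, U y -> s' y = ract (s y) (h y)) -> U x ->
  dom c x -> dom d (phi (s x)) -> dom d' (phi (s' x)) ->
  jac (phi \o s') c d' x =
    jac (phi \o s) c d x *m jac (a (- h x)) d d' (phi (s x))
    + (dfun h c x)^T *m nu a d' (coord d' (phi (s' x))).
Proof.
move=> oU ls sh E Ux dx dsx ds'x.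
have phiE y : U y -> phi (s' y) = a (- h y) (phi (s y)) by move=> /E ->; exact: field_equivariant.
have dax : dom d' (a (- h x) (phi (s x))) by rewrite -phiE.
pose f := local_rep (phi \o s) c d; pose k := h \o point c.
have df : differentiable f (coord c x) by exact: field_differentiable oU ls Ux dx dsx.
have dk : differentiable k (coord c x) by exact: smooth_fun_differentiable sh Ux dx.
pose F u := (- k u, f u).
have dmk : differentiable (fun u => - k u) (coord c x) by exact: differentiableN.
have dF : differentiable F (coord c x) by exact: differentiable_pair.
have Fx : F (coord c x) = (- h x, coord d (phi (s x))).
  by rewrite /F /f /k /local_rep /= coordK.
have dfl : differentiable (flow a d d') (F (coord c x)).
  by rewrite Fx; apply: flow_differentiable; split; [exact: img_coord|rewrite /= coordK].
have near_flow : {near coord c x, flow a d d' \o F =1 local_rep (phi \o s') c d'}.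
  have nd : nbhs x ((phi \o s) @^-1` dom d).
    by apply: (field_continuous oU ls Ux); apply: open_nbhs_nbhs; split=> //; exact: dom_open.
  have nU : nbhs x U by exact: open_nbhs_nbhs.
  have nn := near_point (P := (phi \o s) @^-1` dom d `&` U) dx (near_setI nd nU).
  apply: near_sub nn => u [iu [/= du Uu]].
  by rewrite /F /f /k /flow /local_rep /= coordK// phiE.
have dcomp := differentiable_comp dF dfl.
have -> : jac (phi \o s') c d' x = 'J (flow a d d' \o F) (coord c x).
  exact/esym/(near_eq_jacobian near_flow dcomp).
apply/row_matrixP => i; rewrite (row_jacobian i dcomp) (derive_comp _ dF dfl).
have DF : 'D_(delta_mx 0 i) F (coord c x) =
    (- 'D_(e_ i) k (coord c x), 'D_(delta_mx 0 i) f (coord c x)).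
  rewrite (deriveE _ dF) (diff_pair dmk df) (deriveE _ df); congr (_, _).
  by rewrite -(deriveE _ dmk); apply: deriveN; exact: diff_derivable.
rewrite DF Fx; set al := 'D_(e_ i) k _; set v := 'D_(delta_mx 0 i) f _.
have dfl' : differentiable (flow a d d') (- h x, coord d (phi (s x))) by rewrite -Fx.
have -> : (- al, v) = (- al) *: ((1, 0) : R * 'rV[R]_3) + (0, v).
  by congr (_, _) => /=; rewrite ?scaler0 ?add0r// addr0 /GRing.scale/= mulr1.
rewrite (deriveE _ dfl') linearD linearZZ -!(deriveE _ dfl').
rewrite (derive_flow_time dsx dax) (derive_flow_space_dir _ dsx dax) -phiE//.
rewrite scalerN scaleNr opprK addrC.
have -> : row i (jac (phi \o s) c d x *m jac (a (- h x)) d d' (phi (s x))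
    + (dfun h c x)^T *m nu a d' (coord d' (phi (s' x)))) =
  row i (jac (phi \o s) c d x) *m jac (a (- h x)) d d' (phi (s x))
    + dfun h c x 0 i *: nu a d' (coord d' (phi (s' x))).
  rewrite linearD/= !row_mul; congr (_ + _); apply/rowP => j.
  by rewrite mxE big_ord1 !mxE.
have -> : dfun h c x 0 i = al by rewrite mxE.
by have -> : row i (jac (phi \o s) c d x) = v by exact: row_jacobian.
Qed.

Lemma conn_differentiable U s c x : open U -> local_section U s -> U x -> dom c x ->
  differentiable (conn A s c) (coord c x).
Proof.
move=> oU ls Ux dx; have [sc _] := conn_smooth A oU ls.
by apply: (Ck_differentiable (sc c 1%N)); exists x.
Qed.

Lemma curvature_gauge U s s' h c x : open U -> local_section U s -> local_section U s' ->
  smooth_fun U h -> (forall y, U y -> s' y = ract (s y) (h y)) -> U x -> dom c x ->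
  curvature A s' c x = curvature A s c x.
Proof.
move=> oU ls ls' sh E Ux dx; have oI := open_coord_image (c := c) oU.
have Iu : (coord c @` (U `&` dom c)) (coord c x) by exists x.
have d1 := conn_differentiable oU ls Ux dx; have d2 := conn_differentiable oU ls' Ux dx.
have sg : Ck 1 (coord c @` (U `&` dom c)) (grad (h \o point c)).
  by apply: Ck_grad => //; exact: (sh c 2).
have dg := Ck_differentiable sg Iu.
have n : {near coord c x, conn A s' c =1 (fun u => conn A s c u + grad (h \o point c) u)}.
  have := open_near oI Iu; apply: near_sub => u [y [Uy dy] <-].
  exact: (conn_gauge A oU ls ls' sh E Uy dy).
rewrite /curvature (near_eq_extd n d2) (extdD d1 dg).
by rewrite (extd_grad oI Iu (sh c 2)) addr0.
Qed.

Lemma form_transition U (om : components M) c c' x : open U -> smooth_form U om ->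
  U x -> dom c x -> dom c' x ->
  om c (coord c x) = om c' (coord c' x) *m (jac idfun c c' x)^T /\
  extd (om c) (coord c x) =
    jac idfun c c' x *m extd (om c') (coord c' x) *m (jac idfun c c' x)^T.
Proof.
move=> oU [som com] Ux dx dx'; split; first exact: com.
pose f := local_rep (idfun : M -> M) c c'.
pose O := coord c @` ((U `&` dom c') `&` dom c).
have oO : open O by apply: open_coord_image; apply: openI => //; exact: dom_open.
pose W := coord c' @` (U `&` dom c').
have oW : open W by exact: open_coord_image.
have Ou : O (coord c x) by exists x.
have OW u : O u -> W (f u).
  by move=> [y [[Uy dy'] dy] <-]; exists y => //; rewrite /f local_rep_coord.
have sf : Ck 2 O f.
  apply: Ck_subset (transition_smooth c c' 2) => u [y [[Uy dy'] dy] <-].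
  by exists y.
have d1 : differentiable (om c) (coord c x).
  by apply: (Ck_differentiable (som c 1%N)); exists x.
have n : {near coord c x, om c =1 pull f (om c')}.
  have := open_near oO Ou; apply: near_sub => u [y [[Uy dy'] dy] <-].
  by rewrite (com c c' y Uy dy dy') /pull /f local_rep_coord.
rewrite (near_eq_extd n d1) (extd_pull oO oW OW sf (som c' 1%N) Ou).
by rewrite /f local_rep_coord.
Qed.

Variables (gM : metric_components M) (gN : metric_components N) (mu : components N).
Hypotheses (gM_riem : riemannian gM) (a_isom : isometric gN a) (mu_moment : moment_map gN a mu).

(** S is the differential of the gauge action a(-h x) between the two target charts, so invariance
    of the metric and of mu and equivariance of nu give the target half; its determinant is positive
    by [jac_act_pos]. The conclusions are in the form that [bps1_frame] consumes. *)
Lemma frame_change x U s c d U' s' c' d' :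
  local_data phi x U s c d -> local_data phi x U' s' c' d' ->
  let y := coord d (phi (s x)) in let y' := coord d' (phi (s' x)) in
  let T := jac idfun c c' x in exists S, [/\ 0 < \det T, 0 < \det S,
      covd A phi s c d x *m S = T *m covd A phi s' c' d' x &
      curvature A s c x = T *m curvature A s' c' x *m T^T] /\
    [/\ gM c (coord c x) = T *m gM c' (coord c' x) *m T^T,
      gN d y = S *m gN d' y' *m S^T, mu d y = mu d' y' *m S^T & nu a d' y' = nu a d y *m S].
Proof.
move=> [oU Ux ls dx dsx] [oU' U'x ls' dx' dsx'] y y' T.
have [W [h [oW Wx WU sh E]]] := gauge_transformation oU oU' Ux U'x ls ls'.
have lsW : local_section W s by apply: local_sectionW ls => z /WU[].
have lsW' : local_section W s' by apply: local_sectionW ls' => z /WU[].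
have ps : phi (s' x) = a (- h x) (phi (s x)) by rewrite E// field_equivariant.
have das : dom d' (a (- h x) (phi (s x))) by rewrite -ps.
pose S := jac (a (- h x)) d d' (phi (s x)).
exists S.
have [_ _ _ ctr] := gM_riem.
have [_ mut _ _] := mu_moment.
have nuS : nu a d' y' = nu a d y *m S by rewrite /y' ps; exact: nu_act.
have [E1 E2] := form_transition oW (conn_smooth A oW lsW') Wx dx dx'.
have cs' := field_continuous oW lsW' Wx.
have [_ J2] := jac_comp dx dx' (@cvg_id _ (nbhs x)) (transition_differentiable dx dx')
  (field_differentiable oW lsW' Wx dx' dsx').
have J1 := jac_gauge oW lsW sh E Wx dx dsx dsx'.
have G := conn_gauge A oW lsW lsW' sh E Wx dx.
split; first split.
- exact: jac_transition_pos.
- exact: jac_act_pos.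
- apply: (covd_gauge_algebra (k := dfun h c x) _ _ nuS); first exact: (etrans (esym J2) J1).
  by rewrite -G.
- by rewrite -(curvature_gauge oW lsW lsW' sh E Wx dx).
split; [exact: (ctr c c' x dx dx')| | |exact: nuS].
  by rewrite /y /y' ps; exact: (a_isom dsx das).
by rewrite /y /y' ps; exact: (mut _ _ _ _ dsx das).
Qed.

End FrameChange.

(** * Solutions on manifolds *)

Section StandardFrame.
Context {R : realType}.
Implicit Types (m n a : 'rV[R]_3) (E F T gN : 'M[R]_3).

Lemma invmx_frame E E' S T : E \in unitmx -> E' \in unitmx -> E *m S = T *m E' ->
  S *m invmx E' = invmx E *m T.
Proof.
move=> uE uE' EE; apply: (can_inj (mulKmx uE)).
by rewrite mulmxA EE mulmxK// mulKVmx.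
Qed.

Lemma mul_row_tr (x y : 'rV[R]_3) : x *m y^T = (pairing x y)%:M.
Proof. by apply/matrixP => i j; rewrite !ord1 [RHS]mxE eqxx mulr1n. Qed.

Lemma det_shear a n : pairing a n = 0 -> \det (1%:M - a^T *m n) = 1.
Proof.
move=> an; have -> : 1%:M - a^T *m n = 1%:M + (- a)^T *m n.
  by rewrite linearN/= mulNmx.
rewrite det_rank1; have -> : pairing (- a) n = - pairing a n.
  by rewrite !pairing3 !mxE; ring.
by rewrite an oppr0 addr0.
Qed.

Lemma flatten_curv_frame T E F : T \in unitmx -> E \in unitmx ->
  flatten_curv (T *m E) (T *m F *m T^T) = flatten_curv E F.
Proof.
move=> uT uE; rewrite /flatten_curv.
have uTE : T *m E \in unitmx by rewrite unitmx_mul uT uE.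
have -> : invmx (T *m E) = invmx E *m invmx T.
  apply: (can_inj (mulKmx uTE)); rewrite mulmxV//.
  by rewrite -mulmxA (mulmxA E) mulmxV// mul1mx mulmxV.
rewrite trmx_mul -!mulmxA; congr (_ *m _); rewrite !mulmxA mulVmx// mul1mx.
by rewrite -(mulmxA F) -trmx_mul mulVmx// trmx1 mulmx1.
Qed.

(** The shear 1 - a^T n has determinant 1 and fixes both m^sharp, as a annihilates it, and m, as m
    annihilates n. Hence it changes neither the conformal factor nor the condition on F. *)
Lemma flatten_curv_shear gN m n a F : pairing m n = 0 -> pairing a n = 0 ->
  pairing a (sharp gN m) = 0 -> F^T = - F ->
  let E := 1%:M - a^T *m n in
  kap gN m (flatten_curv E F) = kap gN m F /\
  (sharp gN m *m flatten_curv E F = 0 <-> sharp gN m *m F = 0).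
Proof.
move=> mn an aX aF E; have dE : \det E = 1 by exact: det_shear.
have uE : E \in unitmx by rewrite unitmxE dE unitr1.
have uEt : (invmx E)^T \in unitmx by rewrite unitmx_tr unitmx_inv.
have XE : sharp gN m *m invmx E = sharp gN m.
  have h : sharp gN m *m E = sharp gN m.
    rewrite /E mulmxBr mulmx1 (mulmxA (sharp gN m)) mul_row_tr pairingC aX.
    by rewrite mul_scalar_mx scale0r subr0.
  by rewrite -{1}h mulmxK.
have mE : m *m (invmx E)^T = m.
  have h : m *m E^T = m.
    rewrite /E linearB/= trmx1 mulmxBr mulmx1 trmx_mul trmxK (mulmxA m) mul_row_tr mn.
    by rewrite mul_scalar_mx scale0r subr0.
  by rewrite -{1}h trmx_inv mulmxK// unitmx_tr.
split; first by apply: kap_congr => //; rewrite det_inv dE invr1.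
rewrite /flatten_curv !mulmxA XE; split=> h; last by rewrite h mul0mx.
by rewrite -[LHS](mulmxK uEt) h mul0mx.
Qed.

Lemma std_metric_bps1 gM gN m n a F T : posdef gM -> posdef gN -> m != 0 ->
  pairing m n = 0 -> pairing a n = 0 -> pairing a (sharp gN m) = 0 ->
  F^T = - F -> 0 < \det T ->
  let E := T *m (1%:M - a^T *m n) in
  bps1_mx gM gN m E (T *m F *m T^T) <->
  sharp gN m *m F = 0 /\ gM = T *m std_metric gN m n a F *m T^T.
Proof.
move=> pM pN m0 mn an aX aF dT E.
have uT : T \in unitmx by rewrite unitmxE unitfE gt_eqF.
have dE : \det (1%:M - a^T *m n) = 1 by exact: det_shear.
have uE : 1%:M - a^T *m n \in unitmx by rewrite unitmxE dE unitr1.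
have dTE : 0 < \det E by rewrite /E det_mulmx dE mulr1.
rewrite bps1_standard//; last exact: antisym_congr.
have [k X] := flatten_curv_shear mn an aX aF.
rewrite /E flatten_curv_frame// k std_metric_frame//.
by split=> -[h1 h2]; split; [exact/X| |exact/X|]; rewrite h2 trmx_mul !mulmxA.
Qed.

(** Cartan's formula. It identifies the condition L_(mu^sharp) A = 0 of [standard_at] with the
    condition on the curvature in [std_metric_bps1]. *)
Lemma lie_form_cartan (O : set 'rV[R]_3) (X om : 'rV[R]_3 -> 'rV[R]_3) v : open O -> O v ->
  smooth O X -> smooth O om -> (forall y, O y -> pairing (om y) (X y) = 0) ->
  lie_form X om v = X v *m extd om v.
Proof.
move=> oO Ov sX som omX; have := grad_pairing0 oO Ov som sX omX.
rewrite /lie_form /extd mulmxBr; move=> /eqP; rewrite addr_eq0 => /eqP ->.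
by rewrite opprK.
Qed.

End StandardFrame.

Section Solutions.
Context {R : realType} (N : manifold3 R) (gN : metric_components N).
Variables (a : u1_action N) (mu : components N).
Hypotheses (gN_riem : riemannian gN) (a_isom : isometric gN a).
Hypothesis mu_moment : moment_map gN a mu.

Lemma mu_smooth d : smooth (img d) (mu d).
Proof.
have [[sm _] _ _ _] := mu_moment; have := sm d.
by rewrite setTI.
Qed.

Lemma axial_extd_mu d y : img d y -> axial (extd (mu d) y) = rdet (gN d y) *: nu a d y.
Proof.
move=> [z dz <-]; have [_ _ H _] := mu_moment; have := H d z dz => /= {}H.
apply: eq_on_cross_row => v w; rewrite -bil_axial ?extd_antisym// H volE.
by rewrite [RHS]pairingC pairingZl.
Qed.

Lemma mu_nu d y : img d y -> pairing (mu d y) (nu a d y) = 0.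
Proof. by move=> [z dz <-]; have [_ _ _ H] := mu_moment; exact: H. Qed.

Variables (M : manifold3 R) (gM : metric_components M) (P : u1_bundle M).
Variables (A : connection P) (phi : assoc_section P a).
Hypothesis gM_riem : riemannian gM.

Lemma bps_at_mx al be ga x U s c d : local_data phi x U s c d ->
  let y := coord d (phi (s x)) in
  bps_eqs al be ga (gM c (coord c x)) (gN d y) (mu d y) (nu a d y)
      (covd A phi s c d x) (curvature A s c x) <->
  bps1_mx (gM c (coord c x)) (gN d y) (mu d y) (covd A phi s c d x) (curvature A s c x) /\
  bps2_mx al be ga (gN d y) (mu d y) (nu a d y) (covd A phi s c d x) (curvature A s c x).
Proof.
move=> [oU Ux ls dx dsx] y; apply: bps_eqsP.
- exact: (metric_posdef gM_riem (img_coord dx)).1.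
- by apply: posdef_unit; exact: (metric_posdef gN_riem (img_coord dsx)).
- exact: extd_antisym.
Qed.

(** Since [bps_at] ranges over all trivialisations and charts, an equation verified in one of them
    has to be carried to the others. *)
Lemma bps1_invariant x U s c d U' s' c' d' :
  local_data phi x U s c d -> local_data phi x U' s' c' d' ->
  bps1_mx (gM c' (coord c' x)) (gN d' (coord d' (phi (s' x)))) (mu d' (coord d' (phi (s' x))))
    (covd A phi s' c' d' x) (curvature A s' c' x) ->
  bps1_mx (gM c (coord c x)) (gN d (coord d (phi (s x)))) (mu d (coord d (phi (s x))))
    (covd A phi s c d x) (curvature A s c x).
Proof.
move=> D D'; have [S [[dT dS EE FE] [gE hE mE _]]] :=
  frame_change A gM_riem a_isom mu_moment D D'.
apply: (bps1_frame dT dS _ _ gE hE mE EE FE); last exact: extd_antisym.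
by apply: posdef_unit; case: D' => _ _ _ dx _; exact: (metric_posdef gM_riem (img_coord dx)).
Qed.

Lemma smooth_local_rep U s c d : open U -> local_section U s ->
  smooth (coord c @` ((U `&` (phi \o s) @^-1` dom d) `&` dom c)) (local_rep (phi \o s) c d).
Proof.
move=> oU ls; have [_ sf] := field_smooth phi oU ls.
move=> n; apply: Ck_subset (sf c d n) => u [y [[Uy dy] dcy] <-].
by exists y.
Qed.

Lemma open_field_dom U s d : open U -> local_section U s ->
  open (U `&` (phi \o s) @^-1` dom d).
Proof.
move=> oU ls; rewrite openE => x [Ux dx]; have nU : nbhs x U by exact: open_nbhs_nbhs.
have nd : nbhs x ((phi \o s) @^-1` dom d).
  by apply: (field_continuous oU ls Ux); apply: open_nbhs_nbhs; split=> //; exact: dom_open.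
exact: (near_setI nU nd).
Qed.

Lemma curvature_pull U s c d x V (om : components N) : open U -> local_section U s -> U x ->
  dom c x -> dom d (phi (s x)) -> open V -> smooth_form V om ->
  (forall z, U z -> V (phi (s z))) ->
  (forall z, U z -> dom c z -> dom d (phi (s z)) ->
     conn A s c (coord c z) = om d (coord d (phi (s z))) *m (jac (phi \o s) c d z)^T) ->
  curvature A s c x =
    jac (phi \o s) c d x *m extd (om d) (coord d (phi (s x))) *m (jac (phi \o s) c d x)^T.
Proof.
move=> oU ls Ux dx dsx oV [som _] UV connE.
have oU1 := @open_field_dom U s d oU ls.
have oO := open_coord_image (c := c) oU1.
set O := coord c @` _ in oO; have oW := open_coord_image (c := d) oV.
set W := coord d @` _ in oW.
have Ou : O (coord c x) by exists x.
have sf := @smooth_local_rep U s c d oU ls.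
set f := local_rep (phi \o s) c d in sf.
have OW u : O u -> W (f u).
  move=> [y [[Uy dy] dcy] <-]; rewrite /f local_rep_coord//.
  by exists (phi (s y)) => //; split=> //; exact: UV.
have dA := conn_differentiable A oU ls Ux dx.
have n : {near coord c x, conn A s c =1 pull f (om d)}.
  have := open_near oO Ou; apply: near_sub => u [y [[Uy dy] dcy] <-].
  by rewrite connE// /pull /f local_rep_coord.
rewrite /curvature (near_eq_extd n dA) (extd_pull oO oW OW (sf 2) (som d 1%N) Ou).
by rewrite /f local_rep_coord.
Qed.

Lemma mu_sharp_smooth d : smooth (img d) (mu_sharp gN mu d).
Proof.
apply: smooth_msharp; first exact: img_open.
- exact: metric_smooth.
- exact: mu_smooth.
- by move=> y; exact: metric_posdef.
Qed.

Lemma standard_bps1 x : standard_at gM gN mu A phi x ->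
  exists U s c d, local_data phi x U s c d /\
    bps1_mx (gM c (coord c x)) (gN d (coord d (phi (s x)))) (mu d (coord d (phi (s x))))
    (covd A phi s c d x) (curvature A s c x).
Proof.
move=> [U [s [V [psi [om [[oU Ux ls] [oV _ UV _ dJ] [sfo omE] HU]]]]]].
have [c dx] := dom_cover x; have [d dsx] := dom_cover (phi (s x)).
exists U, s, c, d; split=> //.
have UVz z : U z -> V (phi (s z)) by move=> /UV[].
have [connE gME] := HU x c d Ux dx dsx.
have [mu0 omn omX lie] := omE d _ (UVz x Ux) dsx.
have FE : curvature A s c x = _ :=
  curvature_pull oU ls Ux dx dsx oV sfo UVz (fun z Uz dz dsz => (HU z c d Uz dz dsz).1).
have iy := img_coord dsx.
have EE : covd A phi s c d x = jac (phi \o s) c d x *m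
   (1%:M - (om d (coord d (phi (s x))))^T *m nu a d (coord d (phi (s x)))).
  by rewrite /covd connE trmx_mul trmxK mulmxBr mulmx1 mulmxA.
rewrite EE FE; apply/std_metric_bps1 => //.
- exact: (metric_posdef gM_riem (img_coord dx)).
- exact: (metric_posdef gN_riem iy).
- exact: mu_nu.
- exact: extd_antisym.
- exact: dJ.
split=> //; have oW := open_coord_image (c := d) oV.
have Wv : (coord d @` (V `&` dom d)) (coord d (phi (s x))).
  by exists (phi (s x)) => //; split=> //; exact: UVz.
have Wi : coord d @` (V `&` dom d) `<=` img d by move=> u [z [_ dz] <-]; exact: img_coord.
have sX : smooth (coord d @` (V `&` dom d)) (mu_sharp gN mu d).
  by move=> k; exact: Ck_subset Wi (mu_sharp_smooth d k).
have omX' y : (coord d @` (V `&` dom d)) y -> pairing (om d y) (mu_sharp gN mu d y) = 0.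
  by move=> [z [Vz dz] <-]; have [] := omE d z Vz dz.
have [som _] := sfo.
by rewrite -lie; apply/esym; exact: (lie_form_cartan oW Wv sX (som d) omX').
Qed.

Lemma standard_bps_at x : standard_at gM gN mu A phi x -> bps_at gM gN mu A phi 0 0 0 x.
Proof.
move=> /standard_bps1[U [s [c [d [D H]]]]] U' s' c' d' D'.
apply/(bps_at_mx 0 0 0 D'); split; first exact: (bps1_invariant D' D H).
by rewrite /bps2_mx !scale0r !addr0.
Qed.

Lemma covdE s c d z : dom c z ->
  covariant_jacobian (nu a d) (local_rep (phi \o s) c d) (conn A s c) (coord c z) =
  covd A phi s c d z.
Proof. by move=> dz; rewrite /covariant_jacobian local_rep_coord. Qed.

Variables (al be ga : R).
Hypothesis bps : forall z, bps_at gM gN mu A phi al be ga z.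

Lemma bps1_at z U s c d : local_data phi z U s c d ->
  bps1_mx (gM c (coord c z)) (gN d (coord d (phi (s z)))) (mu d (coord d (phi (s z))))
    (covd A phi s c d z) (curvature A s c z).
Proof. by move=> D; have := bps D; move=> /(bps_at_mx al be ga D)[]. Qed.

Section LocalData.
Variables (x : M) (U : set M) (s : M -> total P) (c : chart M) (d : chart N).
Hypothesis D : local_data phi x U s c d.

Let Om := coord c @` ((U `&` (phi \o s) @^-1` dom d) `&` dom c).

Let Om_open : open Om.
Proof.
by have [oU _ ls _ _] := D; apply: open_coord_image; exact: open_field_dom.
Qed.

Let Om_data u : Om u -> exists z, [/\ local_data phi z U s c d, coord c z = u &
  local_rep (phi \o s) c d u = coord d (phi (s z))].
Proof.
move=> [z [[Uz dz] dcz] <-]; exists z; have [oU _ ls _ _] := D.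
by split=> //; rewrite local_rep_coord.
Qed.

Let rep_img u : Om u -> img d (local_rep (phi \o s) c d u).
Proof. by move=> /Om_data[z [[_ _ _ _ dz] _ ->]]; exact: img_coord. Qed.

Let rep_smooth : smooth Om (local_rep (phi \o s) c d).
Proof. by have [oU _ ls _ _] := D; exact: smooth_local_rep. Qed.

Let conn_local_smooth : smooth Om (conn A s c).
Proof.
have [oU _ ls _ _] := D; have [sc _] := conn_smooth A oU ls.
move=> n; apply: Ck_subset (sc c n) => u [z [[Uz _] dz] <-].
by exists z.
Qed.

Let metric_local u : Om u -> posdef (gM c u).
Proof.
move=> /Om_data[z [[_ _ _ dz _] <- _]].
exact: (metric_posdef gM_riem (img_coord dz)).
Qed.

Let bps_local u : Om u -> bps1_mx (gM c u) (gN d (local_rep (phi \o s) c d u))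
  (mu d (local_rep (phi \o s) c d u))
  (covariant_jacobian (nu a d) (local_rep (phi \o s) c d) (conn A s c) u)
  (extd (conn A s c) u).
Proof.
move=> /Om_data[z [Dz <- ->]]; have [_ _ _ dz _] := Dz; rewrite covdE//.
exact: bps1_at Dz.
Qed.

Let gN_pos y : img d y -> posdef (gN d y) := @metric_posdef R N gN gN_riem d y.
Let kill y (iy : img d y) := nu_killing gN_riem a_isom iy.

Lemma curved_near_regular B : open B -> B x -> curvature A s c x != 0 ->
  nu a d (coord d (phi (s x))) != 0 ->
  exists z, [/\ B z, local_data phi z U s c d, curvature A s c z != 0 &
   [/\ nu a d (coord d (phi (s z))) != 0, mu d (coord d (phi (s z))) != 0 &
     covd A phi s c d z \in unitmx]].
Proof.
move=> oB Bx Fx nx; have [oU Ux ls dx dsx] := D.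
pose W := coord c @` ((B `&` (U `&` (phi \o s) @^-1` dom d)) `&` dom c).
have oW : open W.
  by apply: open_coord_image; apply: openI => //; exact: open_field_dom.
have WO : W `<=` Om by move=> u [z [[Bz Uz] dz] <-]; exists z.
have Wx : W (coord c x) by exists x.
have nx' : nu a d (local_rep (phi \o s) c d (coord c x)) != 0 by rewrite local_rep_coord.
have [u [z [[Bz [Uz dsz]] dz] zu] H] := near_regular (@img_open _ _ d) (@metric_smooth R N gN gN_riem d)
  (@mu_smooth d) (@nu_smooth R N a d) gN_pos (@axial_extd_mu d) (@mu_nu d) kill
  Om_open rep_img rep_smooth conn_local_smooth metric_local bps_local oW WO Wx Fx nx'.
have rz : local_rep (phi \o s) c d (coord c z) = coord d (phi (s z)) by exact: local_rep_coord.
have cz := covdE s d dz; rewrite -zu rz cz in H; have [h1 h2 h3 h4] := H.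
exists z; split; [exact: Bz| |exact: h1|by split].
split; [exact: oU|exact: Uz|exact: ls|exact: dz|exact: dsz].
Qed.

Lemma gauge_near_regular : nu a d (coord d (phi (s x))) != 0 ->
  mu d (coord d (phi (s x))) != 0 -> covd A phi s c d x \in unitmx ->
  exists V h, [/\ open V, V x, V `<=` U `&` dom c, smooth_fun V h &
    forall z, V z -> local_data phi z U s c d /\ let y := coord d (phi (s z)) in
    [/\ nu a d y != 0, mu d y != 0, covd A phi s c d z \in unitmx,
     pairing (conn A s c (coord c z) + dfun h c z) (nu a d y *m invmx (covd A phi s c d z)) = 0 &
     pairing (conn A s c (coord c z) + dfun h c z)
       (mu_sharp gN mu d y *m invmx (covd A phi s c d z)) = 0]].
Proof.
move=> n0 m0 uE; have [oU Ux ls dx dsx] := D.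
have Ox : Om (coord c x) by exists x.
have rx : local_rep (phi \o s) c d (coord c x) = coord d (phi (s x)) by exact: local_rep_coord.
have n0' : nu a d (local_rep (phi \o s) c d (coord c x)) != 0 by rewrite rx.
have m0' : mu d (local_rep (phi \o s) c d (coord c x)) != 0 by rewrite rx.
have uE' : covariant_jacobian (nu a d) (local_rep (phi \o s) c d) (conn A s c) (coord c x)
    \in unitmx by rewrite covdE.
have [V [k [[oV Vx VO sk] HV]]] := regular_gauge (@img_open _ _ d) (@metric_smooth R N gN gN_riem d)
  (@mu_smooth d) (@nu_smooth R N a d) gN_pos (@axial_extd_mu d) (@mu_nu d) kill
  Om_open rep_img rep_smooth conn_local_smooth metric_local bps_local Ox n0' m0' uE'.
pose W := [set z | (U `&` (phi \o s) @^-1` dom d) z /\ (dom c z /\ V (coord c z))].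
have oW : open W.
  rewrite openE => z [Uz [dz Vz]].
  have h1 : nbhs z (U `&` (phi \o s) @^-1` dom d).
    by apply: open_nbhs_nbhs; split=> //; exact: open_field_dom.
  have h2 : nbhs z (dom c) by apply: open_nbhs_nbhs; split=> //; exact: dom_open.
  have h3 : nbhs z (coord c @^-1` V).
    by apply: (coord_continuous dz); exact: open_nbhs_nbhs.
  exact: (near_setI h1 (near_setI h2 h3)).
pose h (z : M) := k (coord c z).
have hp u : V u -> h (point c u) = k u.
  by move=> Vu; have [z [_ dz] <-] := VO u Vu; rewrite /h !coordK.
exists W, h; split.
- exact: oW.
- by split.
- by move=> z [[Uz _] [dz _]].
- move=> c1 j; have oI := open_coord_image (c := c1) oW.
  pose O1 := coord c1 @` (W `&` dom c1).
  have tr : Ck j O1 (coord c \o point c1).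
    apply: Ck_subset (transition_smooth c1 c j) => u [z [[_ [dz _]] dz1] <-].
    by exists z.
  apply: (Ck_comp (@coordinatized_rV R 3) oI _ (sk j) tr) => u [z [[_ [dz Vz]] dz1] <-].
  by rewrite /= coordK.
move=> z [[Uz dsz] [dz Vz]]; split.
  split; [exact: oU|exact: Uz|exact: ls|exact: dz|exact: dsz].
have rz : local_rep (phi \o s) c d (coord c z) = coord d (phi (s z)) by exact: local_rep_coord.
have cz := covdE s d dz; have := HV _ Vz; rewrite rz cz.
have -> : dfun h c z = grad k (coord c z); last by [].
apply/rowP => i; rewrite !mxE; apply: near_eq_derive.
have := open_near oV Vz; apply: near_sub => u Vu.
exact: hp.
Qed.

End LocalData.

Lemma curved_closure x : curved_at A phi x ->
  closure [set x | regular_at mu A phi x] x.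
Proof.
move=> [U [s [c [d [D Fx nx]]]]] B; rewrite nbhsE => -[B' [oB' B'x] B'B].
have [z [B'z Dz _ [h1 h2 h3]]] := curved_near_regular D oB' B'x Fx nx.
by exists z; split; [exists U, s, c, d|exact: B'B].
Qed.

Lemma curved_coefficients x : curved_at A phi x -> [/\ al = 0, be = 0 & ga = 0].
Proof.
move=> [U [s [c [d [D Fx nx]]]]].
have [z [_ Dz Fz [nz mz uz]]] := curved_near_regular D openT I Fx nx.
have [_ _ _ dz dsz] := Dz; have iy := img_coord dsz.
have [_ b2] := (bps_at_mx al be ga Dz).1 (bps Dz).
apply: (bps2_coefficients (metric_posdef gN_riem iy) _ uz Fz mz nz _ b2).
  exact: extd_antisym.
exact: mu_nu.
Qed.

(** The gauge function is found in one chart at the source and one at the target; [frame_change]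
    carries the resulting identities to every other pair of charts. *)
Lemma adapted_gauge x : regular_at mu A phi x ->
  exists V s, [/\ open V, V x, local_section V s &
    forall z c d, V z -> dom c z -> dom d (phi (s z)) -> let y := coord d (phi (s z)) in
      let E := covd A phi s c d z in
    [/\ nu a d y != 0, mu d y != 0, E \in unitmx,
     pairing (conn A s c (coord c z)) (nu a d y *m invmx E) = 0 &
     pairing (conn A s c (coord c z)) (mu_sharp gN mu d y *m invmx E) = 0]].
Proof.
move=> [U [s [c [d [D n0 m0 uE]]]]].
have [V [h [oV Vx VU sh HV]]] := gauge_near_regular D n0 m0 uE.
have [oU _ ls dcx _] := D.
have lsV : local_section V s by apply: local_sectionW ls => z /VU[].
pose s' z := ract (s z) (h z).
have ls' : local_section V s' by exact: local_section_ract.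
exists V, s'; split; [exact: oV|exact: Vx|exact: ls'|].
move=> z c1 d1 Vz dz1 dsz1 y1 E1.
have [Dz /=] := HV z Vz; set y := coord d (phi (s z)); set E := covd A phi s c d z.
move=> [nz mz uE' An AX].
have [_ _ _ dz dsz] := Dz.
have D1 : local_data phi z V s' c1 d1 by split.
have [S [[dT dS EE _] [_ gE mE nE]]] := frame_change A gM_riem a_isom mu_moment Dz D1.
set T := jac idfun c c1 z in dT EE.
have uT : T \in unitmx by rewrite unitmxE unitfE gt_eqF.
have uS : S \in unitmx by rewrite unitmxE unitfE gt_eqF.
have uE1 : E1 \in unitmx.
  have : T *m E1 \in unitmx by rewrite -EE unitmx_mul uE' uS.
  by rewrite unitmx_mul => /andP[].
have AE := conn_gauge A oV lsV ls' sh (fun z _ => erefl) Vz dz.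
have A1E := (form_transition oV (conn_smooth A oV ls') Vz dz dz1).1.
have XE : mu_sharp gN mu d1 y1 = mu_sharp gN mu d y *m S.
  rewrite /mu_sharp /sharp mE gE -/y1.
  have ug : gN d1 y1 \in unitmx.
    exact: (posdef_unit (metric_posdef gN_riem (img_coord dsz1))).
  have uSt : S^T \in unitmx by rewrite unitmx_tr.
  have -> : invmx (S *m gN d1 y1 *m S^T) = invmx S^T *m invmx (gN d1 y1) *m invmx S.
    have uu : S *m gN d1 y1 *m S^T \in unitmx by rewrite !unitmx_mul uS ug uSt.
    apply: (can_inj (mulKmx uu)); rewrite mulmxV// -!mulmxA (mulKVmx uSt) (mulKVmx ug).
    by rewrite mulmxV.
  by rewrite -!mulmxA mulVmx// mulmx1 (mulKVmx uSt).
(* The pairing does not depend on the frames, because the inverses of E and [E1] are intertwined by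
   S and T. *)
have key w : pairing (conn A s' c1 (coord c1 z)) (w *m S *m invmx E1) =
    pairing (conn A s c (coord c z) + dfun h c z) (w *m invmx E).
  rewrite -AE A1E pairing_mul trmxK -/T; congr (pairing _ _).
  by rewrite -!mulmxA (invmx_frame uE' uE1 EE).
split; [| |exact: uE1| |].
- by rewrite nE; apply: contraNneq nz => h0; rewrite -(mulmxK uS (nu a d y)) h0 mul0mx.
- by apply: contraNneq mz => h0; rewrite mE h0 mul0mx.
- by rewrite nE key.
- by rewrite XE key.
Qed.

End Solutions.

Section Straightening.
Context {R : realType}.

Lemma near_eq_jac (M N : manifold3 R) (f g : M -> N) c d x : dom c x ->
  (\forall z \near x, f z = g z) -> differentiable_at f c d x -> jac f c d x = jac g c d x.
Proof.
move=> dx fg df; have nn := near_point (P := [set z | f z = g z]) dx fg.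
apply: near_eq_jacobian df; apply: near_sub nn => u [_ /= h].
by rewrite /local_rep /= h.
Qed.

(** Everything follows from T = (1 + A^T (n E^-1)) E: the first factor has determinant 1 + A(n E^-1)
    = 1, and T sends X E^-1 back to X as soon as A annihilates X E^-1. *)
Lemma adapted_covd (T E : 'M[R]_3) (A n om : 'rV[R]_3) : E = T - A^T *m n -> E \in unitmx ->
  A = om *m T^T -> pairing A (n *m invmx E) = 0 ->
  [/\ \det T = \det E, E = T *m (1%:M - om^T *m n) &
    forall X, pairing A (X *m invmx E) = 0 -> pairing om X = 0].
Proof.
move=> EE uE AE An.
have TE : T = (1%:M + A^T *m (n *m invmx E)) *m E.
  by rewrite mulmxDl mul1mx -!mulmxA mulVmx// mulmx1 {1}EE subrK.
split; first by rewrite TE det_mulmx det_rank1 An addr0 mul1r.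
  by rewrite mulmxBr mulmx1 EE AE trmx_mul trmxK mulmxA.
move=> X AX; have XT : X *m invmx E *m T = X.
  rewrite TE (mulmxA (X *m invmx E)) mulmxDr mulmx1 (mulmxA _ A^T) mul_row_tr pairingC AX mul_scalar_mx.
  by rewrite scale0r addr0 mulmxKV.
by rewrite -AX -{1}XT AE pairing_mul trmxK.
Qed.

(** U is kept inside a single chart of the source, so that forms can be pulled back by psi through
    that chart alone; smoothness of psi in other charts comes from the transition maps. *)
Lemma local_inverse (M N : manifold3 R) (V : set M) (f : M -> N) x : open V -> V x ->
  smooth_map V f ->
  (forall z c d, V z -> dom c z -> dom d (f z) -> 0 < \det (jac f c d z)) ->
  exists (U : set M) (W : set N) (psi : N -> M) (c : chart M),
  [/\ open U, U x, U `<=` V `&` dom c, open W & smooth_map W psi] /\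
  ((forall z, U z -> W (f z) /\ psi (f z) = z) /\
   (forall y, W y -> U (psi y) /\ f (psi y) = y)).
Proof.
move=> oV Vx [cf sf] Jf.
have [c dx] := dom_cover x; have [d dfx] := dom_cover (f x).
have oVd : open (V `&` f @^-1` dom d).
  rewrite openE => z [Vz dz]; have nV : nbhs z V by exact: open_nbhs_nbhs.
  have nd : nbhs z (f @^-1` dom d).
    by apply: (cf z Vz); apply: open_nbhs_nbhs; split=> //; exact: dom_open.
  exact: (near_setI nV nd).
pose O := coord c @` ((V `&` f @^-1` dom d) `&` dom c).
have oO : open O by exact: open_coord_image.
have Ox : O (coord c x) by exists x.
pose F := local_rep f c d.
have sF : smooth O F.
  by move=> k; apply: Ck_subset (sf c d k) => u [z [[Vz dz] dcz] <-]; exists z.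
have uJ : 'J F (coord c x) \in unitmx.
  by rewrite unitmxE unitfE gt_eqF//; exact: (Jf x c d Vx dx dfx).
have [U0 [V0 [G [[oU0 U0x U0O oV0 sG] [HU HV _]]]]] := inverse_function oO Ox sF uJ.
pose U := [set z | (V `&` f @^-1` dom d) z /\ (dom c z /\ U0 (coord c z))].
pose W := [set y | dom d y /\ V0 (coord d y)].
pose psi y := point c (G (coord d y)).
have psiE y : W y -> exists z, [/\ psi y = z, U z & G (coord d y) = coord c z].
  move=> [dy V0y]; have [U0y _] := HV _ V0y; have [z [[Vz dz] dcz] zG] := U0O _ U0y.
  by exists z; rewrite /psi -zG coordK//; split=> //; split=> //; split=> //; rewrite zG.
have oW : open W.
  rewrite openE => y [dy V0y].
  have h2 : nbhs y (dom d) by apply: open_nbhs_nbhs; split=> //; exact: dom_open.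
  have h3 : nbhs y (coord d @^-1` V0).
    by apply: (coord_continuous dy); exact: open_nbhs_nbhs.
  exact: (near_setI h2 h3).
exists U, W, psi, c; split; [split|split].
- rewrite openE => z [Vz [dz U0z]].
  have h1 : nbhs z (V `&` f @^-1` dom d) by exact: open_nbhs_nbhs.
  have h2 : nbhs z (dom c) by apply: open_nbhs_nbhs; split=> //; exact: dom_open.
  have h3 : nbhs z (coord c @^-1` U0).
    by apply: (coord_continuous dz); exact: open_nbhs_nbhs.
  exact: (near_setI h1 (near_setI h2 h3)).
- by split=> //; split.
- by move=> z [[Vz _] [dz _]].
- exact: oW.
- split=> [y Wy|d1 c1 k].
    have [z [_ [_ [dcz _]] Gz]] := psiE y Wy; have [dy V0y] := Wy.
    have c1 : {for y, continuous (coord d)} by exact: coord_continuous.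
    have c2 : {for coord d y, continuous G} by exact: (Ck_continuous (sG 0%N)).
    have c3 : {for G (coord d y), continuous (point c)}.
      by apply: point_continuous; rewrite Gz; exact: img_coord.
    exact: (continuous_comp c1 (continuous_comp c2 c3)).
  pose t1 := coord d \o point d1; pose t2 := coord c1 \o point c.
  pose T1 := coord d1 @` (dom d `&` dom d1); pose T2 := coord c @` (dom c1 `&` dom c).
  have oT1 : open T1 by apply: open_coord_image; exact: dom_open.
  have oT2 : open T2 by apply: open_coord_image; exact: dom_open.
  have st1 j : Ck j T1 t1.
    by apply: Ck_subset (transition_smooth d1 d j) => u [z [dz dz1] <-]; exists z.
  have st2 j : Ck j T2 t2.
    by apply: Ck_subset (transition_smooth c c1 j) => u [z [dz dz1] <-]; exists z.
  pose S1 := T1 `&` t1 @^-1` V0.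
  have oS1 : open S1.
    by apply: (open_preim oT1 oV0) => u Tu; exact: (Ck_continuous (st1 0%N) Tu).
  have st1' j : Ck j S1 t1 by apply: Ck_subset (st1 j) => u [].
  have sG1 j : Ck j S1 (fun u => G (t1 u)).
    apply: (Ck_comp_mx (@coordinatized_rV R 3) oS1 oV0 _ (sG j) (st1' j)).
    by move=> u [].
  pose S2 := S1 `&` (fun u => G (t1 u)) @^-1` T2.
  have oS2 : open S2 by apply: open_preim => // u Tu; exact: (Ck_continuous (sG1 0%N)).
  have sG2 : Ck k S2 (fun u => G (t1 u)) by apply: Ck_subset (sG1 k) => u [].
  have S2T u : S2 u -> T2 (G (t1 u)) by move=> [].
  have sc := Ck_comp_mx (@coordinatized_rV R 3) oS2 oT2 S2T (st2 k) sG2.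
  apply: Ck_subset sc => u [y [[Wy dy1] dpy] <-].
  have [z [pz [_ [dcz _]] Gz]] := psiE y Wy; have [dy V0y] := Wy.
  have ty : t1 (coord d1 y) = coord d y by rewrite /t1 /= coordK.
  split; last by rewrite /= ty Gz; exists z => //; split=> //; rewrite -pz.
  by split; [exists y|rewrite /= ty].
- move=> z [[Vz dz] [dcz U0z]]; have [V0z Gz] := HU _ U0z.
  rewrite /F local_rep_coord// in V0z Gz.
  by split=> //; rewrite /psi Gz coordK.
- move=> y Wy; have [z [pz Uz Gz]] := psiE y Wy; rewrite pz; split=> //.
  have [dy V0y] := Wy; have [[_ dfz] [dcz _]] := Uz.
  have := (HV _ V0y).2; rewrite Gz /F local_rep_coord// => h.
  by rewrite -(coordK dfz) h coordK.
Qed.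

End Straightening.

Section StandardForm.
Context {R : realType} (N : manifold3 R) (gN : metric_components N).
Variables (a : u1_action N) (mu : components N).
Hypotheses (gN_riem : riemannian gN) (a_isom : isometric gN a).
Hypothesis mu_moment : moment_map gN a mu.
Variables (M : manifold3 R) (gM : metric_components M) (P : u1_bundle M).
Variables (A : connection P) (phi : assoc_section P a).
Hypothesis gM_riem : riemannian gM.
Variables (al be ga : R).
Hypothesis bps : forall z, bps_at gM gN mu A phi al be ga z.

Lemma regular_standard x : regular_at mu A phi x -> standard_at gM gN mu A phi x.
Proof.
move=> /(adapted_gauge gN_riem a_isom mu_moment gM_riem bps)[V [s [oV Vx ls HV]]].
pose f := phi \o s.
have smf : smooth_map V f := field_smooth phi oV ls.
have dJE z c d : V z -> dom c z -> dom d (f z) ->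
    \det (jac f c d z) = \det (covd A phi s c d z) /\ 0 < \det (jac f c d z).
  move=> Vz dz dsz; have [nz mz uE An AX] := HV z c d Vz dz dsz.
  have D : local_data phi z V s c d by split; [exact: oV|exact: Vz|exact: ls|exact: dz|exact: dsz].
  have b1 := bps1_at gN_riem gM_riem bps D.
  have iy := img_coord dsz.
  have dE := bps1_det_gt0 (metric_posdef gM_riem (img_coord dz)) (metric_posdef gN_riem iy)
    (mu_nu mu_moment iy) b1 nz uE.
  set E := covd A phi s c d z in uE An dE *.
  have TE : jac f c d z = (1%:M + (conn A s c (coord c z))^T *m (nu a d (coord d (phi (s z))) *m invmx E)) *m E.
    rewrite mulmxDl mul1mx -!mulmxA mulVmx// mulmx1 /E /covd subrK.
    by [].
  have dJ : \det (jac f c d z) = \det E.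
    by rewrite TE det_mulmx det_rank1 An addr0 mul1r.
  by rewrite dJ.
have [U [W [psi [c [[oU Ux UVc oW smp] [HU HW]]]]]] :=
  local_inverse oV Vx smf (fun z c d Vz dz dsz => (dJE z c d Vz dz dsz).2).
have UV : U `<=` V by move=> z /UVc[].
have Uc z : U z -> dom c z by move=> /UVc[].
have lsU : local_section U s by exact: local_sectionW ls.
(* The connection form transported to the target by the inverse of phi, in which phi becomes the
   identity. *)
pose om d := pull (local_rep psi d c) (conn A s c).
have omE y d : W y -> dom d y ->
    om d (coord d y) = conn A s c (coord c (psi y)) *m (jac psi d c y)^T.
  by move=> Wy dy; rewrite /om /pull (local_rep_coord _ _ dy).
have dpsi y d : W y -> dom d y -> differentiable_at psi d c y.
  by move=> Wy dy; apply: (smooth_map_differentiable smp Wy dy); apply: Uc; case: (HW y Wy).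
(* Pulling [om] back by f returns the connection form, since psi o f is the identity near z and its
   Jacobian is a transition matrix. *)
have connE z c1 d : U z -> dom c1 z -> dom d (f z) ->
    conn A s c1 (coord c1 z) = om d (coord d (f z)) *m (jac f c1 d z)^T.
  move=> Uz dz dfz; have [Wz pz] := HU z Uz.
  have cf := field_continuous (phi := phi) oV ls (UV z Uz).
  have df := field_differentiable (phi := phi) oV ls (UV z Uz) dz dfz.
  have [dpf Jpf] := jac_comp dz dfz cf df (dpsi _ d Wz dfz).
  have n : \forall z' \near z, (psi \o f) z' = idfun z'.
    have nU : nbhs z U by exact: open_nbhs_nbhs.
    by apply: filterS nU => z' /HU[].
  have Jid := near_eq_jac dz n dpf.
  have [FT _] := form_transition oU (conn_smooth A oU lsU) Uz dz (Uc z Uz).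
  have Oz := omE (f z) d Wz dfz; rewrite pz in Oz.
  apply: (etrans FT); apply: (etrans (f_equal (fun B => _ *m B^T) (etrans (esym Jid) Jpf))).
  rewrite trmx_mul mulmxA; exact: (f_equal (fun w => w *m (jac f c1 d z)^T) (esym Oz)).
have omsm : smooth_form W om.
  split=> [d k|d d' y Wy dy dy'].
    have oS := open_coord_image (c := d) oW; have oT := open_coord_image (c := c) oU.
    have ST u : (coord d @` (W `&` dom d)) u -> (coord c @` (U `&` dom c)) (local_rep psi d c u).
      move=> [y [Wy dy] <-]; have [Uy _] := HW y Wy; rewrite local_rep_coord//.
      by exists (psi y) => //; split=> //; exact: Uc.
    have [sc _] := conn_smooth A oU lsU; apply: (Ck_pull oS oT ST _ (sc c k)).
    have [_ sp] := smp; apply: Ck_subset (sp d c k.+1) => u [y [Wy dy] <-].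
    by exists y => //; split=> //; apply: Uc; case: (HW y Wy).
  apply: (etrans (omE y d Wy dy)).
  apply: (etrans _ (f_equal (fun w => w *m (jac idfun d d' y)^T) (esym (omE y d' Wy dy')))).
  have [_ J] := jac_comp dy dy' (@cvg_id _ (nbhs y)) (transition_differentiable dy dy') (dpsi y d' Wy dy').
  rewrite -mulmxA -trmx_mul; exact: (f_equal (fun B => _ *m B^T) J).
have UW z : U z -> W (phi (s z)) by move=> /HU[].
have facts z c1 d : U z -> dom c1 z -> dom d (phi (s z)) ->
    let v := coord d (phi (s z)) in
    [/\ mu d v != 0, pairing (om d v) (nu a d v) = 0,
      pairing (om d v) (mu_sharp gN mu d v) = 0, mu_sharp gN mu d v *m extd (om d) v = 0 &
      gM c1 (coord c1 z) = jac f c1 d z *m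
        std_metric (gN d v) (mu d v) (nu a d v) (om d v) (extd (om d) v) *m (jac f c1 d z)^T].
  move=> Uz dz dsz v; have [nz mz uE An AX] := HV z c1 d (UV z Uz) dz dsz.
  have D : local_data phi z U s c1 d.
    by split; [exact: oU|exact: Uz|exact: lsU|exact: dz|exact: dsz].
  have [_ EE H] := adapted_covd (T := jac f c1 d z) (E := covd A phi s c1 d z)
    (om := om d (coord d (phi (s z)))) erefl uE (connE z c1 d Uz dz dsz) An.
  have omn := H _ An; have omX := H _ AX.
  have FE := curvature_pull (A := A) (phi := phi) oU lsU Uz dz dsz oW omsm UW
    (fun z' Uz' dz' dsz' => connE z' c1 d Uz' dz' dsz').
  have b1 := bps1_at gN_riem gM_riem bps D; rewrite EE FE in b1.
  have iy := img_coord dsz.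
  have [XF gE] := (std_metric_bps1 (metric_posdef gM_riem (img_coord dz)) (metric_posdef gN_riem iy)
    mz (mu_nu mu_moment iy) omn omX (extd_antisym _ _) (dJE z c1 d (UV z Uz) dz dsz).2).1 b1.
  by split.
exists U, s, W, psi, om; split.
- by split.
- split; [exact: oW|exact: smp|exact: HU|exact: HW|].
  by move=> z c1 d Uz dz dsz; exact: (dJE z c1 d (UV z Uz) dz dsz).2.
- split=> // d y Wy dy v; have [Uy fy] := HW y Wy.
  have {}fy : phi (s (psi y)) = y by exact: fy.
  have dfy : dom d (phi (s (psi y))) by rewrite fy.
  have := facts (psi y) c d Uy (Uc _ Uy) dfy; rewrite fy -/v => -[m0 omn omX XF _].
  split=> //; have oS := open_coord_image (c := d) oW.
  have Sv : (coord d @` (W `&` dom d)) v by exists y.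
  have Si : coord d @` (W `&` dom d) `<=` img d by move=> u [z [_ dz] <-]; exact: img_coord.
  have sX : smooth (coord d @` (W `&` dom d)) (mu_sharp gN mu d).
    by move=> k; exact: (Ck_subset Si (mu_sharp_smooth gN_riem mu_moment d k)).
  have omX' u : (coord d @` (W `&` dom d)) u -> pairing (om d u) (mu_sharp gN mu d u) = 0.
    move=> [z [Wz dz] <-]; have [Uz fz] := HW z Wz.
    have {}fz : phi (s (psi z)) = z by exact: fz.
    have dfz : dom d (phi (s (psi z))) by rewrite fz.
    by have := facts (psi z) c d Uz (Uc _ Uz) dfz; rewrite fz => -[].
  have [som _] := omsm.
  by rewrite (lie_form_cartan oS Sv sX (som d) omX').
move=> z c1 d Uz dz dsz u v T; split; first exact: connE.
by have [] := facts z c1 d Uz dz dsz.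
Qed.

End StandardForm.

Theorem theorem4p1 (R : realType) (N : manifold3 R) (gN : metric_components N)
    (a : u1_action N) (mu : components N)
    (gN_riem : riemannian gN) (a_isom : isometric gN a)
    (a_nontriv : nontrivial_action a) (mu_moment : moment_map gN a mu)
    (al be ga : R) :
  (forall (M : manifold3 R) (gM : metric_components M) (P : u1_bundle M)
      (A : connection P) (phi : assoc_section P a),
    riemannian gM ->
    (forall x, bps_at gM gN mu A phi al be ga x) ->
    (exists x, curved_at A phi x) ->
    [/\ al = 0, be = 0 & ga = 0]) /\
  (al = 0 -> be = 0 -> ga = 0 ->
    forall (M : manifold3 R) (gM : metric_components M) (P : u1_bundle M)
      (A : connection P) (phi : assoc_section P a),
    riemannian gM ->
    (forall x, standard_at gM gN mu A phi x ->
       bps_at gM gN mu A phi al be ga x) /\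
    ((forall x, bps_at gM gN mu A phi al be ga x) ->
       (forall x, regular_at mu A phi x -> standard_at gM gN mu A phi x) /\
       [set x | curved_at A phi x] `<=`
         closure [set x | regular_at mu A phi x])).
Proof.
split=> [M gM P A phi gM_riem bps [x cx]|al0 be0 ga0 M gM P A phi gM_riem].
  exact: (curved_coefficients gN_riem a_isom mu_moment gM_riem bps cx).
split=> [x st|bps].
  rewrite al0 be0 ga0.
  exact: (standard_bps_at gN_riem a_isom mu_moment gM_riem st).
split=> x; first exact: (regular_standard gN_riem a_isom mu_moment gM_riem bps).
exact: (curved_closure gN_riem a_isom mu_moment gM_riem bps).
Qed.
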